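(* Suppose the environment law $Q$ satisfies $\mathbb{E}_Q\big[\log\frac{1-\alpha_0}{\alpha_0}\big]=0$, $\sigma^2:=\mathrm{Var}_Q\big[\log\frac{1-\alpha_0}{\alpha_0}\big]>0$, and, for some $0<\eta_0<1/2$, $\sup\{x: Q[\alpha_0\ge x]=1\}=\sup\{x: Q[\alpha_0\le 1-x]=1\}\ge\eta_0$. Let $\gamma>0$. There exists $c_1=c_1(Q)>0$ such that for all $n>3$ $$1\le\mathbb{E}_Q\left[\mathbb{E}^\alpha_{m_n}[\mathcal{L}(W_n,T_{m_n})]\right]\le c_1.$$ In particular, for all positive increasing sequences $(\theta(n))_n$, $$Q\left[\mathbb{E}^\alpha_{m_n}[\mathcal{L}(W_n,T_{m_n})]>\theta(n)\right]\le\frac{c_1}{\theta(n)}.$$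
   Context: Random walk in random environment. $\alpha=(\alpha_i)_{i\in\mathbb{Z}}$ is a sequence of i.i.d. $(0,1)$-valued random variables on a probability space $(\Omega_1,\mathcal{F}_1,Q)$ (the environment); $\beta_i=1-\alpha_i$. For a fixed environment $\alpha$, $(X_n)_{n\in\mathbb{N}}$ is the Markov chain on $\mathbb{Z}$ with $\mathbb{P}^\alpha[X_n=i+1\mid X_{n-1}=i]=\alpha_i$, $\mathbb{P}^\alpha[X_n=i-1\mid X_{n-1}=i]=\beta_i$; $\mathbb{P}^\alpha_a$, $\mathbb{E}^\alpha_a$ are its law and expectation given $X_0=a$. $\mathbb{E}_Q$ is expectation under $Q$. $\log_p$ ($p\ge2$) is the $p$-times iterated logarithm. Local time: $\mathcal{L}(k,T)=\sum_{i=1}^T \mathbf{1}_{\{X_i=k\}}$ and, for $V\subset\mathbb{Z}$, $\mathcal{L}(V,T)=\sum_{j\in V}\mathcal{L}(j,T)$ ($k,T$ possibly random). $T_x=\inf\{k\ge1: X_k=x\}$ ($+\infty$ if no such $k$). Potential: $\epsilon_i=\log\frac{1-\alpha_i}{\alpha_i}$, $S_0=0$, $S_k-S_j=\sum_{j+1\le i\le k}\epsilon_i$ for all integers $k>j$. Valleys: a triplet $\{M',m,M''\}$ (with $M'\le m\le M''$) is a valley if $S_{M'}=\max_{M'\le t\le m}S_t$, $S_{M''}=\max_{m\le t\le M''}S_t$, $S_m=\min_{M'\le t\le M''}S_t$ (if $m$ is not unique take the one of smallest absolute value). Its depth is $d([M',M''])=\min(S_{M'}-S_m,S_{M''}-S_m)$.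 Right refinement: take $m\le M_1<m_1\le M''$ with $S_{M_1}-S_{m_1}=\max_{m\le t'\le t''\le M''}(S_{t'}-S_{t''})$ (smallest absolute values if not unique); it yields the valleys $\{M',m,M_1\}$ and $\{M_1,m_1,M''\}$. Left refinement is defined symmetrically. Let $\gamma>0$ be a parameter and $\Gamma_n=\log n+\gamma\log_2 n$, $n>3$. A valley $\{M',m,M''\}$ contains $0$ and is of depth larger than $\Gamma_n$ if (1) $0\in[M',M'']$; (2) $d([M',M''])\ge\Gamma_n$; (3) if $m<0$, $S_{M''}-\max_{m\le t\le0}S_t\ge\gamma\log_2 n$, and if $m>0$, $S_{M'}-\max_{0\le t\le m}S_t\ge\gamma\log_2 n$. Basic valley $\{M_n',m_n,M_n\}$: let $\{M',m_n,M''\}$ be the smallest valley containing $0$ and of depth larger than $\Gamma_n$ (smallest: no other valley constructed inside it by refinement satisfies (1)-(3)). Then: if $m_n>0$, $M_n'=\sup\{l\in\mathbb{Z}_-: l<m_n,\ S_l-S_{m_n}\ge\Gamma_n,\ S_l-\max_{0\le k\le m_n}S_k\ge\gamma\log_2n\}$ and $M_n=\inf\{l\in\mathbb{Z}_+: l>m_n,\ S_l-S_{m_n}\ge\Gamma_n\}$; if $m_n<0$, $M_n'=\sup\{l\in\mathbb{Z}_-: l<m_n,\ S_l-S_{m_n}\ge\Gamma_n\}$ and $M_n=\inf\{l\in\mathbb{Z}_+: l>m_n,\ S_l-S_{m_n}\ge\Gamma_n,\ S_l-\max_{m_n\le k\le0}S_k\ge\gamma\log_2n\}$; if $m_n=0$,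 $M_n'=\sup\{l\in\mathbb{Z}_-: l<0,\ S_l-S_{m_n}\ge\Gamma_n\}$ and $M_n=\inf\{l\in\mathbb{Z}_+: l>0,\ S_l-S_{m_n}\ge\Gamma_n\}$. These objects depend on $\gamma$ and are considered for environments for which the basic valley exists. $W_n=\{M_n',M_n'+1,\dots,m_n,\dots,M_n-1,M_n\}$. *)

(* Defs.v *)
From Stdlib Require Import Relations.
From HB Require Import structures.
From mathcomp Require Import all_boot all_order all_algebra.
From mathcomp Require Import all_classical all_reals all_analysis.
Import Order.TTheory GRing.Theory Num.Theory.
Import numFieldNormedType.Exports.

Set Implicit Arguments.
Unset Strict Implicit.
Unset Printing Implicit Defensive.

Local Open Scope classical_set_scope.
Local Open Scope ring_scope.

Definition iid d (T : measurableType d) (R : realType) (Q : probability T R)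
    (alpha : int -> {RV Q >-> R}) : Prop :=
  (forall (s : seq int) (B : int -> set R), uniq s ->
     (forall i, measurable (B i)) ->
     Q (\bigcap_(i in [set i | i \in s]) (alpha i @^-1` B i)) =
     (\prod_(i <- s) Q (alpha i @^-1` B i))%E) /\
  (forall i (B : set R), measurable B ->
     Q (alpha i @^-1` B) = Q (alpha 0 @^-1` B)).

Definition iterlog (R : realType) (p : nat) (x : R) : R := iter p (@ln R) x.

Section walk.
Context {R : realType}.

Definition rwre_step (e : int -> R) (i j : int) : R :=
  if j == i + 1 then e i else if j == i - 1 then 1 - e i else 0.

(* P e a is the quenched law of the walk X in the environment e, started
   at a; the Markov property is written on cylinders, which avoids
   conditioning on null events. *)
Definition quenched_laws d (T : measurableType d) (X : nat -> T -> int)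
    (P : (int -> R) -> int -> probability T R) : Prop :=
  (forall n k, measurable [set w | X n w = k]) /\
  (forall (e : int -> R) (a : int), (forall i, 0 < e i < 1) ->
     P e a [set w | X 0%N w = a] = 1%E /\
     forall (n : nat) (x : nat -> int),
       P e a [set w | forall k, (k <= n.+1)%N -> X k w = x k] =
       (P e a [set w | forall k, (k <= n)%N -> X k w = x k] *
        (rwre_step e (x n) (x n.+1))%:E)%E).

(* Times are extended reals, +oo standing for a point never visited. *)
Definition return_time (x : nat -> int) (k : int) : \bar R :=
  ereal_inf [set (i%:R%:E : \bar R) | i in [set i : nat | (1 <= i)%N /\ x i = k]].

Definition local_time (x : nat -> int) (k : int) (t : \bar R) : \bar R :=
  (\sum_(1 <= i <oo | i%:R%:E <= t) ((x i == k)%:R)%:E)%E.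

Definition local_time_set (x : nat -> int) (V : set int) (t : \bar R) : \bar R :=
  (\esum_(k in V) local_time x k t)%E.

Definition quenched_local_time d (T : measurableType d) (X : nat -> T -> int)
    (P : (int -> R) -> int -> probability T R)
    (e : int -> R) (m : int) (V : set int) : \bar R :=
  (\int[P e m]_w
     local_time_set (fun i => X i w) V (return_time (fun i => X i w) m))%E.

End walk.

Section potential.
Context {R : realType}.

Definition log_ratio (a : R) : R := ln ((1 - a) / a).

Definition potential (e : int -> R) (k : int) : R :=
  match k with
  | Posz n => \sum_(1 <= i < n.+1) log_ratio (e i%:Z)
  | Negz n => - \sum_(0 <= i < n.+1) log_ratio (e (- i%:Z))
  end.

Lemma potentialB (e : int -> R) (k : int) :
  potential e k - potential e (k - 1) = log_ratio (e k).
Proof.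
case: k => [[|n]|n].
- by rewrite /= big_geq // big_nat1 oppr0 opprK add0r.
- have -> : n.+1%:Z - 1 = n%:Z by rewrite -addn1 PoszD addrK.
  by rewrite /= [X in X - _]big_nat_recr //= addrAC subrr add0r.
- have -> : Negz n - 1 = Negz n.+1 by rewrite !NegzE -opprD -PoszD addn1.
  by rewrite /= [X in _ - - X]big_nat_recr //= opprK addKr NegzE.
Qed.

End potential.

Section valleys.
Context {R : realType}.
Variable S : int -> R.
Implicit Types a b u v : int.

Definition max_on a b : R := sup [set S t | t in [set t : int | a <= t <= b]].
Definition min_on a b : R := inf [set S t | t in [set t : int | a <= t <= b]].
Definition max_drop a b : R :=
  sup [set S p.1 - S p.2 | p in
    [set p : int * int | [&& a <= p.1, p.1 <= p.2 & p.2 <= b]]].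
Definition max_rise a b : R :=
  sup [set S p.2 - S p.1 | p in
    [set p : int * int | [&& a <= p.1, p.1 <= p.2 & p.2 <= b]]].

Record triplet := Triplet { vleft : int; vbot : int; vright : int }.

(* Sites at the same distance from 0, on opposite sides, are not separated
   by the "smallest absolute value" rule, here or in the refinements. *)
Definition is_valley (V : triplet) : Prop :=
  [/\ vleft V <= vbot V <= vright V,
      S (vleft V) = max_on (vleft V) (vbot V),
      S (vright V) = max_on (vbot V) (vright V),
      S (vbot V) = min_on (vleft V) (vright V) &
      forall t, vleft V <= t <= vright V -> S t = S (vbot V) ->
        `|vbot V| <= `|t|].

Definition depth (V : triplet) : R :=
  Num.min (S (vleft V) - S (vbot V)) (S (vright V) - S (vbot V)).

Definition drop_pair a b u v : Prop :=
  [/\ a <= u, u < v, v <= b & S u - S v = max_drop a b].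

Definition rise_pair a b u v : Prop :=
  [/\ a <= u, u < v, v <= b & S v - S u = max_rise a b].

(* Ties: first the top, then the bottom, of smallest absolute value, so that
   the triplets produced by refining a valley are again valleys. *)
Definition right_cut a b M1 m1 : Prop :=
  [/\ drop_pair a b M1 m1,
      forall u v, drop_pair a b u v -> `|M1| <= `|u| &
      forall v, drop_pair a b M1 v -> `|m1| <= `|v|].

Definition left_cut a b m1 M1 : Prop :=
  [/\ rise_pair a b m1 M1,
      forall u v, rise_pair a b u v -> `|M1| <= `|v| &
      forall u, rise_pair a b u M1 -> `|m1| <= `|u|].

Inductive refinement (V : triplet) : triplet -> Prop :=
| right_refinement_outer M1 m1 : right_cut (vbot V) (vright V) M1 m1 ->
    refinement V (Triplet (vleft V) (vbot V) M1)
| right_refinement_inner M1 m1 : right_cut (vbot V) (vright V) M1 m1 ->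
    refinement V (Triplet M1 m1 (vright V))
| left_refinement_inner m1 M1 : left_cut (vleft V) (vbot V) m1 M1 ->
    refinement V (Triplet (vleft V) m1 M1)
| left_refinement_outer m1 M1 : left_cut (vleft V) (vbot V) m1 M1 ->
    refinement V (Triplet M1 (vbot V) (vright V)).

(* G stands for Gamma_n and g for gamma * log_2 n. *)
Variables G g : R.

Definition deep_valley (V : triplet) : Prop :=
  [/\ is_valley V,
      vleft V <= 0 <= vright V,
      G <= depth V,
      (vbot V < 0 -> g <= S (vright V) - max_on (vbot V) 0) &
      (0 < vbot V -> g <= S (vleft V) - max_on 0 (vbot V))].

Definition smallest_deep_valley (V : triplet) : Prop :=
  deep_valley V /\
  forall V', clos_trans triplet refinement V V' -> V' <> V -> ~ deep_valley V'.

Definition left_candidates (m : int) : set int :=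
  [set l | [/\ l <= 0, l < m, G <= S l - S m &
              0 < m -> g <= S l - max_on 0 m]].

Definition right_candidates (m : int) : set int :=
  [set l | [/\ 0 <= l, m < l, G <= S l - S m &
              m < 0 -> g <= S l - max_on m 0]].

Definition basic_valley (B : triplet) : Prop :=
  [/\ exists M' M'', smallest_deep_valley (Triplet M' (vbot B) M''),
      supremums (left_candidates (vbot B)) (vleft B) &
      infimums (right_candidates (vbot B)) (vright B)].

End valleys.

Definition Gamma (R : realType) (gamma : R) (n : nat) : R :=
  ln n%:R + gamma * iterlog 2 n%:R.

Definition is_basic_valley (R : realType) (gamma : R) (n : nat) (e : int -> R)
    (B : triplet) : Prop :=
  basic_valley (potential e) (Gamma gamma n) (gamma * iterlog 2 n%:R) B.

(* A measurable choice of {M_n', m_n, M_n} wherever a basic valley exists;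
   its values elsewhere are arbitrary. *)
Definition basic_valley_choice d (T : measurableType d) (R : realType)
    (gamma : R) (alpha : int -> T -> R) (B : nat -> T -> triplet) : Prop :=
  forall n : nat, (3 < n)%N ->
    (forall V : triplet, measurable [set w | B n w = V]) /\
    (forall w, (exists V, is_basic_valley gamma n (fun i => alpha i w) V) ->
       is_basic_valley gamma n (fun i => alpha i w) (B n w)).

Definition sites (V : triplet) : set int :=
  [set k | vleft V <= k <= vright V].

(* Main.v *)
Require Import Defs.
From Stdlib Require Import Relations.
From HB Require Import structures.
From mathcomp Require Import all_boot all_order all_algebra.
From mathcomp Require Import all_classical all_reals all_analysis.
From mathcomp Require Import measurable_realfun zify ring lra.
Import Order.TTheory GRing.Theory Num.Theory.
Import numFieldNormedType.Exports.

Set Implicit Arguments.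
Unset Strict Implicit.
Unset Printing Implicit Defensive.

Local Open Scope classical_set_scope.
Local Open Scope ring_scope.

(** Write S for the potential and m for the bottom of the basic valley W.  The
    chain killed at its first return to m has the restriction of the reversible
    measure as an excessive measure, so the quenched expectation is at most a
    constant times F = \sum_(k in W) expR (- (S k - S m)), and it is at least 1
    because the first step stays inside W.

    To bound the mean of F uniformly in n, suppose m >= 0 (the other case follows
    by reflecting the path) and let D be the maximum of S on [0, m] minus S m.
    For every a and theta, F <= a + theta^-1 expR (theta (F - a)).  A Lyapunov
    function for the walk gives a small theta, depending only on the law of the
    increments, for which the exponential moment of F on the event
    4^j G <= D < 4^(j+1) G is at most of order 4^j, where G is the prescribed
    depth; with a = 3 j / theta this is summable in j.  The remaining term
    a * P(D >= 4^j G) is summable as well: a valley that is minimal for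
    refinement can only be much deeper than G on the right of 0 if the walk to
    the left of 0 climbs, within about G, to the same height as the walk to the
    right, and neither turns back; the two sides are independent, so optional
    stopping gives a probability of order 2^(-j). *)

(** The bottom m is read off the whole path, so the path seen from m has no usable law. The
    exponential moment of F is therefore summed over every site m that could be the bottom. To the
    right of such an m the walk must climb to G without going below its start, which has weight of
    order 1/G uniformly in m. To the left it must stay between 0 and a height L for at least m
    steps, and these weights add up over m to a mean duration, of order L. With L of order 4^j G the
    depth G cancels: this is where uniformity in n comes from.

    All walks are run for finitely many steps inside a window of radius N, with constants free of N,
    and N is removed at the end by monotone convergence.

    Two facts have to be settled apart. The increments are bounded only almost surely, so the
    environment is clipped. The chosen triplet is arbitrary where no basic valley exists, so almost
    sure existence must be proved for every fixed n. *)

(** * Independence of functions of disjoint sets of steps *)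

Section independence.
Context d (T : measurableType d) (R : realType) (Q : probability T R).
Implicit Types (z : int -> T -> R) (J : pred int).

Definition iid_family z : Prop :=
  [/\ forall i, measurable_fun setT (z i),
      forall (s : seq int) (B : int -> set R), uniq s ->
        (forall i, measurable (B i)) ->
        Q [set w | forall i, i \in s -> B i (z i w)] =
        (\prod_(i <- s) Q (z i @^-1` B i))%E &
      forall i (B : set R), measurable B -> Q (z i @^-1` B) = Q (z 0 @^-1` B)].

Definition cylinders z J : set (set T) :=
  [set A | exists (s : seq int) B, [/\ {subset s <= J}, forall i, measurable (B i) &
     A = [set w | forall i : int, i \in s -> B i (z i w)]]].

Variable z : int -> T -> R.
Hypothesis iidz : iid_family z.

Let mz i : measurable_fun setT (z i). Proof. by case: iidz. Qed.

Let measurable_box (s : seq int) (B : int -> set R) :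
  (forall i, measurable (B i)) ->
  measurable [set w | forall i, i \in s -> B i (z i w)].
Proof.
move=> mB; elim: s => [|j s ih].
  by rewrite (_ : [set _ | _] = setT)//; apply/seteqP; split.
rewrite (_ : [set _ | _] = (z j @^-1` B j) `&`
    [set w | forall i, i \in s -> B i (z i w)]).
  by apply: measurableI => //; rewrite -[X in measurable X]setTI; exact: mz.
apply/seteqP; split => w /=.
  move=> H; split; first by apply: H; rewrite mem_head.
  by move=> i si; apply: H; rewrite inE si orbT.
by move=> [Bj H] i; rewrite inE => /orP[/eqP->//|]; exact: H.
Qed.

Let setI_closed_cylinders J : setI_closed (cylinders z J).
Proof.
move=> _ _ [s1 [B1 [s1J mB1 ->]]] [s2 [B2 [s2J mB2 ->]]].
exists (s1 ++ s2), (fun i => (if i \in s1 then B1 i else setT) `&`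
  (if i \in s2 then B2 i else setT)); split.
- by move=> i; rewrite mem_cat => /orP[/s1J|/s2J].
- by move=> i; apply: measurableI; case: ifP.
- apply/seteqP; split => w /=.
    by move=> [H1 H2] i _; split; case: ifP => // si; [exact: H1|exact: H2].
  move=> H; split=> i si; have := H i; rewrite mem_cat si ?orbT => /(_ isT) [].
    by [].
  by [].
Qed.

Lemma measurable_cylinders J A : <<s cylinders z J >> A -> measurable A.
Proof.
move: A; apply: smallest_sub; first exact: sigma_algebra_measurable.
by move=> _ [s [B [_ mB ->]]]; exact: measurable_box.
Qed.

Let independent_cylinders J1 J2 A1 A2 : (forall i, J1 i -> ~~ J2 i) ->
  cylinders z J1 A1 -> cylinders z J2 A2 -> (Q (A1 `&` A2) = Q A1 * Q A2)%E.
Proof.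
move=> J12 [s1 [B1 [s1J mB1 ->]]] [s2 [B2 [s2J mB2 ->]]].
have [_ indep _] := iidz.
have undupE s (B : int -> set R) : [set w | forall i, i \in s -> B i (z i w)] =
    [set w | forall i, i \in undup s -> B i (z i w)].
  by apply/seteqP; split=> w /= H i; rewrite ?mem_undup => si;
    apply: H; rewrite ?mem_undup.
have s12 i : i \in s2 -> (i \in s1) = false.
  by move=> /s2J; apply: contraTF => /s1J; exact: J12.
rewrite (undupE s1) (undupE s2).
rewrite (_ : _ `&` _ = [set w | forall i, i \in undup s1 ++ undup s2 ->
    (if i \in s1 then B1 i else B2 i) (z i w)]); last first.
  apply/seteqP; split => w /=.
    move=> [H1 H2] i; rewrite mem_cat !mem_undup.
    by have [si _|_ /= si] := boolP (i \in s1); [apply: H1|apply: H2];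
      rewrite mem_undup.
  move=> H; split => i; rewrite mem_undup => si; have := H i;
    rewrite mem_cat !mem_undup si ?orbT => /(_ isT)//.
  by rewrite s12.
rewrite !indep ?undup_uniq//.
rewrite (indep _ (fun i => if i \in s1 then B1 i else B2 i)); last 2 first.
- rewrite cat_uniq !undup_uniq andbT/=; apply/hasPn => i.
  by rewrite !mem_undup => /s12 ->.
- by move=> i; case: ifP.
rewrite big_cat/=; congr (_ * _)%E.
  by apply: eq_big_seq => i; rewrite mem_undup => ->.
by apply: eq_big_seq => i; rewrite mem_undup => /s12 ->.
Qed.

Let dynkin_independent (B : set T) : measurable B ->
  dynkin [set A | measurable A /\ (Q (A `&` B) = Q A * Q B)%E].
Proof.
move=> mB; split => /=.
- by rewrite setTI probability_setT mul1e.
- move=> A [mA AB]; split; first exact: measurableC.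
  rewrite setIC -setDE measureD//; last first.
    by rewrite (le_lt_trans (probability_le1 _ _))// ltry.
  rewrite (setIC B A) [X in (_ - X)%E](_ : _ = (Q A * Q B)%E)//.
  rewrite probability_setC// muleBl ?fin_num_measure// ?mul1e//.
- move=> F tF HF; have mF n : measurable (F n) by case: (HF n).
  have mFB n : measurable (F n `&` B) by exact: measurableI.
  split; first exact: bigcupT_measurable.
  rewrite setI_bigcupl !measure_semi_bigcup//; try exact: bigcupT_measurable; last exact: trivIset_setIr.
  rewrite muleC -[Q B in RHS]fineK ?fin_num_measure// -nneseriesZl//.
  apply: eq_eseriesr => n _; have [_ QE] := HF n.
  by transitivity (Q (F n) * Q B)%E; rewrite ?QE// fineK ?fin_num_measure// muleC.
Qed.

(** The product rule holds on cylinders, which are stable under intersection, and against a fixed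
    second set the sets obeying it form a Dynkin system. The argument is run once for each side. *)
Lemma independent_generated J1 J2 A1 A2 : (forall i, J1 i -> ~~ J2 i) ->
  <<s cylinders z J1 >> A1 -> <<s cylinders z J2 >> A2 ->
  (Q (A1 `&` A2) = Q A1 * Q A2)%E.
Proof.
move=> J12.
have step (J : pred int) (B : set T) : measurable B ->
    (forall A, cylinders z J A -> (Q (A `&` B) = Q A * Q B)%E) ->
    forall A, <<s cylinders z J >> A -> (Q (A `&` B) = Q A * Q B)%E.
  move=> mB AB A sA; have /dynkin_lambda_system H := dynkin_independent mB.
  have [] // := @lambda_system_subset _ _ (@setI_closed_cylinders J) setT _ H
    _ _ A sA.
  by move=> C JC; split; [apply: (@measurable_cylinders J);
    exact: sub_sigma_algebra|exact: AB].
move=> sA1 sA2; apply: (step J1) => //; first exact: measurable_cylinders sA2.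
move=> A cA; rewrite setIC muleC; apply: (step J2) => //.
  by apply: (@measurable_cylinders J1); exact: sub_sigma_algebra.
by move=> C cC; rewrite setIC muleC; exact: (independent_cylinders J12).
Qed.

End independence.

Section independent_functions.
Context d (T : measurableType d) (R : realType) (Q : probability T R).
Variable z : int -> T -> R.
Hypothesis iidz : iid_family Q z.

Definition generated d1 (T1 : measurableType d1) (J : pred int) (V : T -> T1) :=
  forall B, measurable B -> <<s cylinders z J >> (V @^-1` B).

Let mz i : measurable_fun setT (z i). Proof. by case: iidz. Qed.

Lemma measurable_generated d1 (T1 : measurableType d1) J (V : T -> T1) :
  generated J V -> measurable_fun setT V.
Proof.
by move=> mV _ B mB; rewrite setTI; apply: (measurable_cylinders iidz (mV _ mB)).
Qed.

(** On rectangles independence is the product rule, so by uniqueness the joint law of [V1] and [V2]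
    is the product of their laws; Tonelli then splits the integral. *)
Lemma integral_independent d1 d2 (T1 : measurableType d1)
    (T2 : measurableType d2) (J1 J2 : pred int) (V1 : T -> T1) (V2 : T -> T2)
    (f : T1 * T2 -> \bar R) :
  (forall i, J1 i -> ~~ J2 i) -> generated J1 V1 -> generated J2 V2 ->
  measurable_fun setT f -> (forall p, 0 <= f p)%E ->
  (\int[Q]_w f (V1 w, V2 w) = \int[Q]_w \int[Q]_v f (V1 w, V2 v))%E.
Proof.
move=> J12 gV1 gV2 mf f0.
have mV1 := measurable_generated gV1; have mV2 := measurable_generated gV2.
pose X1 : {RV Q >-> T1} := mfun_Sub (mem_set mV1).
pose X2 : {RV Q >-> T2} := mfun_Sub (mem_set mV2).
have mV12 : measurable_fun setT (fun w => (V1 w, V2 w)).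
  exact: measurable_fun_pair.
pose X12 : {RV Q >-> (T1 * T2)%type} := mfun_Sub (mem_set mV12).
transitivity (\int[distribution Q X12]_p f p)%E.
  by rewrite ge0_integral_distribution.
transitivity (\int[distribution Q X1 \x distribution Q X2]_p f p)%E.
  apply: eq_measure_integral => A mA _.
  apply/esym/product_measure_unique => // A1 A2 mA1 mA2.
  by apply: (independent_generated iidz J12); [exact: gV1|exact: gV2].
rewrite fubini_tonelli1//.
rewrite ge0_integral_distribution//; last 2 first.
- exact: measurable_fun_fubini_tonelli_F.
- by move=> x; apply: integral_ge0.
apply: eq_integral => w _ /=; rewrite /fubini_F ge0_integral_distribution//.
exact: measurable_fun_pair2.
Qed.

End independent_functions.

Lemma integral_probability_cst d (T : measurableType d) (R : realType)
    (Q : probability T R) (x : \bar R) : (\int[Q]_w x = x)%E.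
Proof. by rewrite integral_cst// [X in (_ * X)%E](probability_setT Q) mule1. Qed.

Lemma bounded_integrable d (T : measurableType d) (R : realType)
    (Q : probability T R) (g : T -> R) (M : R) :
  measurable_fun setT g -> (forall w, `|g w| <= M) ->
  Q.-integrable setT (EFin \o g).
Proof.
move=> mg gM; apply: measurable_bounded_integrable => //.
  by rewrite [X in (X < _)%E](probability_setT Q) ltry.
exists M; split; first exact: num_real.
by move=> x Mx w _ /=; rewrite (le_trans (gM w))// ltW.
Qed.

(** * Markov chains driven by the steps *)

Section driven_chain.
Variables (R : realType) (d' : measure_display) (T' : measurableType d').
Variable step : T' * R -> T'.

Fixpoint run (x0 : T') (delta : nat -> R) (n : nat) : T' :=
  if n is k.+1 then step (run x0 delta k, delta k) else x0.

Hypothesis mstep : measurable_fun setT step.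

Variables (d : measure_display) (T : measurableType d) (Q : probability T R).
Variables (z : int -> T -> R) (c v : R).

Definition centered_walk : Prop :=
  [/\ iid_family Q z, forall i w, `|z i w| <= c,
      (\int[Q]_w (z 0 w)%:E = 0)%E & (\int[Q]_w (z 0 w ^+ 2)%:E = v%:E)%E].

Hypothesis Hz : centered_walk.
Let iidz : iid_family Q z. Proof. by case: Hz. Qed.
Let mz i : measurable_fun setT (z i). Proof. by case: iidz. Qed.

Variable sg : R.

Lemma generated_run (J : pred int) (x0 : T') (idx : nat -> int) n :
  (forall k, (k < n)%N -> J (idx k)) ->
  generated z J (fun w => run x0 (fun k => sg * z (idx k) w) n).
Proof.
move=> Jidx.
suff : @measurable_fun _ _ (g_sigma_algebraType (cylinders z J)) T' setT
    (fun w => run x0 (fun k => sg * z (idx k) w) n).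
  by move=> H B mB; have := H measurableT B mB; rewrite setTI.
elim: n Jidx => [|n ih] Jidx /=; first exact: measurable_cst.
apply: (measurableT_comp mstep); apply: measurable_fun_pair.
  by apply: ih => k kn; apply: Jidx; rewrite ltnS ltnW.
apply: measurable_funM => //.
move=> _ B mB; rewrite setTI; apply: sub_sigma_algebra.
exists [:: idx n], (fun=> B); split => //.
  by move=> i; rewrite inE => /eqP ->; exact: Jidx.
by apply/seteqP; split => w /=; [move=> ? i; rewrite inE => /eqP ->|apply;
  rewrite inE].
Qed.

Lemma measurable_run (x0 : T') (idx : nat -> int) n :
  measurable_fun setT (fun w => run x0 (fun k => sg * z (idx k) w) n).
Proof. exact: (measurable_generated iidz (@generated_run predT _ _ _ _)). Qed.

(** Transition operator of the chain. The sign [sg] will be 1 or -1 according to the direction in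
    which a path is read. *)
Definition kernel_op (f : T' -> \bar R) (x : T') : \bar R :=
  (\int[Q]_w f (step (x, (sg * z 0 w)%R)))%E.

Lemma kernel_op_ge0 f : (forall x, 0 <= f x)%E -> forall x, (0 <= kernel_op f x)%E.
Proof. by move=> f0 x; apply: integral_ge0. Qed.

Let mstepz : measurable_fun setT (fun p : T' * T => step (p.1, sg * z 0 p.2)).
Proof.
apply: (measurableT_comp mstep); apply: measurable_fun_pair => //.
by apply: measurable_funM => //; exact: measurableT_comp.
Qed.

Lemma measurable_kernel_op f : (forall x, 0 <= f x)%E -> measurable_fun setT f ->
  measurable_fun setT (kernel_op f).
Proof.
move=> f0 mf.
apply: (@measurable_fun_fubini_tonelli_F _ _ _ _ _ Q
  (fun p : T' * T => f (step (p.1, (sg * z 0 p.2)%R)))) => //.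
exact: (measurableT_comp mf mstepz).
Qed.

Lemma integral_run (f : T' -> \bar R) (x0 : T') (idx : nat -> int) n :
  (forall x, 0 <= f x)%E -> measurable_fun setT f -> injective idx ->
  (\int[Q]_w f (run x0 (fun k => sg * z (idx k) w)%R n) =
   iter n kernel_op f x0)%E.
Proof.
move=> f0 mf inj; elim: n f f0 mf => [|n ih] f f0 mf /=.
  by rewrite integral_probability_cst.
have msg : measurable_fun setT (fun p : T' * R => f (step (p.1, sg * p.2))).
  apply: (measurableT_comp mf); apply: (measurableT_comp mstep).
  by apply: measurable_fun_pair => //; apply: measurable_funM.
pose J1 : pred int := fun i => `[< exists2 k, (k < n)%N & idx k = i >].
pose J2 : pred int := pred1 (idx n).
have := @integral_independent _ _ _ _ _ iidz _ _ _ _ J1 J2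
  (fun w => run x0 (fun k => sg * z (idx k) w) n) (z (idx n))
  (fun p => f (step (p.1, (sg * p.2)%R))).
move=> /= -> //; last 3 first.
- move=> i /asboolP[k kn <-]; rewrite /J2/=; apply: contraTN kn => /eqP/inj ->.
  by rewrite ltnn.
- by apply: generated_run => k kn; apply/asboolP; exists k.
- move=> B mB; apply: sub_sigma_algebra; exists [:: idx n], (fun=> B); split => //.
    by move=> i; rewrite inE.
  by apply/seteqP; split => w /=; [move=> ? i; rewrite inE => /eqP ->|apply;
    rewrite inE].
rewrite -[RHS]/(iter n.+1 kernel_op f x0) iterSr -ih//; last 2 first.
- exact: kernel_op_ge0.
- exact: measurable_kernel_op.
apply: eq_integral => w _.
pose X1 : {RV Q >-> R} := mfun_Sub (mem_set (mz (idx n))).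
pose X0 : {RV Q >-> R} := mfun_Sub (mem_set (mz 0)).
set y := run _ _ _.
have my : measurable_fun setT (fun e : R => f (step (y, sg * e))).
  exact: (measurableT_comp msg (pair1_measurable y)).
transitivity (\int[distribution Q X1]_e f (step (y, (sg * e)%R)))%E.
  by rewrite ge0_integral_distribution.
rewrite /kernel_op.
transitivity (\int[distribution Q X0]_e f (step (y, (sg * e)%R)))%E; last first.
  by rewrite ge0_integral_distribution.
apply: eq_measure_integral => A mA _.
by case: iidz => _ _; exact.
Qed.

Hypothesis sgE : sg ^+ 2 = 1.

Lemma integral_quadratic (c0 c1 c2 : R) :
  (\int[Q]_w (c0 + c1 * (sg * z 0 w) - c2 * (sg * z 0 w) ^+ 2)%R%:E =
   (c0 - c2 * v)%:E)%E.
Proof.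
have [_ bz Ez Ez2] := Hz.
have i1 : Q.-integrable setT (EFin \o z 0) by apply: (@bounded_integrable _ _ _ _ _ c) => //.
have i2 : Q.-integrable setT (EFin \o (fun w => z 0 w ^+ 2)).
  apply: (@bounded_integrable _ _ _ _ _ (c ^+ 2)) => [|w]; first exact: measurable_funX.
  by rewrite normrX lerXn2r// ?nnegrE// (le_trans _ (bz 0 w)).
rewrite (_ : (fun w => _) = (fun w => c0%:E + ((c1 * sg)%:E * (z 0 w)%:E +
    (- c2)%:E * (z 0 w ^+ 2)%:E))%E); last first.
  apply/funext => w; rewrite -!EFinM -!EFinD; congr (_%:E).
  by rewrite exprMn sgE; ring.
have i1' : Q.-integrable setT (fun w => (c1 * sg)%:E * (z 0 w)%:E)%E.
  exact: integrableZl.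
have i2' : Q.-integrable setT (fun w => (- c2)%:E * (z 0 w ^+ 2)%:E)%E.
  exact: (integrableZl _ _ i2).
rewrite integralD//; last 2 first.
- exact: finite_measure_integrable_cst.
- exact: integrableD.
rewrite integral_probability_cst integralD//.
rewrite integralZl// Ez mule0 add0e (integralZl _ i2)// Ez2 -EFinM -EFinD.
by congr (_%:E); ring.
Qed.

(** Optional stopping in operator form: [Psi] dominates [f] and does not increase on average in one
    step. The one-step condition is a quadratic majorant in the step, whose mean is given by the
    first two moments. *)
Lemma iter_kernel_op_le (Inv : T' -> Prop) (Psi f : T' -> R) :
  (forall x, 0 <= f x) -> measurable_fun setT f ->
  (forall x, Inv x -> f x <= Psi x) ->
  (forall x e, Inv x -> `|e| <= c -> Inv (step (x, e))) ->
  (forall x, Inv x -> exists c0 c1 c2, c0 - c2 * v <= Psi x /\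
     forall e, `|e| <= c -> Psi (step (x, e)) <= c0 + c1 * e - c2 * e ^+ 2) ->
  forall n x, Inv x -> (iter n kernel_op (EFin \o f) x <= (Psi x)%:E)%E.
Proof.
move=> f0 mf fPsi InvS Hstep.
have ge0 n x : (0 <= iter n kernel_op (EFin \o f) x)%E.
  elim: n x => [|n ih] x; first by rewrite /= lee_fin.
  exact: kernel_op_ge0.
have meas n : measurable_fun setT (iter n kernel_op (EFin \o f)).
  elim: n => [|n ih]; first exact/measurable_EFinP.
  exact: (measurable_kernel_op (ge0 n) ih).
have [_ bz _ _] := Hz.
have sg1 : `|sg| = 1.
  by apply/eqP; rewrite -(@eqrXn2 _ 2)// -normrX sgE normr1 expr1n.
have bsz w : `|sg * z 0 w| <= c by rewrite normrM sg1 mul1r.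
elim=> [|n ih] x Ix; first by rewrite /= lee_fin; exact: fPsi.
have [c0 [c1 [c2 [cPsi cstep]]]] := Hstep _ Ix.
rewrite iterS; apply: (@le_trans _ _ (c0 - c2 * v)%:E); last by rewrite lee_fin.
rewrite -(integral_quadratic c0 c1 c2).
apply: ge0_le_integral => //.
- apply: (measurableT_comp (meas n)); apply: (measurableT_comp mstep).
  by apply: measurable_fun_pair => //; exact: measurable_funM.
- apply/measurable_EFinP; apply: measurable_funB; last first.
    apply: measurable_funM => //; apply: measurable_funX.
    exact: measurable_funM.
  apply: measurable_funD => //; apply: measurable_funM => //.
  exact: measurable_funM.
move=> w _; apply: (@le_trans _ _ (Psi (step (x, sg * z 0 w)))%:E).
  by apply: ih; exact: InvS.
by rewrite lee_fin; exact: cstep.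
Qed.

End driven_chain.

(** * Lyapunov functions *)

Section exit_functional.
Context {R : realType}.
Variables (c v : R).
Hypotheses (c_gt0 : 0 < c) (v_gt0 : 0 < v) (v_le : v <= c ^+ 2).

(** Put [A = x + shift] for a height [x >= 0]. A step bounded by [c] keeps [A] positive and at most
    doubles it; since [A >= 4], the function [expR (- x) * A ^+ 4] is largest at [x = 0]. *)
Definition shift : R := 2 * c + 4.
(** Chosen so that [slope * v >= 2]: the mean loss of a parabola in one step then pays for the
    elapsed unit of time, which is weighted by a factor at most 2. *)
Definition slope : R := 1 + 2 / v.
(* The exponent at which exponential moments of sums of [expR (- S)] are taken;
   this smallness is what makes the one-step drifts below nonpositive. *)
Definition theta : R := v / (8 * shift ^+ 4 * slope).

Let shift_ge4 : 4 <= shift. Proof. by rewrite /shift; have := c_gt0; lra. Qed.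
Let shift_gt0 : 0 < shift. Proof. by have := shift_ge4; lra. Qed.
Let slope_ge1 : 1 <= slope.
Proof. by rewrite /slope lerDl divr_ge0// ltW. Qed.
Let slope_gt0 : 0 < slope. Proof. by have := slope_ge1; lra. Qed.
Let slope_v : 2 <= slope * v.
Proof. by rewrite /slope mulrDl mul1r divfK ?gt_eqF//; have := v_gt0; lra. Qed.
Let shift4_gt0 : 0 < shift ^+ 4. Proof. exact: exprn_gt0. Qed.

Lemma theta_gt0 : 0 < theta.
Proof. by rewrite /theta divr_gt0// !mulr_gt0. Qed.

Let thetaE : theta * shift ^+ 4 * slope = v / 8.
Proof.
rewrite /theta; field.
by rewrite (gt_eqF shift_gt0) (gt_eqF slope_gt0).
Qed.

Lemma theta_le_half : theta <= 1 / 2.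
Proof.
have h1 : v <= shift ^+ 4.
  apply: (le_trans v_le); apply: (@le_trans _ _ (shift ^+ 2)).
    rewrite lerXn2r ?nnegrE ?ltW//; rewrite /shift; have := c_gt0; lra.
  rewrite ler_weXn2l//; have := shift_ge4; lra.
rewrite /theta ler_pdivrMr ?mulr_gt0//.
apply: (le_trans h1).
have -> : 1 / 2 * (8 * shift ^+ 4 * slope) = 4 * slope * shift ^+ 4 by field.
by rewrite ler_peMl ?ltW//; have := slope_ge1; lra.
Qed.

Let weight_le (x : R) : 0 <= x -> expR (- x) * (x + shift) ^+ 4 <= shift ^+ 4.
Proof.
move=> x0; rewrite expRN mulrC ler_pdivrMr ?expR_gt0//.
have -> : expR x = expR (x / 4) ^+ 4.
  by rewrite -expRM_natl; congr expR; field.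
rewrite -exprMn lerXn2r// ?nnegrE.
- by rewrite addr_ge0// ltW.
- by rewrite mulr_ge0 ?expR_ge0// ltW.
apply: (@le_trans _ _ (shift * (1 + x / 4))); last first.
  by rewrite ler_wpM2l ?expR_ge1Dx// ltW.
by have := shift_ge4; nra.
Qed.

Let expR_le (u : R) : 0 <= u -> u <= 1 / 2 -> expR u <= 1 + 2 * u.
Proof.
move=> u0 u1.
have h : 1 - u <= expR (- u) by rewrite expR_ge1Dx.
have -> : expR u = (expR (- u))^-1 by rewrite expRN invrK.
rewrite invf_ple ?posrE ?expR_gt0//; last lra.
apply: le_trans h; rewrite -[_^-1]mul1r ler_pdivrMr; last lra.
nra.
Qed.

(** Since [theta * expR (- x) <= 1 / 2], the exponential is at most [1 + 2 * theta * expR (- x)]; a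
    loss of [2 * theta * expR (- x) * psi] absorbs the excess. *)
Let drift (x psi drop : R) : 0 <= x -> 0 <= psi -> 0 <= drop ->
  2 * theta * expR (- x) * psi <= drop ->
  expR (theta * expR (- x)) * (psi - drop) <= psi.
Proof.
move=> x0 psi0 drop0 H.
have w0 : 0 < expR (- x) := expR_gt0 _.
have w1 : expR (- x) <= 1 by rewrite expR_le1; lra.
have e_le : expR (theta * expR (- x)) <= 1 + 2 * (theta * expR (- x)).
  apply: expR_le; first by rewrite mulr_ge0 ?ltW// theta_gt0.
  apply: le_trans theta_le_half.
  by rewrite -[leRHS]mulr1 ler_wpM2l// ltW// theta_gt0.
have e0 := expR_gt0 (theta * expR (- x)).
have [ld|/ltW ld] := leP drop psi; last first.
  by apply: le_trans psi0; rewrite mulr_ge0_le0 ?(ltW e0)// subr_le0.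
apply: (@le_trans _ _ ((1 + 2 * (theta * expR (- x))) * (psi - drop))).
  by rewrite ler_wpM2r//; lra.
have : 0 <= theta * expR (- x) * drop.
  by rewrite mulr_ge0// mulr_ge0 ?(ltW w0) ?(ltW theta_gt0).
nra.
Qed.

(** The remainder of the second order expansion is exactly [e ^+ 2 / (A ^+ 2 * (A + e))], and
    [A + e <= 2 * A]. This convexity is the source of the loss [v / (2 * A ^+ 3)] in the drifts
    below. *)
Lemma inv_quadratic_le (A e : R) : shift <= A -> `|e| <= c ->
  A^-1 - e / A ^+ 2 + e ^+ 2 / (2 * A ^+ 3) <= (A + e)^-1.
Proof.
move=> sA; rewrite ler_norml => /andP[e1 e2].
have A0 : 0 < A by have := shift_gt0; lra.
have Ae0 : 0 < A + e by move: sA; rewrite /shift; have := c_gt0; lra.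
have Ae2 : A + e <= 2 * A by move: sA; rewrite /shift; have := c_gt0; lra.
have -> : (A + e)^-1 = A^-1 - e / A ^+ 2 + e ^+ 2 / (A ^+ 2 * (A + e)).
  by field; rewrite !gt_eqF.
rewrite lerD2l ler_wpM2l ?sqr_ge0// lef_pV2 ?posrE ?mulr_gt0 ?exprn_gt0//.
have -> : 2 * A ^+ 3 = A ^+ 2 * (2 * A) by ring.
by rewrite ler_wpM2l// exprn_ge0// ltW.
Qed.

Let weight_inv (x : R) : 0 <= x ->
  expR (- x) <= shift ^+ 4 * ((x + shift)^-1) ^+ 4.
Proof.
move=> x0; rewrite exprVn ler_pdivlMr ?weight_le// exprn_gt0//.
by rewrite ltr_wpDl.
Qed.

Section at_height.
Variable x : R.
Hypothesis x_ge0 : 0 <= x.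
Let A := x + shift.
Let A_gt0 : 0 < A. Proof. by rewrite /A ltr_wpDl. Qed.
Let A_ge4 : 4 <= A. Proof. by rewrite /A ler_wpDl. Qed.
Let i := A^-1.
Let i_gt0 : 0 < i. Proof. by rewrite invr_gt0. Qed.
Let iA : i * A = 1. Proof. by rewrite mulVf// gt_eqF. Qed.
Let i_le1 : i <= 1. Proof. by rewrite invf_le1//; have := A_ge4; lra. Qed.
Let thetaw k : 0 <= k ->
  theta * expR (- x) * k <= theta * shift ^+ 4 * i ^+ 4 * k.
Proof.
move=> k0; rewrite ler_wpM2r// -mulrA ler_wpM2l ?(ltW theta_gt0)//.
exact: weight_inv.
Qed.
Let theta_shift : theta * shift ^+ 4 <= v / 8.
Proof. by rewrite -thetaE ler_peMr// mulr_ge0 ?ltW// theta_gt0. Qed.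

(** The identity is harmonic for a centered walk. The correction [- A^-1] makes it lose
    [v / (2 * A ^+ 3)] per step, more than the cost [2 * theta * expR (- x) * A] of the exponential
    weight, which is at most [v / (4 * A ^+ 3)]. *)
Lemma drift_identity :
  expR (theta * expR (- x)) * (A - A^-1 - v / (2 * A ^+ 3)) <= A - A^-1.
Proof.
have iE : v / (2 * A ^+ 3) = v / 2 * i ^+ 3.
  by rewrite /i; field; rewrite gt_eqF.
have i3 : 0 < i ^+ 3 by rewrite exprn_gt0.
apply: drift => //; rewrite ?iE -/i.
- have := A_ge4; have := i_le1; lra.
- by rewrite mulr_ge0 ?ltW// divr_gt0.
have := @thetaw A (ltW A_gt0).
have -> : theta * shift ^+ 4 * i ^+ 4 * A = theta * shift ^+ 4 * i ^+ 3.
  by rewrite exprSr -!mulrA iA mulr1.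
have := theta_shift; have := theta_gt0; have := expR_gt0 (- x).
move=> w0 t0 t1 h.
have h1 : 0 <= theta * expR (- x) * i := mulr_ge0 (mulr_ge0 (ltW t0) (ltW w0)) (ltW i_gt0).
have h2 : theta * shift ^+ 4 * i ^+ 3 <= v / 8 * i ^+ 3.
  by rewrite ler_wpM2r// ltW.
have h3 : 0 < v * i ^+ 3 by rewrite mulr_gt0.
rewrite mulrBr; have -> : 2 * theta * expR (- x) * A = 2 * (theta * expR (- x) * A).
  by rewrite !mulrA.
have -> : 2 * theta * expR (- x) * i = 2 * (theta * expR (- x) * i).
  by rewrite !mulrA.
lra.
Qed.

(** This function lies between 1 and 2, so it controls the exponential moment whatever the exit
    point. *)
Lemma drift_bounded :
  expR (theta * expR (- x)) * (2 - A^-1 - v / (2 * A ^+ 3)) <= 2 - A^-1.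
Proof.
have iE : v / (2 * A ^+ 3) = v / 2 * i ^+ 3.
  by rewrite /i; field; rewrite gt_eqF.
have i3 : 0 < i ^+ 3 by rewrite exprn_gt0.
apply: drift => //; rewrite ?iE -/i.
- have := i_le1; lra.
- by rewrite mulr_ge0 ?ltW// divr_gt0.
have := @thetaw 2 (ler0n _ 2).
have i4 : i ^+ 4 <= i ^+ 3 by rewrite exprS ger_pMl.
have i40 : 0 < i ^+ 4 by rewrite exprn_gt0.
have := theta_shift; have := theta_gt0; have := expR_gt0 (- x).
move=> w0 t0 t1 h.
have h1 : 0 <= theta * expR (- x) * i := mulr_ge0 (mulr_ge0 (ltW t0) (ltW w0)) (ltW i_gt0).
have h2 : theta * shift ^+ 4 * i ^+ 4 <= v / 8 * i ^+ 4.
  by rewrite ler_wpM2r// ltW.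
have h3 : v / 8 * i ^+ 4 <= v / 8 * i ^+ 3 by rewrite ler_wpM2l// divr_ge0// ltW.
have h4 : 0 < v / 8 * i ^+ 3 by rewrite mulr_gt0 ?divr_gt0.
rewrite mulrBr.
have -> : 2 * theta * expR (- x) * i = 2 * (theta * expR (- x) * i).
  by rewrite !mulrA.
lra.
Qed.

(** [A * (H - A)] is, up to the variance, a mean exit time. The term [2 - A^-1] is what the product
    of the elapsed time and the bounded function above gains in one step; the loss [slope * v] pays
    for it, and the loss due to [- H / A] pays for the exponential weight. *)
Lemma drift_parabola H : 2 * A <= H ->
  2 - A^-1 + expR (theta * expR (- x)) *
    (slope * (A * (H - A)) - H / A - (slope * v + H * v / (2 * A ^+ 3))) <=
  slope * (A * (H - A)) - H / A.
Proof.
move=> AH.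
have H0 : 0 < H by have := A_gt0; lra.
have iE : H * v / (2 * A ^+ 3) = H * (v / 2 * i ^+ 3).
  by rewrite /i; field; rewrite gt_eqF.
have i3 : 0 < i ^+ 3 by rewrite exprn_gt0.
set psi := slope * _ - _; set drop := H * v / _.
have AHA : A * A <= A * (H - A) by rewrite ler_wpM2l ?(ltW A_gt0)//; lra.
have psi0 : 0 <= psi.
  have HA : 0 <= A * (H - A) - H / A.
    have -> : A * (H - A) - H / A = H * (A - i) - A * A.
      by rewrite /i; field; rewrite gt_eqF.
    have h : 2 * A * (A - i) <= H * (A - i).
      by rewrite ler_wpM2r//; have := A_ge4; have := i_le1; lra.
    have : 2 * A * (A - i) = 2 * (A * A) - 2 by rewrite mulrBr -mulrA -(mulrA 2) (mulrC A i) iA mulr1.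
    have : 4 * 4 <= A * A by rewrite ler_pM.
    lra.
  apply: (le_trans HA); rewrite /psi lerD2r ler_peMl//.
  by rewrite mulr_ge0 ?ltW//; lra.
have drop0 : 0 <= drop by rewrite /drop !mulr_ge0 ?invr_ge0 ?mulr_ge0 ?exprn_ge0 ?ltW//.
have main : expR (theta * expR (- x)) * (psi - drop) <= psi.
  apply: drift => //.
  have psile : psi <= slope * (A * H).
    rewrite /psi lerBlDr; apply: (@le_trans _ _ (slope * (A * H))).
      by rewrite ler_pM2l// ler_pM2l//; have := A_gt0; lra.
    by rewrite lerDl divr_ge0// ltW.
  have sAH : 0 <= slope * (A * H) by rewrite !mulr_ge0 ?ltW//.
  have := thetaw sAH.
  have -> : theta * shift ^+ 4 * i ^+ 4 * (slope * (A * H)) =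
      theta * shift ^+ 4 * slope * (i ^+ 3 * (i * A) * H).
    by ring.
  rewrite iA mulr1 thetaE => h.
  have h1 : theta * expR (- x) * psi <= theta * expR (- x) * (slope * (A * H)).
    by rewrite ler_wpM2l// mulr_ge0 ?expR_ge0// ltW// theta_gt0.
  have h2 : 0 < v * (i ^+ 3 * H) by rewrite !mulr_gt0.
  rewrite /drop iE.
  have -> : 2 * theta * expR (- x) * psi = 2 * (theta * expR (- x) * psi).
    by rewrite !mulrA.
  lra.
have e1 : 1 <= expR (theta * expR (- x)).
  by apply: le_trans (expR_ge1Dx _); rewrite lerDl mulr_ge0 ?expR_ge0 ?(ltW theta_gt0).
have -> : psi - (slope * v + drop) = (psi - drop) - slope * v by ring.
rewrite mulrBr.
have h : slope * v <= expR (theta * expR (- x)) * (slope * v).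
  by rewrite ler_peMl// mulr_ge0 ?ltW.
have := slope_v; have := i_gt0; rewrite /i; lra.
Qed.

End at_height.

End exit_functional.

(** * Exit and hitting functionals of a walk *)

Section walk_functionals.
Context {R : realType}.

(* The state holds the position [x], the sum of [expR (- x)] over the past
   positions and the elapsed time; it is frozen once [x] leaves [0, L). *)
Definition exit_step (L : R) (p : (R * R * R) * R) : R * R * R :=
  let x := p.1.1.1 in
  if (0 <= x) && (x < L) then (x + p.2, p.1.1.2 + expR (- x), p.1.2 + 1)
  else p.1.

Lemma measurable_exit_step L : measurable_fun setT (exit_step L).
Proof.
have m1 : measurable_fun setT (fun p : (R * R * R) * R => p.1.1.1).
  by do 2 apply: (measurableT_comp measurable_fst); exact: measurable_fst.
have m2 : measurable_fun setT (fun p : (R * R * R) * R => p.1.1.2).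
  apply: (measurableT_comp measurable_snd).
  by apply: (measurableT_comp measurable_fst); exact: measurable_fst.
have m3 : measurable_fun setT (fun p : (R * R * R) * R => p.1.2).
  by apply: (measurableT_comp measurable_snd); exact: measurable_fst.
apply: measurable_fun_ifT; last exact: measurable_fst.
  apply: measurable_and; first exact: measurable_fun_ler.
  exact: measurable_fun_ltr.
apply: measurable_fun_pair; last exact: measurable_funD.
apply: measurable_fun_pair.
  by apply: measurable_funD => //; exact: measurable_snd.
apply: measurable_funD => //; apply: (measurableT_comp (@measurable_expR R)).
exact: measurable_funN.
Qed.

(* The state holds the position and whether level [b] has been reached; from then
   on it is frozen outside (b', b''). *)
Definition hit_step (b b' b'' : R) (p : (R * bool) * R) : R * bool :=
  let x := p.1.1 in
  if p.1.2 && ~~ ((b' < x) && (x < b'')) then p.1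
  else (x + p.2, p.1.2 || (b <= x + p.2)).

Lemma measurable_hit_step b b' b'' : measurable_fun setT (hit_step b b' b'').
Proof.
have m1 : measurable_fun setT (fun p : (R * bool) * R => p.1.1).
  by apply: (measurableT_comp measurable_fst); exact: measurable_fst.
have m2 : measurable_fun setT (fun p : (R * bool) * R => p.1.2).
  by apply: (measurableT_comp measurable_snd); exact: measurable_fst.
have m3 : measurable_fun setT (fun p : (R * bool) * R => p.1.1 + p.2).
  by apply: measurable_funD => //; exact: measurable_snd.
apply: measurable_fun_ifT; first 1 last.
- exact: measurable_fst.
- apply: measurable_fun_pair => //; apply: measurable_or => //.
  exact: measurable_fun_ler.
apply: measurable_and => //; apply: measurable_neg.
by apply: measurable_and; exact: measurable_fun_ltr.
Qed.

Variables (d : measure_display) (T : measurableType d) (Q : probability T R).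
Variables (z : int -> T -> R) (c v : R).
Hypotheses (Hz : centered_walk Q z c v).
Hypotheses (c_gt0 : 0 < c) (v_gt0 : 0 < v) (v_le : v <= c ^+ 2).
Variable sg : R.
Hypothesis sgE : sg ^+ 2 = 1.

Local Notation th := (theta c v).
Local Notation B := (shift c).

Definition exit_chain L idx n w :=
  run (exit_step L) (0, 0, 0) (fun k => sg * z (idx k) w) n.

(** For the chain frozen on leaving [0, G), a position at least [G] means that the exit took place
    through the top. *)
Definition top_weight (G : R) (x : R * R * R) : R :=
  if G <= x.1.1 then expR (th * x.1.2) else 0.

(** Summed over [m], the indicator gives the elapsed time plus one. *)
Definition duration_weight (m : nat) (x : R * R * R) : R :=
  if m%:R <= x.2 then expR (th * x.1.2) else 0.

Lemma measurable_top_weight G : measurable_fun setT (top_weight G).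
Proof.
apply: measurable_fun_ifT => //.
  apply: measurable_fun_ler => //.
  by apply: (measurableT_comp measurable_fst); exact: measurable_fst.
apply: (measurableT_comp (@measurable_expR R)); apply: measurable_funM => //.
by apply: (measurableT_comp measurable_snd); exact: measurable_fst.
Qed.

Lemma measurable_duration_weight m : measurable_fun setT (duration_weight m).
Proof.
apply: measurable_fun_ifT => //.
  by apply: measurable_fun_ler => //; exact: measurable_snd.
apply: (measurableT_comp (@measurable_expR R)); apply: measurable_funM => //.
by apply: (measurableT_comp measurable_snd); exact: measurable_fst.
Qed.

Lemma top_weight_ge0 G x : 0 <= top_weight G x.
Proof. by rewrite /top_weight; case: ifP => // _; exact: expR_ge0. Qed.

Lemma duration_weight_ge0 m x : 0 <= duration_weight m x.
Proof. by rewrite /duration_weight; case: ifP => // _; exact: expR_ge0. Qed.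

Let B_ge4 : 4 <= B. Proof. by rewrite /shift; have := c_gt0; lra. Qed.
Let Bc : 4 <= B - c. Proof. by rewrite /shift; have := c_gt0; lra. Qed.

Let stay (P : R -> Prop) (y c0 : R) : y <= c0 -> exists c0' c1 c2 : R,
  c0' - c2 * v <= c0 /\ forall e, P e -> y <= c0' + c1 * e - c2 * e ^+ 2.
Proof.
by move=> yc; exists c0, 0, 0; split=> [|e _]; rewrite !mul0r subr0// addr0.
Qed.

(** The Lyapunov function is [2 / G] times the exponential weight times the function of
    [drift_identity]: it starts at most at [2 * B / G], and it dominates the weight above [G]
    because [2 * (A - A^-1) >= G] there. *)
Lemma integral_top_weight (G : R) idx n : 0 < G -> injective idx ->
  (\int[Q]_w (top_weight G (exit_chain G idx n w))%:E <= (2 * B / G)%:E)%E.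
Proof.
move=> G0 inj.
have mtop : measurable_fun setT (EFin \o top_weight G).
  by apply/measurable_EFinP; apply: measurable_top_weight.
rewrite (integral_run (measurable_exit_step G) Hz sg (f := EFin \o top_weight G))//;
  last by move=> x; rewrite /= lee_fin top_weight_ge0.
pose Psi (x : R * R * R) := 2 / G * expR (th * x.1.2) *
  ((x.1.1 + B) - (x.1.1 + B)^-1).
apply: (@le_trans _ _ (Psi (0, 0, 0))%:E); last first.
  rewrite lee_fin /Psi /= mulr0 expR0 mulr1 add0r.
  rewrite [leRHS]mulrAC ler_wpM2l ?divr_ge0 ?(ltW G0)//.
  by rewrite gerBl invr_ge0; have := B_ge4; lra.
have G20 : 0 < 2 / G by rewrite divr_gt0.
apply: (iter_kernel_op_le (measurable_exit_step G) Hz sgE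
  (Inv := fun x => - c <= x.1.1)) => /=.
- by move=> x; exact: top_weight_ge0.
- exact: measurable_top_weight.
- move=> [[x a] b] /= xc; rewrite /top_weight /Psi /=.
  have A4 : 4 <= x + B by have := Bc; lra.
  have Ai : (x + B)^-1 <= 1 by rewrite invf_le1; lra.
  case: ifP => Gx; last first.
    by rewrite mulr_ge0 ?mulr_ge0 ?expR_ge0 ?(ltW G20)//; lra.
  rewrite -mulrA mulrCA ler_peMr ?expR_ge0//.
  rewrite mulrAC ler_pdivlMr// mul1r.
  have := B_ge4; lra.
- move=> [[x a] b] e /= xc; rewrite ler_norml => /andP[e1 e2].
  by rewrite /exit_step/=; case: ifP => //= /andP[]; lra.
- move=> [[x a] b] /= xc; rewrite /exit_step /=.
  case: (boolP ((0 <= x) && (x < G))) => [/andP[x0 xG]|_]; last exact: stay.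
  rewrite /Psi /=; set A := x + B.
  have BA : B <= A by rewrite /A; lra.
  have A0 : 0 < A by have := B_ge4; lra.
  pose k := 2 / G * expR (th * (a + expR (- x))).
  have k0 : 0 < k by rewrite /k mulr_gt0 ?expR_gt0.
  have kE : k = 2 / G * expR (th * a) * expR (th * expR (- x)).
    by rewrite /k mulrDr expRD mulrA.
  exists (k * (A - A^-1)), (k * (1 + A ^- 2)), (k / (2 * A ^+ 3)); split.
    have -> : k * (A - A^-1) - k / (2 * A ^+ 3) * v =
        2 / G * expR (th * a) * (expR (th * expR (- x)) *
          (A - A^-1 - v / (2 * A ^+ 3))).
      by rewrite kE; field; rewrite !gt_eqF.
    rewrite ler_wpM2l// ?(mulr_ge0 (ltW G20) (expR_ge0 _))//.
    exact: (drift_identity c_gt0 v_gt0 v_le x0).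
  move=> e ec.
  have := inv_quadratic_le c_gt0 BA ec.
  rewrite (_ : x + e + B = A + e); last by rewrite /A; ring.
  rewrite -/k => h.
  have -> : k * (A - A^-1) + k * (1 + A ^- 2) * e - k / (2 * A ^+ 3) * e ^+ 2 =
      k * (A + e - (A^-1 - e / A ^+ 2 + e ^+ 2 / (2 * A ^+ 3))).
    by field; rewrite gt_eqF.
  by rewrite ler_wpM2l ?(ltW k0)// lerD2l lerN2.
- by have := c_gt0; lra.
Qed.

Let sum_le (N : nat) (b E : R) : 0 <= E ->
  \sum_(m < N) (if m%:R <= b then E else 0) <= (1 + `|b|) * E.
Proof.
move=> E0.
have [b0|b0] := ltP b 0.
  rewrite big1 ?mulr_ge0// ?addr_ge0// => i _; case: ifP => // ib.
  by have := ler0n R i; lra.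
rewrite ger0_norm//.
have : \sum_(m < N) (if m%:R <= b then E else 0) <= (1 + b) * E /\
       \sum_(m < N) (if m%:R <= b then E else 0) <= N%:R * E.
  elim: N => [|N [ih1 ih2]]; first by rewrite big_ord0 mul0r mulr_ge0// addr_ge0.
  rewrite big_ord_recr /= -[N.+1%:R]natr1 mulrDl mul1r.
  case: ifP => [Nb|_]; last by rewrite addr0; split => //; lra.
  split; last by lra.
  by have := ler_wpM2r E0 Nb; lra.
by case.
Qed.

Definition duration_bound L : R :=
  2 + slope v * (B * (2 * (L + c + B))).

(** The Lyapunov function is the exponential weight times [(1 + time) * P2 + P3], where [P2] lies
    between 1 and 2 and the parabola [P3] is the budget for the time still to come. The start [x0]
    is free because the existence of valleys uses a walk started far above 0. *)
Lemma integral_duration_weight_all (L x0 : R) idx n : 0 <= x0 <= L -> injective idx ->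
  (\int[Q]_w ((1 + `|(run (exit_step L) (x0, 0, 0)
      (fun k => sg * z (idx k) w)%R n).2|) *
     expR (th * (run (exit_step L) (x0, 0, 0)
      (fun k => sg * z (idx k) w)%R n).1.2))%:E <=
   (2 + slope v * ((x0 + B) * (2 * (L + c + B))))%:E)%E.
Proof.
move=> /andP[x00 x0L] inj.
pose f (x : R * R * R) := (1 + `|x.2|) * expR (th * x.1.2).
have f0 x : 0 <= f x by rewrite mulr_ge0 ?expR_ge0 ?addr_ge0.
have mf : measurable_fun setT f.
  apply: measurable_funM.
    apply: measurable_funD => //; apply: (measurableT_comp (@normr_measurable _ _)) => //.
  apply: (measurableT_comp (@measurable_expR R)); apply: measurable_funM => //.
  by apply: (measurableT_comp measurable_snd); exact: measurable_fst.
have mEf : measurable_fun setT (EFin \o f) by exact/measurable_EFinP.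
rewrite (integral_run (measurable_exit_step L) Hz sg (f := EFin \o f))//.
(* The factor 2 gives [2 * (x + B) <= H] on the whole range from [- c] to [L + c], so that [P3] is
   nonnegative and [drift_parabola] applies. *)
pose H := 2 * (L + c + B).
pose P2 (x : R) := 2 - (x + B)^-1.
pose P3 (x : R) := slope v * ((x + B) * (H - (x + B))) - H / (x + B).
pose Psi (x : R * R * R) := expR (th * x.1.2) *
  ((1 + x.2) * P2 x.1.1 + P3 x.1.1).
have sl0 : 1 <= slope v by rewrite /slope lerDl divr_ge0// ltW.
have H0 : 0 < H by rewrite /H; have := B_ge4; have := c_gt0; lra.
apply: (@le_trans _ _ (Psi (x0, 0, 0))%:E); last first.
  rewrite lee_fin /Psi /= mulr0 expR0 mul1r addr0 mul1r /P2 /P3 -/H.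
  have A0 : 0 < x0 + B by have := B_ge4; lra.
  have i0 : 0 < (x0 + B)^-1 by rewrite invr_gt0.
  have h1 : 0 < H / (x0 + B) by rewrite divr_gt0.
  have h2 : slope v * ((x0 + B) * (H - (x0 + B))) <= slope v * ((x0 + B) * H).
    rewrite ler_pM2l; last lra.
    by rewrite ler_pM2l//; lra.
  lra.
apply: (iter_kernel_op_le (measurable_exit_step L) Hz sgE
  (Inv := fun x => - c <= x.1.1 <= L + c /\ 0 <= x.2)) => //=.
- move=> [[x a] b] /= [/andP[xc xL] b0]; rewrite /f /Psi /= ger0_norm//.
  have A4 : 4 <= x + B by have := Bc; lra.
  have Ai : (x + B)^-1 <= 1 by rewrite invf_le1; lra.
  have i0 : 0 < (x + B)^-1 by rewrite invr_gt0; lra.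
  rewrite mulrC ler_wpM2l ?expR_ge0//.
  have P21 : 1 <= P2 x by rewrite /P2; lra.
  have P30 : 0 <= P3 x.
    have HA : H / 2 <= H - (x + B) by rewrite /H; lra.
    have h1 : (x + B) * (H / 2) <= (x + B) * (H - (x + B)).
      by rewrite ler_wpM2l//; lra.
    have h2 : 4 * (H / 2) <= (x + B) * (H / 2) by rewrite ler_wpM2r//; lra.
    have h3 : H / (x + B) <= H * 1 by rewrite ler_wpM2l ?(ltW H0).
    have h4 : 1 * ((x + B) * (H - (x + B))) <= slope v * ((x + B) * (H - (x + B))).
      by rewrite ler_wpM2r// mulr_ge0//; lra.
    by rewrite /P3; lra.
  have : (1 + b) * 1 <= (1 + b) * P2 x by rewrite ler_wpM2l//; lra.
  lra.
- move=> [[x a] b] e /= [/andP[xc xL] b0]; rewrite ler_norml => /andP[e1 e2].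
  rewrite /exit_step/=; case: ifP => /= [/andP[x1 x2]|_]; last by rewrite xc.
  by split; [apply/andP; split|]; lra.
- move=> [[x a] b] /= [/andP[xc xL] b0]; rewrite /exit_step /=.
  case: (boolP ((0 <= x) && (x < L))) => [/andP[x1 x2]|_]; last exact: stay.
  rewrite /Psi /=; set A := x + B.
  have BA : B <= A by rewrite /A; lra.
  have A0 : 0 < A by have := B_ge4; lra.
  pose k := expR (th * (a + expR (- x))).
  have k0 : 0 < k by exact: expR_gt0.
  have kE : k = expR (th * a) * expR (th * expR (- x)) by rewrite /k mulrDr expRD.
  pose D := v / (2 * A ^+ 3).
  exists (k * ((2 + b) * (2 - A^-1) + (slope v * (A * (H - A)) - H / A))),
    (k * ((2 + b) * A ^- 2 + slope v * (H - 2 * A) + H * A ^- 2)),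
    (k * ((2 + b) / (2 * A ^+ 3) + slope v + H / (2 * A ^+ 3))); split.
    have h1 := drift_bounded c_gt0 v_gt0 v_le x1.
    have AH : 2 * A <= H by rewrite /A /H; have := c_gt0; lra.
    have h2 := drift_parabola c_gt0 v_gt0 v_le x1 AH.
    rewrite -/A in h1 h2.
    set E := expR (th * expR (- x)) in h1 h2 kE.
    have -> : k * ((2 + b) * (2 - A^-1) + (slope v * (A * (H - A)) - H / A)) -
        k * ((2 + b) / (2 * A ^+ 3) + slope v + H / (2 * A ^+ 3)) * v =
        expR (th * a) * ((1 + b) * (E * (2 - A^-1 - v / (2 * A ^+ 3))) +
          E * (2 - A^-1 - v / (2 * A ^+ 3)) +
          E * (slope v * (A * (H - A)) - H / A -
             (slope v * v + H * v / (2 * A ^+ 3)))).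
      by rewrite kE; field; rewrite gt_eqF.
    rewrite ler_wpM2l ?expR_ge0// /P2 /P3 -/A.
    have h3 : (1 + b) * (E * (2 - A^-1 - v / (2 * A ^+ 3))) <=
        (1 + b) * (2 - A^-1) by rewrite ler_wpM2l//; lra.
    lra.
  move=> e ec.
  have := inv_quadratic_le c_gt0 BA ec.
  rewrite /P2 /P3 (_ : x + e + B = A + e); last by rewrite /A; ring.
  rewrite -/k => h.
  set I := A^-1 - e / A ^+ 2 + e ^+ 2 / (2 * A ^+ 3) in h.
  have -> : k * ((2 + b) * (2 - A^-1) + (slope v * (A * (H - A)) - H / A)) +
    k * ((2 + b) * A ^- 2 + slope v * (H - 2 * A) + H * A ^- 2) * e -
    k * ((2 + b) / (2 * A ^+ 3) + slope v + H / (2 * A ^+ 3)) * e ^+ 2 =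
    k * ((2 + b) * (2 - I) + (slope v * ((A + e) * (H - (A + e))) - H * I)).
    by rewrite /I; field; rewrite gt_eqF.
  rewrite ler_wpM2l ?(ltW k0)// (_ : 1 + (b + 1) = 2 + b); last by ring.
  have h1 : (2 + b) * (2 - (A + e)^-1) <= (2 + b) * (2 - I).
    by rewrite ler_wpM2l//; lra.
  have h2 : H * I <= H * (A + e)^-1 by rewrite ler_wpM2l// ltW.
  lra.
- by split => //; apply/andP; split; have := c_gt0; lra.
Qed.

(** Only the law of each walk matters, so every enumeration is replaced by the one of index 0; the
    indicators then add up along a single walk. *)
Lemma sum_integral_duration_weight (L : R) (idx : nat -> nat -> int) N n : 0 <= L ->
  (forall m, injective (idx m)) ->
  (\sum_(m < N) \int[Q]_w (duration_weight m (exit_chain L (idx m) n w))%:E <=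
   (duration_bound L)%:E)%E.
Proof.
move=> L0 inj.
have md m : measurable_fun setT (EFin \o duration_weight m).
  by apply/measurable_EFinP; apply: measurable_duration_weight.
have dge0 m x : (0 <= (EFin \o duration_weight m) x)%E.
  by rewrite /= lee_fin duration_weight_ge0.
under eq_bigr => m _.
  rewrite (integral_run (measurable_exit_step L) Hz sg (0, 0, 0) n
    (dge0 m) (md m) (inj m)).
  rewrite -(integral_run (measurable_exit_step L) Hz sg (0, 0, 0) n
    (dge0 m) (md m) (inj 0%N)).
  over.
rewrite -ge0_integral_sum//; last first.
- move=> m; apply: measurableT_comp => //.
  exact: (measurable_run (measurable_exit_step L) Hz).
have := @integral_duration_weight_all L 0 (idx 0%N) n _ (inj 0%N).
rewrite lexx L0 add0r => /(_ isT); apply: le_trans.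
apply: ge0_le_integral => //.
- by move=> w _; apply: sume_ge0.
- apply: emeasurable_sum => m; apply: measurableT_comp => //.
  exact: (measurable_run (measurable_exit_step L) Hz).
- apply/measurable_EFinP.
  have mr := measurable_run (measurable_exit_step L) Hz sg (0, 0, 0) (idx 0%N) n.
  apply: measurable_funM.
    apply: measurable_funD => //; apply: (measurableT_comp (@normr_measurable _ _)).
    exact: (measurableT_comp measurable_snd mr).
  apply: (measurableT_comp (@measurable_expR R)); apply: measurable_funM => //.
  apply: (measurableT_comp measurable_snd).
  exact: (measurableT_comp measurable_fst mr).
- move=> w _; rewrite sumEFin lee_fin; exact: sum_le (expR_ge0 _).
Qed.

(** The event that level [b] is reached and the walk then falls to [b'] before getting to [b''],
    within [n] steps. *)
Definition hit_success (b b' b'' : R) idx n w : bool :=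
  let x := run (hit_step b b' b'') (0, b <= 0)
    (fun k => sg * z (idx k) w) n in x.2 && (x.1 <= b').

(** Once [b] is reached, the distance to [b'' + c] is a martingale, nonnegative since the overshoot
    above [b''] is at most [c]. It starts at most at [b'' + c - b] and is at least [b'' - b'] on
    success. Before [b] is reached the majorant is constant. *)
Lemma integral_hit (b b' b'' : R) idx n : injective idx ->
  b <= b'' -> b' < b'' -> 0 <= b'' + c ->
  (\int[Q]_w ((hit_success b b' b'' idx n w)%:R)%:E <=
   ((b'' + c - b) / (b'' - b'))%:E)%E.
Proof.
move=> inj bb bb' b0.
pose f (x : R * bool) : R := (x.2 && (x.1 <= b'))%:R.
have mf : measurable_fun setT f.
  rewrite (_ : f = fun x => if x.2 && (x.1 <= b') then 1 else 0); last first.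
    by apply/funext => x; rewrite /f; case: ifP.
  apply: measurable_fun_ifT => //; apply: measurable_and => //.
  by apply: measurable_fun_ler.
have mEf : measurable_fun setT (EFin \o f) by exact/measurable_EFinP.
rewrite (integral_run (measurable_hit_step b b' b'') Hz sg (f := EFin \o f))//;
  last by move=> x; rewrite /= lee_fin.
have D0 : 0 < (b'' - b')^-1 by rewrite invr_gt0 subr_gt0.
pose Psi (x : R * bool) :=
  (if x.2 then b'' + c - x.1 else b'' + c - b) / (b'' - b').
apply: (@le_trans _ _ (Psi (0, b <= 0))%:E); last first.
  rewrite lee_fin /Psi /= ler_wpM2r ?(ltW D0)//; case: ifP => // b00; lra.
apply: (iter_kernel_op_le (measurable_hit_step b b' b'') Hz sgE
  (Inv := fun x => (x.2 || (x.1 < b)) && (x.1 <= b'' + c))) => //=.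
- move=> [x s] /= /andP[_ xb]; rewrite /f /Psi /=.
  case: s => /=; last first.
    by rewrite mulr_ge0 ?(ltW D0)//; have := c_gt0; lra.
  case: (leP x b') => /= xb'; last by rewrite mulr_ge0 ?(ltW D0)//; lra.
  by rewrite ler_pdivlMr ?subr_gt0// mul1r; have := c_gt0; lra.
- move=> [x s] e /= /andP[sx xb]; rewrite ler_norml => /andP[e1 e2].
  rewrite /hit_step/=; case: ifP => /=; first by rewrite sx xb.
  case: s sx => /= [_|xltb _].
    by move=> /negbFE /andP[h1 h2]; lra.
  by have [h|h] /= := leP b (x + e); rewrite ?h/=; lra.
- move=> [x s] /= /andP[sx xb]; rewrite /hit_step /=.
  case: (boolP (s && ~~ ((b' < x) && (x < b'')))) => [_|]; first exact: stay.
  case: s sx => /= [_ /negPn /andP[h1 h2]|xltb _]; rewrite /Psi /=.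
    exists ((b'' + c - x) / (b'' - b')), (- (b'' - b')^-1), 0.
    split; first by rewrite mul0r subr0.
    by move=> e _; rewrite mul0r subr0 opprD addrA mulrBl mulNr (mulrC e).
  exists ((b'' + c - b) / (b'' - b')), 0, 0; split; first by rewrite mul0r subr0.
  move=> e _; rewrite !mul0r subr0 addr0 ler_wpM2r ?(ltW D0)//.
  by case: ifP => // h; lra.
- by case: (leP b 0) => //= ->.
Qed.

End walk_functionals.

(** * The chains evaluated along a given path *)

Section chain_paths.
Context {R : realType}.
Implicit Types (L b : R) (y delta : nat -> R).

Lemma exit_run_alive L y delta T :
  (forall k, (k < T)%N -> delta k = y k.+1 - y k) ->
  (forall k, (k < T)%N -> 0 <= y k < L) ->
  run (exit_step L) (y 0%N, 0, 0) delta T =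
    (y T, \sum_(k < T) expR (- y k), T%:R).
Proof.
elim: T => [|T ih] Hd Hy; first by rewrite /= big_ord0.
rewrite /= ih; last 2 first.
- by move=> k kT; apply: Hd; rewrite ltnS ltnW.
- by move=> k kT; apply: Hy; rewrite ltnS ltnW.
rewrite /exit_step/= Hy// Hd// big_ord_recr/= -natr1.
by congr (_, _, _); ring.
Qed.

Lemma exit_step_mono L p :
  p.1.1.2 <= (exit_step L p).1.2 /\ p.1.2 <= (exit_step L p).2.
Proof.
rewrite /exit_step; case: ifP => //= _.
by rewrite !lerDl expR_ge0.
Qed.

Lemma exit_run_mono L x0 delta T n : (T <= n)%N ->
  (run (exit_step L) x0 delta T).1.2 <= (run (exit_step L) x0 delta n).1.2 /\
  (run (exit_step L) x0 delta T).2 <= (run (exit_step L) x0 delta n).2.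
Proof.
elim: n => [|n ih]; first by rewrite leqn0 => /eqP ->.
rewrite leq_eqVlt => /orP[/eqP ->//|]; rewrite ltnS => /ih [ih1 ih2] /=.
have [h1 h2] := exit_step_mono L (run (exit_step L) x0 delta n, delta n).
by split; [exact: le_trans h1|exact: le_trans h2].
Qed.

Lemma exit_run_stop L x0 delta T n : (T <= n)%N ->
  ~~ (0 <= (run (exit_step L) x0 delta T).1.1 < L) ->
  run (exit_step L) x0 delta n = run (exit_step L) x0 delta T.
Proof.
move=> + H; elim: n => [|n ih]; first by rewrite leqn0 => /eqP ->.
rewrite leq_eqVlt => /orP[/eqP ->//|]; rewrite ltnS => /ih /= ->.
by rewrite {1}/exit_step/= (negbTE H).
Qed.

(** Success is absorbing, so a fall to [b'] earlier than [k2] does no harm; otherwise the chain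
    follows the path up to [k2], because the path stays below [b'']. *)
Lemma hit_run_success b b' b'' y delta k1 k2 n : y 0%N = 0 ->
  (forall k, (k < k2)%N -> delta k = y k.+1 - y k) ->
  (k1 <= k2 <= n)%N -> b <= y k1 -> y k2 <= b' ->
  (forall k, (k < k2)%N -> y k < b'') ->
  let x := run (hit_step b b' b'') (0, b <= 0) delta n in x.2 && (x.1 <= b').
Proof.
move=> y0 Hd /andP[k12 k2n] yk1 yk2 Hy /=.
pose V k := run (hit_step b b' b'') (0, b <= 0) delta k.
rewrite -/(V n).
have absorb k : (V k).2 && ((V k).1 <= b') ->
    (V k.+1).2 && ((V k.+1).1 <= b').
  move=> /andP[s x]; rewrite /V/= -/(V k) /hit_step/=.
  by rewrite s /= (ltNge b') x /= s x.
suff : (V k2).2 && ((V k2).1 <= b').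
  move=> H; rewrite -(subnKC k2n); elim: (n - k2)%N => [|j ih].
    by rewrite addn0.
  by rewrite addnS; exact: absorb.
have inv k : (k <= k2)%N -> (V k).2 && ((V k).1 <= b') \/
    (V k).1 = y k /\ (forall i, (i <= k)%N -> b <= y i -> (V k).2).
  elim: k => [_|k ih kk2].
    right; split; rewrite /V //= => i; rewrite leqn0 => /eqP ->.
    by rewrite y0.
  have [|[x s]] := ih (ltnW kk2); first by move=> /absorb; left.
  have [/andP[s' x']|ns] := boolP ((V k).2 && ((V k).1 <= b')).
    by left; apply: absorb; rewrite s' x'.
  right; rewrite /V/= -/(V k) /hit_step/=.
  rewrite (_ : _ && ~~ _ = false) /=; last first.
    move: ns; case: ((V k).2) => //=; rewrite -ltNge => ->.
    by rewrite x Hy.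
  have -> : (V k).1 + delta k = y k.+1 by rewrite x Hd//; ring.
  split => // i; rewrite leq_eqVlt => /orP[/eqP -> ->|]; first by rewrite orbT.
  by rewrite ltnS => ik /(s _ ik) ->.
have [//|[x s]] := inv k2 (leqnn _).
by rewrite (s _ k12 yk1) x yk2.
Qed.

End chain_paths.

Ltac int_lia R :=
  repeat match goal with
  | H : ?T |- _ => lazymatch type of T with
    | Prop => lazymatch T with
      | context [R] => clear H
      | is_true _ => fail
      | @eq _ _ _ => fail
      | ~ (@eq _ _ _) => fail
      | _ => clear H
      end
    end
  end; lia.

Ltac absurd_lra R := suff : (1 : R) <= 0; [by rewrite ler10|lra].

(** * Valleys of a path *)

Section extrema.
Context {R : realType}.
Implicit Types (f S : int -> R) (a b s t : int).

Lemma exists_max_interval f a b : a <= b ->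
  exists2 t, a <= t <= b & forall s, a <= s <= b -> f s <= f t.
Proof.
move=> ab; have [n ->] : exists n : nat, b = a + n%:Z.
  by exists `|b - a|%N; lia.
elim: n => [|n [t tab tmax]].
  by exists a; [lia|move=> s sa; have -> : s = a by lia].
have [h|h] := leP (f t) (f (a + n.+1%:Z)).
  exists (a + n.+1%:Z); first lia.
  move=> s sab; have [->//|sn] := eqVneq s (a + n.+1%:Z).
  by apply: le_trans h; apply: tmax; lia.
exists t; first lia.
move=> s sab; have [->|sn] := eqVneq s (a + n.+1%:Z); first exact: ltW.
by apply: tmax; lia.
Qed.

Lemma exists_min_abs (P : int -> Prop) : (exists t, P t) ->
  exists2 t, P t & forall s, P s -> `|t| <= `|s|.
Proof.
move=> [t0 Pt0].
have ex : exists n, `[< exists2 t, P t & `|t|%N = n >].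
  by exists `|t0|%N; apply/asboolP; exists t0.
case: (ex_minnP ex) => m /asboolP[s Ps sm] mmin; exists s => // r Pr.
have : (m <= `|r|)%N by apply: mmin; apply/asboolP; exists r.
by lia.
Qed.

Lemma le_max_on S a b s : a <= s <= b -> S s <= max_on S a b.
Proof.
move=> sab; have ab : a <= b by lia.
have [t tab tmax] := exists_max_interval S ab.
apply: ub_le_sup; last by exists s.
by exists (S t) => _ [r /= rab <-]; exact: tmax.
Qed.

Lemma max_on_le S a b M : a <= b -> (forall s, a <= s <= b -> S s <= M) ->
  max_on S a b <= M.
Proof.
move=> ab H; apply: ge_sup; first by exists (S a), a => //=; lia.
by move=> _ [r /= rab <-]; exact: H.
Qed.

Lemma max_on_attained S a b : a <= b ->
  exists2 t, a <= t <= b & S t = max_on S a b.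
Proof.
move=> ab; have [t tab tmax] := exists_max_interval S ab.
exists t => //; apply/eqP; rewrite eq_le le_max_on//=.
exact: max_on_le.
Qed.

Lemma max_on_eq S a b t : a <= t <= b ->
  (forall s, a <= s <= b -> S s <= S t) -> S t = max_on S a b.
Proof.
move=> tab H; apply/eqP; rewrite eq_le le_max_on//= max_on_le//; lia.
Qed.

Lemma min_onE S a b : min_on S a b = - max_on (fun t => - S t) a b.
Proof.
rewrite /min_on /max_on /inf; congr (- sup _).
by apply/seteqP; split => [_ [_ [t tab <-] <-]|_ [t tab <-]];
  [exists t|exists (S t) => //; exists t].
Qed.

Lemma min_on_le S a b s : a <= s <= b -> min_on S a b <= S s.
Proof.
by move=> sab; rewrite min_onE lerNl; exact: (@le_max_on (fun t => - S t)).
Qed.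

Lemma min_on_eq S a b t : a <= t <= b ->
  (forall s, a <= s <= b -> S t <= S s) -> S t = min_on S a b.
Proof.
move=> tab H; rewrite min_onE -[LHS]opprK; congr (- _).
by apply: (@max_on_eq (fun t => - S t)) => // s /H; rewrite lerN2.
Qed.

Lemma le_max_rise S a b u v : a <= u -> u <= v -> v <= b ->
  S v - S u <= max_rise S a b.
Proof.
move=> au uv vb.
have ab : a <= b by lia.
have [t tab tmax] := exists_max_interval S ab.
have [t' tab' tmin] := exists_max_interval (fun t => - S t) ab.
apply: ub_le_sup; last by exists (u, v) => //=; rewrite au uv.
exists (S t - S t') => _ [[p q] /= /and3P[ap pq qb] <-].
by apply: lerB; [apply: tmax; lia|rewrite -lerN2; apply: tmin; lia].
Qed.

Lemma max_rise_attained S a b : a <= b -> exists u v,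
  [/\ a <= u, u <= v, v <= b & S v - S u = max_rise S a b].
Proof.
move=> ab.
have low v : exists u, a <= v -> a <= u <= v /\
    forall s, a <= s <= v -> S u <= S s.
  have [av|//] := leP a v; last by move=> av; exists 0; lia.
  have [u uav H] := exists_max_interval (fun t => - S t) av.
  by exists u => _; split => // s /H; rewrite lerN2.
have [u Hu] := choice low.
have [v vab vmax] := exists_max_interval (fun t => S t - S (u t)) ab.
have [|/andP[au uv] umin] := Hu v; first lia.
exists (u v), v; split => //; first lia.
apply/eqP; rewrite eq_le le_max_rise//=; last lia.
apply: ge_sup; first by exists (S a - S a), (a, a) => //=; lia.
move=> _ [[p q] /= /and3P[ap pq qb] <-].
apply: (@le_trans _ _ (S q - S (u q))); last by apply: vmax; lia.
have [|_ qmin] := Hu q; first lia.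
by rewrite lerB//; apply: qmin; lia.
Qed.

(** The rise from [u] to [v] makes the maximal rise positive, so it is not attained at a pair of
    equal sites, which [rise_pair] excludes. The tie rules are two successive minimisations of the
    absolute value. *)
Lemma exists_left_cut S a b u v : a <= u -> u < v -> v <= b -> S u < S v ->
  exists m1 M1, left_cut S a b m1 M1.
Proof.
move=> au uv vb Suv.
have ab : a <= b by lia.
have [u0 [v0 [au0 uv0 vb0 E0]]] := max_rise_attained S ab.
have r0 : 0 < max_rise S a b.
  by apply: (@lt_le_trans _ _ (S v - S u)); [lra|apply: le_max_rise => //; lia].
have ex1 : exists M1, exists m1, rise_pair S a b m1 M1.
  exists v0, u0; split => //.
  have : v0 <> u0 by move=> E; move: E0; rewrite E subrr => E0; absurd_lra R.
  by lia.
have [M1 exm M1min] := exists_min_abs ex1.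
have [m1 rm m1min] := exists_min_abs exm.
by exists m1, M1; split => // u1 v1 r1; apply: M1min; exists u1.
Qed.

End extrema.

Section one_step_smallest.
Context {R : realType}.
Variables (S : int -> R) (G g : R).
Hypotheses (S0 : S 0 = 0) (G_gt0 : 0 < G) (g_gt0 : 0 < g).

Definition unrefinable (V : triplet) : Prop := deep_valley S G g V /\
  forall V', refinement S V V' -> V' <> V -> ~ deep_valley S G g V'.

(** Cut the slope [[a, m]] at its largest rise, from [m1] up to [M1]; it is at least [h], the rise
    from 0 to the maximum over [[0, m]]. As neither piece is deep, the rise must start left of 0,
    and the path on [[m1, 0]] must come within [g] of the height [h] without exceeding it by [g]. *)
Lemma unrefinable_coincidence a m b : unrefinable (Triplet a m b) ->
  0 < m -> G <= max_on S 0 m ->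
  exists p q, [/\ a <= q, q <= p, p <= 0, max_on S 0 m - g <= S p /\ S q <= g &
    forall k, q <= k <= 0 -> S k < max_on S 0 m + g].
Proof.
move=> [[[/= /andP[am mb] Sa Sb Sm tie] /andP[a0 b0] dV _ gV] min] m0 hG.
have G0 := G_gt0; have g0 := g_gt0.
set h := max_on S 0 m in hG *.
have {}gV := gV m0; rewrite -/h in gV.
have [P P0m SP] : exists2 t : int, 0 <= t <= m & S t = h by apply: max_on_attained; int_lia R.
have Pgt0 : 0 < P.
  have : P <> 0 by move=> E; move: SP; rewrite E S0 => SP; absurd_lra R.
  by int_lia R.
move: dV; rewrite /depth /= le_min => /andP[dVl dVr].
have am' : a < m.
  have : a <> m by move=> E; move: dVl; rewrite E subrr => ?; absurd_lra R.
  by int_lia R.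
have mb' : m < b.
  have : b <> m by move=> E; move: dVr; rewrite E subrr => ?; absurd_lra R.
  by int_lia R.
have [m1 [M1 cut]] : exists m1 M1, left_cut S a m m1 M1.
  by apply: (@exists_left_cut _ S a m 0 P); [int_lia R|int_lia R|int_lia R|rewrite S0 SP; lra].
have [[am1 m1M1 M1m E] _ m1min] := cut.
set r := max_rise S a m in E.
have rise u v : a <= u -> u <= v -> v <= m -> S v - S u <= r.
  exact: le_max_rise.
have hr : h <= r.
  by have : S P - S 0 <= r; [by apply: rise; int_lia R|rewrite SP S0 subr0].
have low t : a <= t <= b -> S m <= S t by move=> tab; rewrite Sm; exact: min_on_le.
have topM1 k : m1 <= k <= m -> S k <= S M1.
  by move=> km; have : S k - S m1 <= r; [by apply: rise; int_lia R|lra].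
have hM1 : m1 <= 0 -> h <= S M1.
  by move=> m10; rewrite -SP; apply: topM1; int_lia R.
(* If [M1 <= 0], the outer piece contains 0 and keeps the bottom [m]; it can only fail the condition
   on its left end, so [S M1 < h + g], and the start [m1] of a rise of at least [h] is then below
   [g]. *)
have [M10|M10] := leP M1 0.
  have SM1 : S M1 < h + g.
    rewrite ltNge; apply/negP => hgM1.
    have := min (Triplet M1 m b).
    apply; first exact: (@left_refinement_outer _ S (Triplet a m b) m1 M1 cut).
      by case=> E'; int_lia R.
    split => /=.
    - split => /=; first int_lia R.
      + by apply: max_on_eq => [|s sM1]; [int_lia R|apply: topM1; int_lia R].
      + exact: Sb.
      + by apply: min_on_eq => [|s sM1]; [int_lia R|apply: low; int_lia R].
      + by move=> t tb; apply: tie; int_lia R.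
    - int_lia R.
    - rewrite /depth /= le_min dVr andbT.
      by have : S m <= S m1; [by apply: low; int_lia R|lra].
    - by move=> mlt; int_lia R.
    - by move=> _; rewrite -/h; lra.
  exists M1, m1; split => //; first int_lia R.
    by have : h <= S M1; [by apply: hM1; int_lia R|split; lra].
  by move=> k km; apply: le_lt_trans SM1; apply: topM1; int_lia R.
(* If [M1 > 0], the inner piece contains 0 and has depth at least [r >= G]. It is deep unless
   [m1 < 0] and its right end does not exceed the maximum over [[m1, 0]] by [g]; that maximum is
   attained at the wanted [p]. *)
have hle : S M1 <= h by rewrite /h; apply: le_max_on; int_lia R.
have nd : ~ deep_valley S G g (Triplet a m1 M1).
  apply: min; first exact: (@left_refinement_inner _ S (Triplet a m b) m1 M1 cut).
  by case=> _ E'; int_lia R.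
have topa k : a <= k <= m -> S k <= S a by move=> kam; rewrite Sa; exact: le_max_on.
have dv : (m1 < 0 -> g <= S M1 - max_on S m1 0) -> deep_valley S G g (Triplet a m1 M1).
  move=> Hneg; split => //=.
  - split => /=; first int_lia R.
    + by apply: max_on_eq => [|s sM1]; [int_lia R|apply: topa; int_lia R].
    + by apply: max_on_eq => [|s sM1]; [int_lia R|apply: topM1; int_lia R].
    + apply: min_on_eq => [|s sM1]; first int_lia R.
      by have : S M1 - S s <= r; [by apply: rise; int_lia R|lra].
    + move=> t tb St; apply: m1min; split; try int_lia R; last by rewrite St.
      have : t <> M1 by move=> Et; move: St E; rewrite Et => St E; absurd_lra R.
      by int_lia R.
  - int_lia R.
  - rewrite /depth /= le_min.
    have := topa M1; move=> H; have : S M1 <= S a by apply: H; int_lia R.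
    by move=> H'; apply/andP; split; lra.
  - move=> m1gt; have : max_on S 0 m1 <= h; last by lra.
    by apply: max_on_le => [|s sm]; [int_lia R|apply: le_max_on; int_lia R].
have [m1lt|m1ge] := ltP m1 0; last by exfalso; apply/nd/dv; int_lia R.
have SM1 : S M1 < max_on S m1 0 + g.
  by rewrite ltNge; apply/negP => H; apply/nd/dv => _; lra.
have [p pm1 Sp] : exists2 t : int, m1 <= t <= 0 & S t = max_on S m1 0.
  by apply: max_on_attained; int_lia R.
have hSM1 : h <= S M1 by apply: hM1; int_lia R.
exists p, m1; split; try int_lia R.
  by split; lra.
move=> k km1; apply: (@le_lt_trans _ _ (S M1)); first by apply: topM1; int_lia R.
lra.
Qed.

End one_step_smallest.

(** * Reflection of paths and valleys *)

Section mirror.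
Context {R : realType}.
Implicit Types (S : int -> R) (V U : triplet) (a b : int).

Definition mirror V := Triplet (- vright V) (- vbot V) (- vleft V).

Lemma mirrorK V : mirror (mirror V) = V.
Proof. by case: V => a m b; rewrite /mirror /= !opprK. Qed.

Definition flip S (k : int) := S (- k).

Lemma flipK S : flip (flip S) = S.
Proof. by apply/funext => k; rewrite /flip opprK. Qed.

Lemma max_on_flip S a b : max_on (flip S) a b = max_on S (- b) (- a).
Proof.
congr sup; apply/seteqP; split => [_ [t /= tab <-]|_ [t /= tab <-]].
  by exists (- t) => //=; lia.
by exists (- t); rewrite /flip ?opprK//=; lia.
Qed.

Lemma min_on_flip S a b : min_on (flip S) a b = min_on S (- b) (- a).
Proof. by rewrite !min_onE -(max_on_flip (fun t => - S t)). Qed.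

Lemma max_drop_flip S a b : max_drop (flip S) a b = max_rise S (- b) (- a).
Proof.
congr sup; apply/seteqP; split => [_ [[u v] /= uv <-]|_ [[u v] /= uv <-]].
  by exists (- v, - u) => //=; lia.
by exists (- v, - u); rewrite /flip ?opprK//=; lia.
Qed.

Lemma max_rise_flip S a b : max_rise (flip S) a b = max_drop S (- b) (- a).
Proof. by rewrite -[in RHS](flipK S) max_drop_flip !opprK. Qed.

Lemma is_valley_flip S V : is_valley S V -> is_valley (flip S) (mirror V).
Proof.
case: V => a m b [/= amb Sa Sb Sm tie]; split => /=; first lia.
- by rewrite max_on_flip !opprK /flip opprK.
- by rewrite max_on_flip !opprK /flip opprK.
- by rewrite min_on_flip !opprK /flip opprK.
- move=> t tab; rewrite /flip opprK => /tie; rewrite !normrN; apply; lia.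
Qed.

Lemma deep_valley_flip S G g V :
  deep_valley S G g V -> deep_valley (flip S) G g (mirror V).
Proof.
case=> vV V0 dV gl gr; split; first exact: is_valley_flip.
- by move: V0 => /=; lia.
- by rewrite /depth /= /flip !opprK minC.
- rewrite /= max_on_flip /flip !opprK oppr0 => h; apply: gr; lia.
- rewrite /= max_on_flip /flip !opprK oppr0 => h; apply: gl; lia.
Qed.

Lemma drop_pair_flip S a b u v :
  drop_pair (flip S) a b u v -> rise_pair S (- b) (- a) (- v) (- u).
Proof. by move=> [au uv vb E]; split; rewrite -?max_drop_flip//; lia. Qed.

Lemma rise_pair_flip S a b u v :
  rise_pair (flip S) a b u v -> drop_pair S (- b) (- a) (- v) (- u).
Proof. by move=> [au uv vb E]; split; rewrite -?max_rise_flip//; lia. Qed.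

(** Drops become rises, and the tie rules survive because they compare absolute values. *)
Lemma right_cut_flip S a b M m :
  right_cut (flip S) a b M m -> left_cut S (- b) (- a) (- m) (- M).
Proof.
move=> [/drop_pair_flip P HM Hm]; split => //.
- move=> u v; rewrite -[in rise_pair _ _ _](flipK S) => /rise_pair_flip.
  by rewrite !opprK normrN -[`|v|]normrN; exact: HM.
- move=> u; rewrite -[in rise_pair _ _ _](flipK S) => /rise_pair_flip.
  by rewrite !opprK normrN -[`|u|]normrN; exact: Hm.
Qed.

Lemma left_cut_flip S a b m M :
  left_cut (flip S) a b m M -> right_cut S (- b) (- a) (- M) (- m).
Proof.
move=> [/rise_pair_flip P HM Hm]; split => //.
- move=> u v; rewrite -[in drop_pair _ _ _](flipK S) => /drop_pair_flip.
  by rewrite !opprK normrN -[`|u|]normrN; exact: HM.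
- move=> u; rewrite -[in drop_pair _ _ _](flipK S) => /drop_pair_flip.
  by rewrite !opprK normrN -[`|u|]normrN; exact: Hm.
Qed.

Lemma refinement_flip S V U :
  refinement (flip S) V U -> refinement S (mirror V) (mirror U).
Proof.
case.
- move=> M m /right_cut_flip.
  exact: (@left_refinement_outer _ S (mirror V)).
- move=> M m /right_cut_flip.
  exact: (@left_refinement_inner _ S (mirror V)).
- move=> m M /left_cut_flip.
  exact: (@right_refinement_inner _ S (mirror V)).
- move=> m M /left_cut_flip.
  exact: (@right_refinement_outer _ S (mirror V)).
Qed.

Lemma unrefinable_flip S G g V :
  unrefinable S G g V -> unrefinable (flip S) G g (mirror V).
Proof.
move=> [dV HV]; split; first exact: deep_valley_flip.
move=> U /refinement_flip; rewrite mirrorK => VU UV dU.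
apply: (HV _ VU); first by move=> E; apply: UV; rewrite -E mirrorK.
by have := deep_valley_flip dU; rewrite flipK.
Qed.

(** The part of [basic_valley] on which the estimates rest: minimality against single refinements,
    and ends that are attained extremal candidates. *)
Definition basic_facts S (G g : R) (B : triplet) : Prop :=
  exists a b, [/\ unrefinable S G g (Triplet a (vbot B) b),
    left_candidates S G g (vbot B) (vleft B),
    forall l, left_candidates S G g (vbot B) l -> l <= vleft B,
    right_candidates S G g (vbot B) (vright B) &
    forall l, right_candidates S G g (vbot B) l -> vright B <= l].

Lemma basic_valley_facts S G g B : basic_valley S G g B -> basic_facts S G g B.
Proof.
case=> [[a [b [dV HV]]] [supU supL] [infL infU]]; exists a, b; split => //.
- by split => // V' VV'; apply: HV; exact: t_step.
(* On the integers, a supremum that is not attained is contradicted by the smaller upper bound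
   [vleft B - 1]. *)
- apply: contrapT => nc.
  have : (vleft B : int) <= vleft B - 1; last lia.
  apply: supL => l lc; have := supU _ lc.
  have : l <> vleft B by move=> E; apply: nc; rewrite -E.
  by move=> ? ? /=; lia.
- apply: contrapT => nc.
  have : (vright B + 1 : int) <= vright B; last lia.
  apply: infU => l lc; have := infL _ lc.
  have : l <> vright B by move=> E; apply: nc; rewrite -E.
  by move=> ? ? /=; lia.
Qed.

Lemma left_candidates_flip S G g m l : left_candidates (flip S) G g m l ->
  right_candidates S G g (- m) (- l).
Proof.
case=> l0 lm Gl gl; split => //; [lia|lia|] => m0.
by have := gl _; rewrite max_on_flip oppr0; apply; lia.
Qed.

Lemma right_candidates_flip S G g m l : right_candidates (flip S) G g m l ->
  left_candidates S G g (- m) (- l).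
Proof.
case=> l0 lm Gl gl; split => //; [lia|lia|] => m0.
by have := gl _; rewrite max_on_flip oppr0; apply; lia.
Qed.

Lemma basic_facts_flip S G g B :
  basic_facts S G g B -> basic_facts (flip S) G g (mirror B).
Proof.
case=> a [b [uV Hl ml Hr mr]]; exists (- b), (- a); split => /=.
- exact: (unrefinable_flip uV).
- by apply: right_candidates_flip; rewrite flipK.
- by move=> l /left_candidates_flip; rewrite opprK => /mr; lia.
- by apply: left_candidates_flip; rewrite flipK.
- by move=> l /right_candidates_flip; rewrite opprK => /ml; lia.
Qed.

End mirror.

Section basic_shape.
Context {R : realType}.
Variables (S : int -> R) (G g : R) (B : triplet).
Hypotheses (G_gt0 : 0 < G) (g_gt0 : 0 < g) (gG : g <= G).
Hypothesis HB : basic_facts S G g B.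
Hypothesis m_ge0 : 0 <= vbot B.

(** The ends of the deep valley are themselves candidates, so the basic valley lies inside it and
    its bottom is minimal there too. *)
Lemma basic_facts_bounds : [/\ vleft B <= 0, vleft B < vbot B,
  vbot B < vright B &
  forall l, vleft B <= l <= vright B -> S (vbot B) <= S l].
Proof.
have G0 := G_gt0.
case: HB => a [b [[dV _] [l0 lm _ _] ml [_ mr _ _] mr']]; split => // l lB.
case: dV => -[/= amb Sa Sb Sm tie] ab dV gn gp.
move: dV; rewrite /depth /= le_min => /andP[dVl dVr].
have am : a <> vbot B.
  by move=> E; move: dVl; rewrite E subrr => ?; absurd_lra R.
have bm : b <> vbot B.
  by move=> E; move: dVr; rewrite E subrr => ?; absurd_lra R.
rewrite Sm; apply: min_on_le.
have : a <= vleft B by apply: ml; split => //; int_lia R.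
have : vright B <= b by apply: mr'; split => //; int_lia R.
by move: lB; int_lia R.
Qed.

Lemma basic_facts_right : (forall l, vbot B <= l < vright B ->
    0 <= S l - S (vbot B) < G) /\ G <= S (vright B) - S (vbot B).
Proof.
have G0 := G_gt0.
have [l0 lm mr low] := basic_facts_bounds.
case: HB => a [b [_ _ _ [_ _ Gr _] mr']]; split => // l lB.
rewrite subr_ge0 low; last by move: lB; int_lia R.
rewrite ltNge; apply/negP => Gl.
have : vright B <= l; last by move: lB; int_lia R.
have lm' : l <> vbot B by move=> E; move: Gl; rewrite E subrr => ?; absurd_lra R.
apply: mr'; split => //.
- by move: lB m_ge0; int_lia R.
- by move: lB lm'; int_lia R.
- by move: m_ge0; int_lia R.
Qed.

(** For [l < 0], a site at this height would clear both thresholds, as [g <= G], and be a candidate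
    to the right of [vleft B]. For [l >= 0] the maximum over [[0, vbot B]] bounds it. *)
Lemma basic_facts_left l : vleft B < l <= vbot B ->
  0 <= S l - S (vbot B) < (max_on S 0 (vbot B) - S (vbot B)) + G.
Proof.
have G0 := G_gt0; have gG' := gG => lB.
have [l0 lm mr low] := basic_facts_bounds.
rewrite subr_ge0 low /=; last by move: lB; int_lia R.
have mm : S (vbot B) <= max_on S 0 (vbot B).
  by apply: le_max_on; move: m_ge0; int_lia R.
have [l00|l00] := leP 0 l.
  have : S l <= max_on S 0 (vbot B) by apply: le_max_on; move: lB; int_lia R.
  lra.
rewrite ltNge; apply/negP => Gl.
case: HB => a [b [_ _ ml _ _]].
have : l <= vleft B; last by move: lB; int_lia R.
apply: ml; split; [int_lia R|move: m_ge0; int_lia R|lra|move=> _; lra].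
Qed.

End basic_shape.

(** * Existence of basic valleys *)

Section existence.
Context {R : realType}.
Variables (S : int -> R) (G g : R).
Hypotheses (G_gt0 : 0 < G) (g_gt0 : 0 < g).

Let ordered V := vleft V <= vbot V <= vright V.
Let width V := `|vright V - vleft V|%N.

Let refinement_ordered V U : refinement S V U -> ordered V ->
  [/\ ordered U, vleft V <= vleft U, vright U <= vright V &
      vleft V < vbot V < vright V -> vleft V < vleft U \/ vright U < vright V].
Proof.
rewrite /ordered; case=> m M [[h1 h2 h3 _] _ _] /= h; split; try lia.
Qed.

(** Refining strictly shrinks a valley whose bottom is interior, which positive depth ensures; a
    deep valley of least width among the iterated refinements is therefore smallest. *)
Lemma exists_smallest_deep_valley V0 : deep_valley S G g V0 ->
  exists V, smallest_deep_valley S G g V.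
Proof.
move=> dV0; have G0 := G_gt0.
pose cand V := (V = V0 \/ clos_trans _ (refinement S) V0 V) /\
  deep_valley S G g V.
have ex : exists n, `[< exists2 V, cand V & width V = n >].
  by exists (width V0); apply/asboolP; exists V0 => //; split => //; left.
case: (ex_minnP ex) => n /asboolP[V [V0V dV] Vn] nmin.
exists V; split => // U VU UV dU.
have : (n <= width U)%N.
  apply: nmin; apply/asboolP; exists U => //; split => //; right.
  by case: V0V => [<-//|V0V]; exact: t_trans V0V VU.
rewrite -Vn.
have [[/= amb _ _ _ _] _ + _ _] := dV.
rewrite /depth le_min => /andP[dVl dVr].
have am : vleft V <> vbot V.
  by move=> E; move: dVl; rewrite E subrr => ?; absurd_lra R.
have bm : vright V <> vbot V.
  by move=> E; move: dVr; rewrite E subrr => ?; absurd_lra R.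
have shrink W1 W2 : clos_trans _ (refinement S) W1 W2 -> ordered W1 ->
  [/\ ordered W2, vleft W1 <= vleft W2, vright W2 <= vright W1 &
      vleft W1 < vbot W1 < vright W1 ->
      vleft W1 < vleft W2 \/ vright W2 < vright W1].
  elim=> [x y|x y w _ ih1 _ ih2 ox]; first exact: refinement_ordered.
  have [oy h1 h2 h3] := ih1 ox; have [ow h4 h5 _] := ih2 oy.
  by split => //; [int_lia R|int_lia R|move=> /h3; int_lia R].
have [oU h1 h2 h3] := shrink _ _ VU amb.
have := h3 _; move: oU amb; rewrite /ordered /width => oU amb h.
have {}h : vleft V < vleft U \/ vright U < vright V by apply: h; int_lia R.
by case: h => h; int_lia R.
Qed.

Lemma exists_basic_valley V0 : deep_valley S G g V0 ->
  exists B, basic_valley S G g B.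
Proof.
move=> /exists_smallest_deep_valley[[a m b] sV]; have G0 := G_gt0.
have [[[/= amb _ _ _ _] ab + gn gp] _] := sV.
rewrite /depth /= le_min => /andP[dVl dVr].
have am : a <> m by move=> E; move: dVl; rewrite E subrr => ?; absurd_lra R.
have bm : b <> m by move=> E; move: dVr; rewrite E subrr => ?; absurd_lra R.
have la : left_candidates S G g m a by split => //; int_lia R.
have rb : right_candidates S G g m b by split => //; int_lia R.
have [l lc lmin] := exists_min_abs (ex_intro _ _ la).
have [r rc rmin] := exists_min_abs (ex_intro _ _ rb).
exists (Triplet l m r); split => /=; first by exists a, b.
- split; last by move=> x; apply.
  by move=> x xc; have := lmin _ xc; case: lc xc => l0 _ _ _ [x0 _ _ _]; int_lia R.
- split; last by move=> x; apply.
  by move=> x xc; have := rmin _ xc; case: rc xc => l0 _ _ _ [x0 _ _ _]; int_lia R.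
Qed.

Hypothesis S0 : S 0 = 0.

(** The bottom is the minimum over an interval containing 0, hence at height at most 0. Since the
    path stays positive once it has come within [g] of [H], it is at most [H - g] between 0 and the
    bottom, which is the margin asked of the opposite end. *)
Lemma deep_valley_of_levels (H : R) (a b : int) : a < 0 -> 0 < b -> G <= H ->
  H <= S a -> H <= S b -> (forall k, a < k < b -> S k < H) ->
  (forall p q, 0 <= p -> p <= q -> q < b -> H - g <= S p -> 0 < S q) ->
  (forall p q, a < q -> q <= p -> p <= 0 -> H - g <= S p -> 0 < S q) ->
  exists V, deep_valley S G g V.
Proof.
move=> a0 b0 GH Ha Hb Hk Hr Hl; have G0 := G_gt0.
have [t tab tmin] : exists2 t, a <= t <= b & forall s, a <= s <= b -> S t <= S s.
  have [|t tab tmin] := @exists_max_interval _ (fun k => - S k) a b.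
    by int_lia R.
  by exists t => // s /tmin; rewrite lerN2.
have [m [mab mmin] tie] := exists_min_abs
  (ex_intro (fun t : int => a <= t <= b /\ forall s, a <= s <= b -> S t <= S s)
    t (conj tab tmin)).
have Sm0 : S m <= 0 by rewrite -S0; apply: mmin; int_lia R.
have am : a <> m by move=> E; move: Ha; rewrite E => ?; absurd_lra R.
have bm : b <> m by move=> E; move: Hb; rewrite E => ?; absurd_lra R.
exists (Triplet a m b); split => /=.
- split => /=; first int_lia R.
  + apply: max_on_eq => [|s sm]; first int_lia R.
    have [->//|sa] := eqVneq s a.
    by apply: le_trans Ha; apply/ltW/Hk; int_lia R.
  + apply: max_on_eq => [|s sm]; first int_lia R.
    have [->//|sa] := eqVneq s b.
    by apply: le_trans Hb; apply/ltW/Hk; int_lia R.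
  + by apply: min_on_eq => // s sab; exact: mmin.
  + move=> s sab Ss; apply: tie; split => //.
    by move=> r rab; rewrite Ss; exact: mmin.
- by int_lia R.
- by rewrite /depth /= le_min; apply/andP; split; lra.
- move=> m0; have : max_on S m 0 <= H - g; last by lra.
  apply: max_on_le => [|s sm]; first int_lia R.
  rewrite leNgt; apply/negP => /ltW h.
  have : 0 < S m; last by move=> ?; absurd_lra R.
  by apply: (Hl s m) => //; int_lia R.
- move=> m0; have : max_on S 0 m <= H - g; last by lra.
  apply: max_on_le => [|s sm]; first int_lia R.
  rewrite leNgt; apply/negP => /ltW h.
  have : 0 < S m; last by move=> ?; absurd_lra R.
  by apply: (Hr s m) => //; int_lia R.
Qed.

End existence.

(** * The path seen from a site *)

Section walk_from_site.
Context {R : realType}.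
Variables (S dS : int -> R) (c v : R).
Hypotheses (S0 : S 0 = 0) (SE : forall k, S k - S (k - 1) = dS k).

Definition site_sum (f : int -> R) (a b : int) : R :=
  \sum_(i < `|b - a|%N.+1) f (a + i%:Z).

(** Step number [i] joins [i - 1] to [i], hence a shift by 1 on the right and none on the left. From
    [m], the right enumeration uses indices above [m] and the left one indices at most [m]: this
    disjointness gives independence of the two sides. *)
Definition right_sites (m : int) (k : nat) : int := m + 1 + k%:Z.
Definition left_sites (m : int) (k : nat) : int := m - k%:Z.

Lemma right_sites_inj m : injective (right_sites m).
Proof. by move=> i j; rewrite /right_sites; lia. Qed.

Lemma left_sites_inj m : injective (left_sites m).
Proof. by move=> i j; rewrite /left_sites; lia. Qed.

Let rightE m k : 1 * dS (right_sites m k) =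
  (S (m + k.+1%:Z) - S m) - (S (m + k%:Z) - S m).
Proof.
rewrite mul1r -SE /right_sites.
rewrite (_ : m + 1 + k%:Z = m + k.+1%:Z); last lia.
by rewrite (_ : m + k.+1%:Z - 1 = m + k%:Z); [ring|lia].
Qed.

Let leftE m k : - 1 * dS (left_sites m k) =
  (S (m - k.+1%:Z) - S m) - (S (m - k%:Z) - S m).
Proof.
rewrite mulN1r -SE /left_sites.
by rewrite (_ : m - k%:Z - 1 = m - k.+1%:Z); [ring|lia].
Qed.

Lemma site_sum_le m (TL TR : nat) :
  (forall l : int, m - TL%:Z <= l <= m + TR%:Z -> S m <= S l) ->
  site_sum (fun k => expR (- (S k - S m))) (m - TL%:Z) (m + TR%:Z) <=
  \sum_(k < TL) expR (- (S (m - k%:Z) - S m)) +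
  \sum_(k < TR) expR (- (S (m + k%:Z) - S m)) + 2.
Proof.
move=> low; rewrite /site_sum.
set f := fun k => expR (- (S k - S m)).
have f1 k : m - TL%:Z <= k <= m + TR%:Z -> f k <= 1.
  by move=> /low h; rewrite /f expR_le1; lra.
rewrite (_ : `|_|%N.+1 = TL + TR.+1)%N; last lia.
rewrite big_split_ord /= -addrA lerD//; last first.
  rewrite big_ord_recr /=; apply: lerD.
    by apply: ler_sum => i _; rewrite /f (_ : m - _ + _ = m + i%:Z)//; lia.
  by apply: le_trans (f1 _ _) _; [lia|lra].
rewrite (reindex_inj rev_ord_inj)/=.
have -> : \sum_(i < TL) f (m - TL%:Z + (TL - i.+1)%N%:Z) =
    \sum_(i < TL) f (m - i.+1%:Z).
  by apply: eq_bigr => i _; congr f; have := ltn_ord i; lia.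
have : \sum_(i < TL.+1) f (m - i%:Z) = \sum_(i < TL.+1) f (m - i%:Z) by [].
rewrite {1}big_ord_recl big_ord_recr /=.
have -> : \sum_(i < TL) f (m - (lift ord0 i)%:Z) = \sum_(i < TL) f (m - i.+1%:Z).
  by apply: eq_bigr.
have : f (m - 0%:Z) = 1 by rewrite /f subr0 subrr oppr0 expR0.
have : f (m - TL%:Z) <= 1 by apply: f1; lia.
rewrite -/f; lra.
Qed.

(** To the right the chain stops exactly at [TR], through the top. To the left it has made at least
    [TL >= m] steps, and what it accumulates after [TL] only enlarges the bound; its horizon is
    [2 * N] because the left end may be that far from [m]. *)
Lemma expR_site_sum_le (d : measure_display) (T : measurableType d)
    (z : int -> T -> R) (w : T) (G L : R)
    (m TL TR N : nat) : (forall i, z i w = dS i) -> 0 < theta c v ->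
  (forall k, (k < TR)%N -> 0 <= S (m%:Z + k%:Z) - S m%:Z < G) ->
  G <= S (m%:Z + TR%:Z) - S m%:Z ->
  (forall k, (k < TL)%N -> 0 <= S (m%:Z - k%:Z) - S m%:Z < L) ->
  S m%:Z <= S (m%:Z - TL%:Z) -> 0 < G ->
  (TR <= N)%N -> (m <= TL)%N -> (TL <= 2 * N)%N ->
  expR (theta c v * site_sum (fun k => expR (- (S k - S m%:Z)))
     (m%:Z - TL%:Z) (m%:Z + TR%:Z)) <=
  expR (2 * theta c v) *
  (top_weight c v G (exit_chain z 1 G (right_sites m%:Z) N w) *
   duration_weight c v m (exit_chain z (- 1) L (left_sites m%:Z) (2 * N) w)).
Proof.
move=> zE th0 HR HRT HL HLT G0 TRN mTL TLN.
pose yR k := S (m%:Z + k%:Z) - S m%:Z.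
pose yL k := S (m%:Z - k%:Z) - S m%:Z.
have yR0 : yR 0%N = 0 by rewrite /yR addr0 subrr.
have yL0 : yL 0%N = 0 by rewrite /yL subr0 subrr.
have runR : run (exit_step G) (0, 0, 0)
    (fun k => 1 * z (right_sites m%:Z k) w) TR =
    (yR TR, \sum_(k < TR) expR (- yR k), TR%:R).
  rewrite -{1}yR0; apply: exit_run_alive => k kT; last exact: HR.
  by rewrite zE rightE.
have runL : run (exit_step L) (0, 0, 0)
    (fun k => - 1 * z (left_sites m%:Z k) w) TL =
    (yL TL, \sum_(k < TL) expR (- yL k), TL%:R).
  rewrite -{1}yL0; apply: exit_run_alive => k kT; last exact: HL.
  by rewrite zE leftE.
have -> : top_weight c v G (exit_chain z 1 G (right_sites m%:Z) N w) =
    expR (theta c v * \sum_(k < TR) expR (- yR k)).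
  rewrite /exit_chain (exit_run_stop TRN) runR /top_weight /= ?HRT//.
  by rewrite [_ < G]ltNge HRT andbF.
have [durL cntL] := exit_run_mono L (0, 0, 0)
  (fun k => - 1 * z (left_sites m%:Z k) w) TLN.
rewrite runL /= in durL cntL.
rewrite /duration_weight ifT; last first.
  by apply: le_trans cntL; rewrite ler_nat.
rewrite -!expRD ler_expR -!mulrDr [2 * _]mulrC -!mulrDr ler_wpM2l ?(ltW th0)//.
have low l : m%:Z - TL%:Z <= l <= m%:Z + TR%:Z -> S m%:Z <= S l.
  move=> lm; have [lm'|lm'] := leP l m%:Z.
    have -> : l = m%:Z - (`|m%:Z - l|%N)%:Z by lia.
    have [E|/eqP ne] := eqVneq `|m%:Z - l|%N TL; first by rewrite E.
    have : (`|m%:Z - l| < TL)%N by lia.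
    by move=> /HL; lra.
  have -> : l = m%:Z + (`|l - m%:Z|%N)%:Z by lia.
  have [E|/eqP ne] := eqVneq `|l - m%:Z|%N TR; first by rewrite E; lra.
  have : (`|l - m%:Z| < TR)%N by lia.
  by move=> /HR; lra.
apply: (le_trans (site_sum_le low)).
rewrite -/(yL _) -/(yR _).
by move: durL; rewrite /exit_chain /yL /yR; lra.
Qed.

Lemma hit_right (d : measure_display) (T : measurableType d)
    (z : int -> T -> R) (w : T) (b b' b'' : R)
    (k1 k2 n : nat) : (forall i, z i w = dS i) -> (k1 <= k2 <= n)%N ->
  b <= S k1%:Z -> S k2%:Z <= b' -> (forall k, (k < k2)%N -> S k%:Z < b'') ->
  hit_success z 1 b b' b'' (right_sites 0) n w.
Proof.
move=> zE k12 h1 h2 h3.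
apply: (@hit_run_success _ _ _ _ (fun k => S k%:Z) _ k1 k2) => // k kk.
by rewrite zE rightE !add0r; ring.
Qed.

Lemma hit_left (d : measure_display) (T : measurableType d)
    (z : int -> T -> R) (w : T) (b b' b'' : R)
    (k1 k2 n : nat) : (forall i, z i w = dS i) -> (k1 <= k2 <= n)%N ->
  b <= S (- k1%:Z) -> S (- k2%:Z) <= b' ->
  (forall k, (k < k2)%N -> S (- k%:Z) < b'') ->
  hit_success z (- 1) b b' b'' (left_sites 0) n w.
Proof.
move=> zE k12 h1 h2 h3.
apply: (@hit_run_success _ _ _ _ (fun k => S (- k%:Z)) _ k1 k2) => //.
by move=> k kk; rewrite zE leftE !sub0r; ring.
Qed.

End walk_from_site.

(** * Averaged bound on the valley sum *)

Section environment_bound.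
Context {R : realType} {d : measure_display} {T : measurableType d}.
Variables (z : int -> T -> R) (c v : R).
Local Notation th := (theta c v).

Section bounds.
Variables (G : R) (N : nat).
Local Notation W := (G + c).

(** Let [h] be the maximum of the path over [0, m]. This is the case [h < 2^j G] of a fall of size
    at least [4^j G]. *)
Definition early_fall (j : nat) (w : T) : bool :=
  hit_success z 1 0 (2 ^+ j * G - 4 ^+ j * G) (2 ^+ j * G) (right_sites 0) N w.

(** The case where [h] lies in the cell of heights from [l * W] to [l.+1 * W]. *)
Definition right_peak (j l : nat) (w : T) : bool :=
  hit_success z 1 (l%:R * W) (l.+1%:R * W - 4 ^+ j * G) (l.+1%:R * W)
    (right_sites 0) N w.

(** What minimality imposes left of 0 when [h] lies in that cell: the levels [h - g], [h + g] and
    [g] are rounded to multiples of [W], which is at least [g]. *)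
Definition left_peak (l : nat) (w : T) : bool :=
  hit_success z (- 1) ((l%:R - 1) * W) W (l.+2%:R * W) (left_sites 0) N w.

Definition peak_coincidence (j l : nat) (w : T) : R :=
  if 2 ^+ j * G <= l.+1%:R * W then (right_peak j l w)%:R * (left_peak l w)%:R
  else 0.

Definition deep_count (j : nat) (w : T) : R :=
  (early_fall j w)%:R + \sum_(l < (4 ^ j.+1).+1) peak_coincidence j l w.

(** The cap [4 ^+ j.+1 * G + G] is the height bound of [basic_facts_left] when
    [D < 4 ^+ j.+1 * G]. *)
Definition profile_sum (j : nat) (w : T) : R :=
  \sum_(m < N.+1)
    top_weight c v G (exit_chain z 1 G (right_sites m%:Z) N w) *
    duration_weight c v m
      (exit_chain z (- 1) (4 ^+ j.+1 * G + G) (left_sites m%:Z) (2 * N) w).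

(* Bounds the valley sum F when D := max_on S 0 m - S m lies in
   [4^j G, 4^(j+1) G) (or only D < 4 G, if j = 0), through F <= a + theta^-1 expR (theta (F - a)) with
   a = 3 j / theta; [deep_count] dominates the indicator of that event if j > 0. *)
Definition level_bound (j : nat) (w : T) : R :=
  3 * j%:R / th * deep_count j w +
  th^-1 * expR (- (3 * j%:R)) * (expR (2 * th) * profile_sum j w).

Hypotheses (c_gt0 : 0 < c) (v_gt0 : 0 < v) (v_le : v <= c ^+ 2).
Hypothesis G_ge1 : 1 <= G.

Let W_gt0 : 0 < W. Proof. by have := c_gt0; have := G_ge1; lra. Qed.

Lemma peak_coincidence_ge0 j l w : 0 <= peak_coincidence j l w.
Proof. by rewrite /peak_coincidence; case: ifP => // _; rewrite mulr_ge0. Qed.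

Lemma deep_count_ge0 j w : 0 <= deep_count j w.
Proof.
by rewrite addr_ge0// sumr_ge0// => l _; exact: peak_coincidence_ge0.
Qed.

Lemma profile_sum_ge0 j w : 0 <= profile_sum j w.
Proof.
apply: sumr_ge0 => m _.
by rewrite mulr_ge0 ?top_weight_ge0 ?duration_weight_ge0.
Qed.

Lemma level_bound_ge0 j w : 0 <= level_bound j w.
Proof.
have t0 := theta_gt0 c_gt0 v_gt0.
apply: addr_ge0.
  by rewrite mulr_ge0 ?deep_count_ge0// divr_ge0// ltW.
by rewrite !mulr_ge0 ?expR_ge0 ?profile_sum_ge0// invr_ge0 ltW.
Qed.

Section at_environment.
Variables (S : int -> R) (w : T) (g : R) (B : triplet).
Hypotheses (S0 : S 0 = 0) (SE : forall k, S k - S (k - 1) = z k w).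
Hypotheses (g_gt0 : 0 < g) (gG : g <= G).
Hypotheses (HB : basic_facts S G g B) (m_ge0 : 0 <= vbot B).
Hypotheses (NB : - N%:Z <= vleft B) (BN : vright B <= N%:Z).

Let G0 : 0 < G. Proof. exact: lt_le_trans G_ge1. Qed.
Let h := max_on S 0 (vbot B).
Let D := h - S (vbot B).

Let mh : 0 <= h. Proof. by rewrite -S0; apply: le_max_on; move: m_ge0; lia. Qed.

Let h_le_D : h <= D.
Proof.
rewrite /D -[leLHS]subr0 lerD2l lerN2 -S0.
have [l0 lm mr low] := basic_facts_bounds G0 HB m_ge0.
by apply: low; int_lia R.
Qed.

Let le_h k : 0 <= k <= vbot B -> S k <= h. Proof. exact: le_max_on. Qed.

Lemma expR_site_sum_le_profile j : D < 4 ^+ j.+1 * G ->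
  expR (th * site_sum (fun k => expR (- (S k - S (vbot B))))
    (vleft B) (vright B)) <= expR (2 * th) * profile_sum j w.
Proof.
move=> Dj; have G0' := G0.
have [l0 lm mr low] := basic_facts_bounds G0 HB m_ge0.
have [HR HRT] := basic_facts_right G0 HB m_ge0.
have HL := basic_facts_left G0 gG HB m_ge0.
have m0 := m_ge0; have nb := NB; have bn := BN.
have [m mE] : exists m : nat, vbot B = m%:Z by exists `|vbot B|%N; int_lia R.
have [TL aE] : exists n : nat, vleft B = m%:Z - n%:Z.
  by exists `|vbot B - vleft B|%N; move: mE; int_lia R.
have [TR bE] : exists n : nat, vright B = m%:Z + n%:Z.
  by exists `|vright B - vbot B|%N; move: mE; int_lia R.
have mN : (m < N.+1)%N by move: mE; int_lia R.
rewrite aE bE mE.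
apply: le_trans (@expR_site_sum_le _ S (fun k => z k w) c v SE d T z w G
  (4 ^+ j.+1 * G + G) m _ _ N _ _ _ _ _ _ _ _ _ _) _ => //.
- exact: theta_gt0.
- move=> k kT; rewrite -mE; apply: HR; move: kT mE bE; int_lia R.
- by rewrite -bE -mE.
- move=> k kT; rewrite -mE.
  have : vleft B < vbot B - k%:Z <= vbot B by move: kT mE aE; int_lia R.
  move=> /HL /andP[-> /=] H; apply: lt_le_trans H _.
  by rewrite lerD2r ltW.
- by rewrite -aE -mE; apply: low; move: mE aE; int_lia R.
- by move: mE bE; int_lia R.
- by move: mE aE; int_lia R.
- by move: mE aE; int_lia R.
rewrite ler_wpM2l ?expR_ge0// /profile_sum (bigD1 (Ordinal mN))//= lerDl.
apply: sumr_ge0 => i _.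
by rewrite mulr_ge0 ?top_weight_ge0 ?duration_weight_ge0.
Qed.

Lemma deep_count_ge1 j : 4 ^+ j * G <= D < 4 ^+ j.+1 * G -> (0 < j)%N ->
  1 <= deep_count j w.
Proof.
move=> /andP[Dj Dj1] j0; have G0' := G0; have W0 := W_gt0; have c0 := c_gt0.
have mh' := mh; have hD := h_le_D.
have [l0 lm mr low] := basic_facts_bounds G0 HB m_ge0.
have m0 := m_ge0; have nb := NB; have bn := BN.
have r0 : 0 < 4 ^+ j * G by rewrite mulr_gt0// exprn_gt0.
have s0 : G <= 2 ^+ j * G by rewrite ler_peMl ?(ltW G0)// exprn_ege1// ler1n.
have [m mE] : exists m : nat, vbot B = m%:Z by exists `|vbot B|%N; int_lia R.
have mN : (m <= N)%N by move: mE; int_lia R.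
have le_h' k : (k <= m)%N -> S k%:Z <= h.
  by move=> km; apply: le_h; move: mE; int_lia R.
have Sm : S m%:Z = h - D by rewrite -mE /D; ring.
(* A maximum below [2^j G] followed by a fall of at least [4^j G] is already unlikely. A higher
   maximum is paid for by the coincidence on the left of 0. *)
have [hs|hs] := ltP h (2 ^+ j * G).
  have -> : deep_count j w = 1 + \sum_(l < (4 ^ j.+1).+1) peak_coincidence j l w.
    rewrite /deep_count /early_fall (@hit_right _ S (fun k => z k w) S0 SE
      d T z w _ _ _ 0 m N)//.
    - by rewrite S0.
    - by rewrite Sm; lra.
    - by move=> k km; have := le_h' k (ltnW km); lra.
  by rewrite lerDl; apply: sumr_ge0 => l _; exact: peak_coincidence_ge0.
have mgt0 : 0 < vbot B.
  have : vbot B <> 0.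
    move=> E; have : D = 0; last by move=> E'; absurd_lra R.
    rewrite /D /h E -(@max_on_eq _ S 0 0 0)// ?subrr// => s s0'.
    by rewrite (_ : s = 0)//; int_lia R.
  by move: m0; int_lia R.
have /andP[] := truncn_itv (divr_ge0 mh' (ltW W0)).
set l := Num.truncn (h / W) => hl1 hl2.
have {}hl1 : l%:R * W <= h by rewrite -ler_pdivlMr.
have {}hl2 : h < l.+1%:R * W by rewrite -ltr_pdivrMr.
(* The number of cells is finite because [h <= D], the bottom being no higher than [S 0 = 0]. *)
have lj : (l < (4 ^ j.+1).+1)%N.
  rewrite ltnS -(ler_nat R) natrX.
  have : l%:R * W < 4 ^+ j.+1 * W.
    apply: (le_lt_trans hl1); apply: (le_lt_trans hD); apply: (lt_trans Dj1).
    by rewrite ltr_pM2l ?exprn_gt0//; lra.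
  by rewrite ltr_pM2r// => /ltW.
have [P Pm SP] : exists2 t : int, 0 <= t <= vbot B & S t = h.
  exact: max_on_attained.
have [PN PE] : exists PN : nat, P = PN%:Z by exists `|P|%N; int_lia R.
have R1 : right_peak j l w.
  apply: (@hit_right _ S (fun k => z k w) S0 SE d T z w _ _ _ PN m N) => //.
  - by move: mE PE Pm; int_lia R.
  - by rewrite -PE SP.
  - by rewrite Sm; lra.
  - by move=> k km; have := le_h' k (ltnW km); lra.
have L1 : left_peak l w.
  have [a [b [uV Hl ml _ _]]] := HB.
  have [p [q [aq qp p0 [Sp Sq] Hk]]] : exists p q, [/\ a <= q, q <= p, p <= 0,
      h - g <= S p /\ S q <= g & forall k, q <= k <= 0 -> S k < h + g].
    by apply: (unrefinable_coincidence S0 G0 g_gt0 uV mgt0); exact: le_trans hs.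
  (* The sites [p] and [q] lie inside the basic valley, hence within [N] of 0: its left end has
     height at least [h + g], which is not attained on [[q, 0]]. *)
  have qB : vleft B < q.
    rewrite ltNge; apply/negP => qB.
    have [_ _ _ /(_ mgt0) H1] := Hl.
    have : S (vleft B) < h + g by apply: Hk; move: qB l0; int_lia R.
    by move: H1; rewrite -/h => H1 H2; absurd_lra R.
  have gG' := gG; have g0 := g_gt0.
  have lS : l.+1%:R = l%:R + 1 :> R by rewrite -natr1.
  have lSS : l.+2%:R = l%:R + 2 :> R by rewrite -addn2 natrD.
  have gW : g <= W by lra.
  rewrite lS in hl2.
  apply: (@hit_left _ S (fun k => z k w) S0 SE d T z w _ _ _ `|p|%N `|q|%N N) => //.
  - by move: qB nb qp p0; int_lia R.
  - rewrite (_ : - (`|p|%N)%:Z = p); last by move: p0; int_lia R.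
    apply: le_trans Sp; lra.
  - rewrite (_ : - (`|q|%N)%:Z = q); last by move: p0 qp; int_lia R.
    by apply: (le_trans Sq).
  - move=> k kq; have : S (- k%:Z) < h + g.
      by apply: Hk; move: kq p0 qp; int_lia R.
    move=> H; apply: (lt_le_trans H); rewrite lSS; lra.
have -> : deep_count j w = peak_coincidence j l w + ((early_fall j w)%:R +
    \sum_(i < (4 ^ j.+1).+1 | i != Ordinal lj) peak_coincidence j i w).
  by rewrite /deep_count (bigD1 (Ordinal lj))//=; ring.
rewrite {1}/peak_coincidence R1 L1 ifT; last by apply: (le_trans hs); exact: ltW.
rewrite mulr1 lerDl addr_ge0// sumr_ge0// => i _.
exact: peak_coincidence_ge0.
Qed.

Lemma site_sum_le_levels : exists J, forall J', (J <= J')%N ->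
  site_sum (fun k => expR (- (S k - S (vbot B)))) (vleft B) (vright B) <=
  \sum_(j < J'.+1) level_bound j w.
Proof.
have G0' := G0; have t0 := theta_gt0 c_gt0 v_gt0.
have ex : exists j, D < 4 ^+ j.+1 * G.
  exists (Num.truncn D); apply: (@lt_le_trans _ _ (Num.truncn D).+1%:R).
    by rewrite truncnS_gt.
  apply: (@le_trans _ _ (4 ^+ (Num.truncn D).+1)); last first.
    by rewrite ler_peMr ?exprn_ge0//; exact: G_ge1.
  by rewrite -natrX ler_nat ltnW// ltn_expl.
case: (ex_minnP ex) => j Dj jmin; exists j => J' jJ'.
have jJ : (j < J'.+1)%N by [].
set F := site_sum _ _ _.
apply: (@le_trans _ _ (level_bound j w)); last first.
  rewrite (bigD1 (Ordinal jJ))//= lerDl sumr_ge0// => i _.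
  exact: level_bound_ge0.
have eF := expR_site_sum_le_profile Dj; rewrite -/F in eF.
(* This is [1 + x <= expR x] at [x = th * F - 3 * j]. *)
have : F <= 3 * j%:R / th + th^-1 * expR (- (3 * j%:R)) * expR (th * F).
  have := expR_ge1Dx (- (3 * j%:R) + th * F); rewrite expRD => e1.
  set E := expR (- _) in e1 *; set E' := expR (th * F) in e1 *.
  have -> : 3 * j%:R / th + th^-1 * E * E' = (3 * j%:R + E * E') / th.
    by field; rewrite gt_eqF.
  by rewrite ler_pdivlMr// mulrC; lra.
move=> h1; apply: (le_trans h1); apply: lerD; last first.
  by rewrite ler_wpM2l// mulr_ge0 ?expR_ge0// invr_ge0 ltW.
have [->|jn0] := eqVneq j 0%N; first by rewrite mulr0 !mul0r.
rewrite ler_peMr//; first exact: (divr_ge0 (mulr_ge0 (ler0n _ 3) (ler0n _ j)) (ltW t0)).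
apply: deep_count_ge1; last by rewrite lt0n.
rewrite Dj andbT leNgt; apply/negP => Dlt.
have := jmin j.-1; rewrite prednK ?lt0n// => /(_ Dlt).
by rewrite leqNgt ltn_predL lt0n jn0.
Qed.

End at_environment.
End bounds.
End environment_bound.

(** * Expectations of the level bounds *)

Section independent_product.
Context d (T : measurableType d) (R : realType) (Q : probability T R).
Variable z : int -> T -> R.
Hypothesis iidz : iid_family Q z.

Lemma integral_independent_prod d1 d2 (T1 : measurableType d1)
    (T2 : measurableType d2) (J1 J2 : pred int) (V1 : T -> T1) (V2 : T -> T2)
    (f1 : T1 -> R) (f2 : T2 -> R) :
  (forall i, J1 i -> ~~ J2 i) -> generated z J1 V1 -> generated z J2 V2 ->
  measurable_fun setT f1 -> measurable_fun setT f2 ->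
  (forall x, 0 <= f1 x) -> (forall x, 0 <= f2 x) ->
  (\int[Q]_w (f1 (V1 w) * f2 (V2 w))%:E =
   (\int[Q]_w (f1 (V1 w))%:E) * \int[Q]_w (f2 (V2 w))%:E)%E.
Proof.
move=> J12 g1 g2 mf1 mf2 f10 f20.
have mV1 := measurable_generated iidz g1.
have mV2 := measurable_generated iidz g2.
have mp : measurable_fun setT (fun p : T1 * T2 => (f1 p.1 * f2 p.2)%:E).
  apply/measurable_EFinP; apply: measurable_funM.
    exact: (measurableT_comp mf1 measurable_fst).
  exact: (measurableT_comp mf2 measurable_snd).
have := integral_independent iidz J12 g1 g2 mp.
move=> /= ->; last by move=> p; rewrite lee_fin mulr_ge0.
have m2 : measurable_fun setT (fun w => (f2 (V2 w))%:E).
  by apply/measurable_EFinP; exact: (measurableT_comp mf2 mV2).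
have m1 : measurable_fun setT (fun w => (f1 (V1 w))%:E).
  by apply/measurable_EFinP; exact: (measurableT_comp mf1 mV1).
rewrite -ge0_integralZr//; last 2 first.
- by move=> w _; rewrite lee_fin.
- by apply: integral_ge0 => w _; rewrite lee_fin.
apply: eq_integral => w _; rewrite -ge0_integralZl_EFin//.
by move=> v _; rewrite lee_fin.
Qed.

End independent_product.

Lemma ge0_integral_lincomb d (T : measurableType d) (R : realType)
    (mu : {measure set T -> \bar R}) (a b : R) (f g : T -> R) :
  0 <= a -> 0 <= b -> measurable_fun setT f -> measurable_fun setT g ->
  (forall w, 0 <= f w) -> (forall w, 0 <= g w) ->
  (\int[mu]_w (a * f w + b * g w)%:E =
   a%:E * \int[mu]_w (f w)%:E + b%:E * \int[mu]_w (g w)%:E)%E.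
Proof.
move=> a0 b0 mf mg f0 g0.
have mEf : measurable_fun setT (EFin \o f) by exact/measurable_EFinP.
have mEg : measurable_fun setT (EFin \o g) by exact/measurable_EFinP.
have f0' w : setT w -> (0 <= (f w)%:E)%E by rewrite lee_fin.
have g0' w : setT w -> (0 <= (g w)%:E)%E by rewrite lee_fin.
under eq_integral do rewrite EFinD 2!EFinM.
rewrite ge0_integralD//; first by rewrite !ge0_integralZl_EFin.
- by move=> w _; rewrite mule_ge0// lee_fin.
- exact: measurable_funeM.
- by move=> w _; rewrite mule_ge0// lee_fin.
- exact: measurable_funeM.
Qed.

Section level_integrals.
Context {R : realType} {d : measure_display} {T : measurableType d}.
Variables (Q : probability T R) (z : int -> T -> R) (c v : R).
Hypotheses (Hz : centered_walk Q z c v).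
Hypotheses (c_gt0 : 0 < c) (v_gt0 : 0 < v) (v_le : v <= c ^+ 2).
Local Notation th := (theta c v).

Let iidz : iid_family Q z. Proof. by case: Hz. Qed.
Let sg1 : (1 : R) ^+ 2 = 1. Proof. by rewrite expr1n. Qed.
Let sgN1 : (- 1 : R) ^+ 2 = 1. Proof. by rewrite sqrrN expr1n. Qed.
Let th_gt0 : 0 < th. Proof. exact: theta_gt0. Qed.

Definition hit_test (b' : R) (x : R * bool) : R := (x.2 && (x.1 <= b'))%:R.

Lemma measurable_hit_test b' : measurable_fun setT (hit_test b').
Proof.
rewrite (_ : hit_test b' = fun x => if x.2 && (x.1 <= b') then 1 else 0).
  apply: measurable_fun_ifT => //; apply: measurable_and => //.
  exact: measurable_fun_ler.
by apply/funext => x; rewrite /hit_test; case: ifP.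
Qed.

Lemma measurable_hit_success sg b b' b'' idx n :
  measurable_fun setT (fun w => (hit_success z sg b b' b'' idx n w)%:R : R).
Proof.
apply: (measurableT_comp (@measurable_hit_test b')).
exact: (measurable_run (measurable_hit_step b b' b'') Hz).
Qed.

Let right_pred (m : int) : pred int := fun i => m < i.
Let left_pred (m : int) : pred int := fun i => i <= m.
Let right_left m i : right_pred m i -> ~~ left_pred m i.
Proof. by rewrite /right_pred /left_pred -ltNge. Qed.

Lemma integral_hit_prod b1 b1' b1'' b2 b2' b2'' n :
  (\int[Q]_w ((hit_success z 1 b1 b1' b1'' (right_sites 0) n w)%:R *
     (hit_success z (- 1) b2 b2' b2'' (left_sites 0) n w)%:R)%:E =
   (\int[Q]_w ((hit_success z 1 b1 b1' b1'' (right_sites 0) n w)%:R)%:E) *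
   \int[Q]_w ((hit_success z (- 1) b2 b2' b2'' (left_sites 0) n w)%:R)%:E)%E.
Proof.
apply: (integral_independent_prod iidz (@right_left 0)
  (f1 := hit_test b1') (f2 := hit_test b2')
  (V1 := fun w => run (hit_step b1 b1' b1'') (0, b1 <= 0)
    (fun k => 1 * z (right_sites 0 k) w) n)
  (V2 := fun w => run (hit_step b2 b2' b2'') (0, b2 <= 0)
    (fun k => - 1 * z (left_sites 0 k) w) n)).
- apply: (generated_run (measurable_hit_step b1 b1' b1'') 1 (0, b1 <= 0)
    (idx := right_sites 0)) => k _.
  by rewrite /right_pred /right_sites; lia.
- apply: (generated_run (measurable_hit_step b2 b2' b2'') (- 1) (0, b2 <= 0)
    (idx := left_sites 0)) => k _.
  by rewrite /left_pred /left_sites; lia.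
- exact: measurable_hit_test.
- exact: measurable_hit_test.
- by move=> x; exact: ler0n.
- by move=> x; exact: ler0n.
Qed.

Let measurable_right_weight G m n : measurable_fun setT
  (fun w => top_weight c v G (exit_chain z 1 G (right_sites m) n w)).
Proof.
apply: (measurableT_comp (measurable_top_weight _ _ _)).
exact: (measurable_run (measurable_exit_step G) Hz).
Qed.

Let measurable_left_weight L k m n : measurable_fun setT
  (fun w => duration_weight c v k (exit_chain z (- 1) L (left_sites m) n w)).
Proof.
apply: (measurableT_comp (measurable_duration_weight _ _ _)).
exact: (measurable_run (measurable_exit_step L) Hz).
Qed.

Lemma integral_profile (G L : R) (N n1 n2 : nat) : 0 < G -> 0 <= L ->
  (\int[Q]_w (\sum_(m < N)
    top_weight c v G (exit_chain z 1 G (right_sites m%:Z) n1 w) *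
    duration_weight c v m (exit_chain z (- 1) L (left_sites m%:Z) n2 w))%:E <=
   (2 * shift c / G * duration_bound c v L)%:E)%E.
Proof.
move=> G0 L0.
under eq_integral do rewrite -sumEFin.
rewrite ge0_integral_sum//; last 2 first.
- move=> m; apply/measurable_EFinP; exact: measurable_funM.
- move=> m w _; rewrite lee_fin.
  by rewrite mulr_ge0 ?top_weight_ge0 ?duration_weight_ge0.
have prodE (m : nat) : (\int[Q]_w
    (top_weight c v G (exit_chain z 1 G (right_sites m%:Z) n1 w) *
     duration_weight c v m (exit_chain z (- 1)%R L (left_sites m%:Z) n2 w))%:E =
    (\int[Q]_w (top_weight c v G (exit_chain z 1%R G (right_sites m%:Z) n1 w))%:E) *
    \int[Q]_w (duration_weight c v m
      (exit_chain z (- 1)%R L (left_sites m%:Z) n2 w))%:E)%E.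
  apply: (integral_independent_prod iidz (@right_left m%:Z)
    (f1 := top_weight c v G) (f2 := duration_weight c v m)).
  - apply: (generated_run (measurable_exit_step G) 1 (0, 0, 0)
      (idx := right_sites m%:Z)) => k _.
    by rewrite /right_pred /right_sites; lia.
  - apply: (generated_run (measurable_exit_step L) (- 1) (0, 0, 0)
      (idx := left_sites m%:Z)) => k _.
    by rewrite /left_pred /left_sites; lia.
  - exact: measurable_top_weight.
  - exact: measurable_duration_weight.
  - exact: top_weight_ge0.
  - exact: duration_weight_ge0.
under eq_bigr do rewrite prodE.
apply: (@le_trans _ _ (\sum_(m < N) (2 * shift c / G)%:E *
    \int[Q]_w (duration_weight c v m
      (exit_chain z (- 1)%R L (left_sites m%:Z) n2 w))%:E)%E).
  apply: lee_sum => m _; apply: lee_wpmul2r.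
    by apply: integral_ge0 => w _; rewrite lee_fin duration_weight_ge0.
  exact: (integral_top_weight Hz c_gt0 v_gt0 v_le sg1 _ G0 (@right_sites_inj _)).
have s0 : 0 <= 2 * shift c / G.
  by rewrite !mulr_ge0 ?invr_ge0 ?(ltW G0)// /shift; have := c_gt0; lra.
rewrite -ge0_sume_distrr; last first.
  by move=> m _; apply: integral_ge0 => w _; rewrite lee_fin duration_weight_ge0.
rewrite [leRHS]EFinM; apply: lee_wpmul2l; first by rewrite lee_fin.
have := sum_integral_duration_weight Hz c_gt0 v_gt0 v_le sgN1 (idx := fun m => left_sites m%:Z) N n2 L0.
by apply => m; exact: left_sites_inj.
Qed.

(** Bounds [2 * shift c / G * duration_bound] at the height [4^(j+1) G + G], divided by [4^j];
    [G >= 1] absorbs the lower order terms. *)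
Definition profile_const : R :=
  2 * shift c * (2 + 2 * slope v * shift c * (c + shift c + 5)).

(** The first term comes from [early_fall]. For the second, a cell has probability at most
    [2 (1 + c) / 4^j] on the right times [4 (1 + c) / 2^j] on the left, there are [4^(j+1) + 1]
    cells, and [8 (4^(j+1) + 1) / 8^j <= 40 / 2^j]. *)
Definition count_const : R := (1 + c) + 40 * (1 + c) ^+ 2.

Lemma profile_const_ge0 : 0 <= profile_const.
Proof.
have c0 := c_gt0.
have s0 : 0 <= shift c by rewrite /shift; lra.
have l0 : 0 <= slope v by rewrite /slope addr_ge0// divr_ge0// ltW.
by rewrite /profile_const !mulr_ge0// addr_ge0// !mulr_ge0//; lra.
Qed.

Lemma count_const_ge0 : 0 <= count_const.
Proof.
by have c0 := c_gt0; have := sqr_ge0 (1 + c); rewrite /count_const; lra.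
Qed.

Variables (G : R) (N : nat).
Hypothesis G_ge1 : 1 <= G.
Let G_gt0 : 0 < G. Proof. exact: lt_le_trans G_ge1. Qed.

Lemma integral_profile_sum j :
  (\int[Q]_w (profile_sum z c v G N j w)%:E <= (profile_const * 4 ^+ j)%:E)%E.
Proof.
have G1 := G_ge1; have c0 := c_gt0.
have q0 : 1 <= 4 ^+ j :> R by rewrite exprn_ege1// ler1n.
have L0 : 0 <= 4 ^+ j.+1 * G + G by rewrite addr_ge0 ?mulr_ge0 ?exprn_ge0 ?ltW.
apply: (le_trans (integral_profile _ _ _ G_gt0 L0)); rewrite lee_fin.
rewrite /duration_bound /profile_const exprS.
have s0 : 4 <= shift c by rewrite /shift; lra.
have l0 : 0 <= slope v by rewrite /slope addr_ge0// divr_ge0// ltW.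
set q := 4 ^+ j in q0 *; set s := shift c in s0 *; set l := slope v in l0 *.
have ls0 : 0 <= l * s by rewrite mulr_ge0//; lra.
have main : 2 + l * (s * (2 * (4 * q * G + G + c + s))) <=
    (2 + 2 * l * s * (c + s + 5)) * q * G.
  have -> : 2 + l * (s * (2 * (4 * q * G + G + c + s))) =
    2 + 2 * (l * s) * (4 * q * G + G + c + s) by ring.
  have -> : (2 + 2 * l * s * (c + s + 5)) * q * G =
    2 * (q * G) + 2 * (l * s) * ((c + s + 5) * (q * G)) by ring.
  have qG : 1 <= q * G by rewrite -[leLHS]mulr1 ler_pM.
  have GqG : G <= q * G by rewrite ler_peMl// ltW.
  apply: lerD; first lra.
  rewrite ler_wpM2l//; first lra.
  have : (c + s) * 1 <= (c + s) * (q * G) by rewrite ler_wpM2l//; lra.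
  lra.
have -> : 2 * s / G * (2 + l * (s * (2 * (4 * q * G + G + c + s)))) =
  2 * s * (2 + l * (s * (2 * (4 * q * G + G + c + s)))) / G.
  by field; rewrite gt_eqF.
rewrite ler_pdivrMr//.
have -> : 2 * s * (2 + 2 * l * s * (c + s + 5)) * q * G =
  2 * s * ((2 + 2 * l * s * (c + s + 5)) * q * G) by ring.
by rewrite ler_wpM2l//; lra.
Qed.

Lemma measurable_peak_coincidence j l :
  measurable_fun setT (peak_coincidence z c G N j l).
Proof.
have [h|h] := boolP (2 ^+ j * G <= l.+1%:R * (G + c)).
  rewrite (_ : peak_coincidence z c G N j l = fun w =>
      (right_peak z c G N j l w)%:R * (left_peak z c G N l w)%:R).
    by apply: measurable_funM; exact: measurable_hit_success.
  by apply/funext => w; rewrite /peak_coincidence h.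
rewrite (_ : peak_coincidence z c G N j l = cst 0); first exact: measurable_cst.
by apply/funext => w; rewrite /peak_coincidence (negbTE h).
Qed.

Lemma integral_deep_count j :
  (\int[Q]_w (deep_count z c G N j w)%:E <= (count_const / 2 ^+ j)%:E)%E.
Proof.
have G1 := G_ge1; have c0 := c_gt0.
pose W := G + c; have W0 : 0 < W by rewrite /W; lra.
have q0 : 1 <= 2 ^+ j :> R by rewrite exprn_ege1// ler1n.
have q4 : 4 ^+ j = 2 ^+ j * 2 ^+ j :> R.
  by rewrite -exprMn; congr (_ ^+ _); ring.
set q := 2 ^+ j in q0 q4.
have mpc := measurable_peak_coincidence j.
under eq_integral do rewrite EFinD -sumEFin.
rewrite ge0_integralD//; last 3 first.
- by apply/measurable_EFinP; exact: measurable_hit_success.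
- by move=> w _; apply: sume_ge0 => l _; rewrite lee_fin peak_coincidence_ge0.
- apply: emeasurable_sum => l; exact/measurable_EFinP.
rewrite ge0_integral_sum//; last 2 first.
- by move=> l; exact/measurable_EFinP.
- by move=> l w _; rewrite lee_fin peak_coincidence_ge0.
rewrite /count_const mulrDl EFinD; apply: leeD.
  apply: (le_trans (integral_hit Hz c_gt0 sg1 _ (@right_sites_inj _) _ _ _)).
  - by rewrite mulr_ge0 ?exprn_ge0 ?(ltW G_gt0).
  - by rewrite gtrDl oppr_lt0 mulr_gt0 ?exprn_gt0.
  - by rewrite addr_ge0 ?(ltW c0)// mulr_ge0 ?exprn_ge0 ?(ltW G_gt0).
  rewrite lee_fin -/q q4 subr0 opprB addrCA subrr addr0.
  rewrite ler_pdivrMr ?mulr_gt0//; try lra.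
  have -> : (1 + c) / q * (q * q * G) = (1 + c) * (q * G).
    by field; rewrite gt_eqF//; lra.
  have : 1 <= q * G by rewrite -[leLHS]mulr1 ler_pM.
  by move=> qG; have : c * 1 <= c * (q * G); [rewrite ler_wpM2l// ltW|lra].
have each (l : nat) : (\int[Q]_w (peak_coincidence z c G N j l w)%:E <=
    (2 * (1 + c) / (q * q) * (4 * (1 + c) / q))%:E)%E.
  have [lW|lW] := boolP (2 ^+ j * G <= l.+1%:R * (G + c)); last first.
    under eq_integral do rewrite /peak_coincidence (negbTE lW).
    rewrite integral0 lee_fin !mulr_ge0 ?invr_ge0 ?mulr_ge0//; lra.
  under eq_integral do rewrite /peak_coincidence lW.
  rewrite integral_hit_prod [leRHS]EFinM; apply: lee_pmul.
  - by apply: integral_ge0 => w _; rewrite lee_fin.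
  - by apply: integral_ge0 => w _; rewrite lee_fin.
  - apply: (le_trans (integral_hit Hz c_gt0 sg1 _ (@right_sites_inj _) _ _ _)).
    + by rewrite ler_wpM2r ?(ltW W0)// ler_nat.
    + by rewrite gtrDl oppr_lt0 mulr_gt0 ?exprn_gt0.
    + by rewrite addr_ge0 ?(ltW c0)// mulr_ge0 ?(ltW W0).
    rewrite lee_fin -/W q4 -natr1 opprB addrCA subrr addr0.
    rewrite ler_pdivrMr ?mulr_gt0//; try lra.
    have -> : 2 * (1 + c) / (q * q) * (q * q * G) = 2 * (1 + c) * G.
      by field; rewrite gt_eqF//; lra.
    rewrite /W; have : c * 1 <= c * G by rewrite ler_wpM2l// ltW.
    lra.
  - apply: (le_trans (integral_hit Hz c_gt0 sgN1 _ (@left_sites_inj _) _ _ _)).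
    + by rewrite ler_wpM2r ?(ltW W0)// -addn2 natrD; lra.
    + by rewrite -[ltLHS]mul1r ltr_pM2r// ltr1n.
    + by rewrite addr_ge0 ?(ltW c0)// mulr_ge0 ?(ltW W0).
    rewrite lee_fin -/W; rewrite -/W in lW.
    have l2 : l.+2%:R = l.+1%:R + 1 :> R by rewrite natr1.
    have l1 : l%:R = l.+1%:R - 1 :> R by rewrite -natr1; ring.
    rewrite l2 l1; set y := l.+1%:R in lW *.
    have yW : 0 < y * W by rewrite mulr_gt0// ltr0n.
    have -> : (y + 1) * W - W = y * W by ring.
    have -> : (y + 1) * W + c - (y - 1 - 1) * W = 3 * W + c by ring.
    rewrite ler_pdivrMr//.
    apply: (@le_trans _ _ (4 * (1 + c) / q * (q * G))).
      have -> : 4 * (1 + c) / q * (q * G) = 4 * (1 + c) * G.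
        by field; rewrite gt_eqF//; lra.
      rewrite /W; have : c * 1 <= c * G by rewrite ler_wpM2l// ltW.
      lra.
    by rewrite ler_wpM2l// mulr_ge0 ?invr_ge0//; lra.
apply: (@le_trans _ _ (\sum_(l < (4 ^ j.+1).+1)
    (2 * (1 + c) / (q * q) * (4 * (1 + c) / q))%:E)%E).
  by apply: lee_sum => l _; exact: each.
rewrite sumEFin lee_fin sumr_const card_ord -[_ *+ _]mulr_natr.
have -> : (4 ^ j.+1).+1%:R = 4 * (q * q) + 1 :> R.
  by rewrite -[LHS]natr1 natrX exprS q4.
have -> : 2 * (1 + c) / (q * q) * (4 * (1 + c) / q) * (4 * (q * q) + 1) =
  (32 * (1 + c) ^+ 2 + 8 * (1 + c) ^+ 2 / (q * q)) / q.
  by field; rewrite gt_eqF//; lra.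
have qq : 1 <= q * q by rewrite -[leLHS]mulr1 ler_pM.
rewrite ler_wpM2r//; first by rewrite invr_ge0; lra.
have : 8 * (1 + c) ^+ 2 / (q * q) <= 8 * (1 + c) ^+ 2.
  rewrite ler_pdivrMr ?ler_peMr//; last lra.
  by rewrite mulr_ge0 ?sqr_ge0.
lra.
Qed.

Let measurable_level j : measurable_fun setT (level_bound z c v G N j) /\
  measurable_fun setT (deep_count z c G N j) /\
  measurable_fun setT (profile_sum z c v G N j).
Proof.
have m1 : measurable_fun setT (deep_count z c G N j).
  apply: measurable_funD; first exact: measurable_hit_success.
  by apply: measurable_sum => l; exact: measurable_peak_coincidence.
have m2 : measurable_fun setT (profile_sum z c v G N j).
  by apply: measurable_sum => m; exact: measurable_funM.
split => //; apply: measurable_funD; apply: measurable_funM => //.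
exact: measurable_funM.
Qed.

Lemma measurable_level_bound j : measurable_fun setT (level_bound z c v G N j).
Proof. by case: (measurable_level j). Qed.

(** The sums of [j / 2^j] and of [1 / 2^j] are both at most 2, whence the 6 = 3 * 2 and the 2. *)
Definition level_const : R :=
  6 * count_const / th + 2 * (expR (2 * th) * profile_const / th).

Let sum_geo n : \sum_(j < n) j%:R / 2 ^+ j <= 2 :> R /\
  \sum_(j < n) (2 ^+ j)^-1 <= 2 :> R.
Proof.
have H1 : \sum_(j < n) j%:R / 2 ^+ j + n.+1%:R * 2 / 2 ^+ n = 2 :> R.
  elim: n => [|n ih]; first by rewrite big_ord0 expr0; field.
  rewrite big_ord_recr /= -[RHS]ih -addrA; congr (_ + _).
  rewrite -!natr1 exprS; field.
  by rewrite expf_neq0.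
have H2 : \sum_(j < n) (2 ^+ j)^-1 + 2 / 2 ^+ n = 2 :> R.
  elim: n {H1} => [|n ih]; first by rewrite big_ord0 expr0; field.
  rewrite big_ord_recr /= -[RHS]ih -addrA; congr (_ + _).
  rewrite exprS; field.
  by rewrite expf_neq0.
split; first by rewrite -[leRHS]H1 lerDl divr_ge0 ?exprn_ge0// mulr_ge0.
by rewrite -[leRHS]H2 lerDl divr_ge0 ?exprn_ge0.
Qed.

Lemma integral_level_bounds J :
  measurable_fun setT (fun w => \sum_(j < J) level_bound z c v G N j w) /\
  (\int[Q]_w (\sum_(j < J) level_bound z c v G N j w)%:E <= level_const%:E)%E.
Proof.
split; first by apply: measurable_sum => j; case: (measurable_level j).
under eq_integral do rewrite -sumEFin.
rewrite ge0_integral_sum//; last 2 first.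
- by move=> j; apply/measurable_EFinP; case: (measurable_level j).
- by move=> j w _; rewrite lee_fin level_bound_ge0.
have e0 : 0 <= expR (2 * th) * profile_const / th.
  exact: (divr_ge0 (mulr_ge0 (expR_ge0 _) profile_const_ge0) (ltW th_gt0)).
have each (j : nat) : (\int[Q]_w (level_bound z c v G N j w)%:E <=
    (3 * count_const / th * (j%:R / 2 ^+ j) +
     expR (2 * th) * profile_const / th * (2 ^+ j)^-1)%:E)%E.
  have [_ [m1 m2]] := measurable_level j.
  have a0 : 0 <= 3 * j%:R / th.
    exact: (divr_ge0 (mulr_ge0 (ler0n _ 3) (ler0n _ j)) (ltW th_gt0)).
  have b0 : 0 <= th^-1 * expR (- (3 * j%:R)) * expR (2 * th).
    by rewrite !mulr_ge0 ?expR_ge0// invr_ge0 ltW.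
  rewrite /level_bound.
  under eq_integral do rewrite [_ * (_ * profile_sum _ _ _ _ _ _ _)]mulrA.
  rewrite ge0_integral_lincomb//; last 2 first.
  - by move=> w; exact: deep_count_ge0.
  - by move=> w; exact: profile_sum_ge0.
  rewrite EFinD; apply: leeD.
    have -> : 3 * count_const / th * (j%:R / 2 ^+ j) =
        3 * j%:R / th * (count_const / 2 ^+ j) by ring.
    rewrite [leRHS]EFinM; apply: lee_wpmul2l; first by rewrite lee_fin.
    exact: integral_deep_count.
  apply: (@le_trans _ _ ((th^-1 * expR (- (3 * j%:R)) * expR (2 * th))%:E *
     (profile_const * 4 ^+ j)%:E)%E).
    by apply: lee_wpmul2l; [rewrite lee_fin|exact: integral_profile_sum].
  rewrite -EFinM lee_fin.
  have -> : th^-1 * expR (- (3 * j%:R)) * expR (2 * th) *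
      (profile_const * 4 ^+ j) = expR (2 * th) * profile_const / th *
      (4 ^+ j * expR (- (3 * j%:R))) by ring.
  rewrite ler_wpM2l// expRN ler_pdivrMr ?expR_gt0//.
  (* As [expR 1 ^+ 3 >= 8], the factor [expR (- (3 * j))] brings [4^j] down to [2^-j]; this is the
     origin of the 3 in the choice of [a]. *)
  have -> : (2 ^+ j)^-1 * expR (3 * j%:R) = (expR 1 ^+ 3 / 2) ^+ j :> R.
    rewrite [3 * _]mulrC expRM_natl -[X in expR X ^+ _]mulr1 expRM_natl.
    by rewrite [RHS]expr_div_n mulrC.
  rewrite lerXn2r ?nnegrE ?divr_ge0 ?exprn_ge0 ?expR_ge0//.
  have e2 : (2 : R) <= expR 1 by have := expR_ge1Dx (1 : R); lra.
  have : 2 ^+ 3 <= expR 1 ^+ 3 :> R by rewrite lerXn2r ?nnegrE ?expR_ge0.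
  rewrite ler_pdivlMr//; lra.
apply: (@le_trans _ _ (\sum_(j < J) (3 * count_const / th * (j%:R / 2 ^+ j) +
     expR (2 * th) * profile_const / th * (2 ^+ j)^-1)%:E)%E).
  by apply: lee_sum => j _; exact: each.
rewrite sumEFin lee_fin big_split /= -!mulr_sumr /level_const.
have [g1 g2] := sum_geo J.
apply: lerD.
  have -> : 6 * count_const / th = 3 * count_const / th * 2 by ring.
  rewrite ler_wpM2l//.
  exact: (divr_ge0 (mulr_ge0 (ler0n _ 3) count_const_ge0) (ltW th_gt0)).
by rewrite [leRHS]mulrC ler_wpM2l.
Qed.

End level_integrals.

(** * Almost sure existence of a deep valley *)

(** Serves for a set not known to be measurable, by enclosing it in a countable intersection of
    measurable sets. *)
Lemma negligible_small d (T : measurableType d) (R : realType)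
    (Q : probability T R) (A : set T) :
  (forall e : R, 0 < e -> exists E, [/\ measurable E, A `<=` E & (Q E <= e%:E)%E]) ->
  Q.-negligible A.
Proof.
move=> H.
have [E HE] := choice (fun n : nat => H (n.+1%:R^-1) (ltac:(by rewrite invr_gt0))).
have mE n : measurable (E n) by case: (HE n).
exists (\bigcap_n E n); split.
- exact: bigcap_measurable.
- apply/eqP; rewrite eq_le measure_ge0 andbT; apply/lee_addgt0Pr => e e0.
  rewrite add0e.
  have [n ne] : exists n : nat, n.+1%:R^-1 <= e.
    exists (Num.truncn e^-1); rewrite invf_ple ?posrE//.
    by rewrite ltW// truncnS_gt.
  apply: (@le_trans _ _ (Q (E n))).
    apply: le_measure; rewrite ?inE//; first exact: bigcap_measurable.
    exact: bigcap_inf.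
  by case: (HE n) => _ _ h; apply: (le_trans h); rewrite lee_fin.
- by move=> w Aw n _; case: (HE n) => _ + _; exact.
Qed.

Section existence_almost_surely.
Context {R : realType} {d : measure_display} {T : measurableType d}.
Variables (Q : probability T R) (z : int -> T -> R) (c v : R).
Hypotheses (Hz : centered_walk Q z c v).
Hypotheses (c_gt0 : 0 < c) (v_gt0 : 0 < v) (v_le : v <= c ^+ 2).
Local Notation th := (theta c v).

Let probability_bool (b : T -> bool) :
  measurable_fun setT (fun w => (b w)%:R : R) ->
  measurable [set w | b w] /\ Q [set w | b w] = (\int[Q]_w ((b w)%:R)%:E)%E.
Proof.
move=> mb.
have mB : measurable [set w | b w].
  rewrite (_ : [set w | b w] = (fun w => (b w)%:R : R) @^-1` [set 1]).
    by rewrite -[X in measurable X]setTI; apply: mb.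
  apply/seteqP; split => w /=; first by move=> ->.
  by case: (b w) => // /eqP; rewrite eq_sym oner_eq0.
split => //; transitivity (\int[Q]_w (\1_[set w | b w] w)%:E)%E.
  by rewrite integral_indic// setIT.
by apply: eq_integral => w _; rewrite indicE mem_setE.
Qed.

Section side.
Variables (sg : R) (idx : nat -> int).
Hypotheses (sgE : sg ^+ 2 = 1) (inj : injective idx).

Let duration (A H : R) n w : R :=
  let x := run (exit_step (A + H)) (A, 0, 0) (fun k => sg * z (idx k) w) n in
  (1 + `|x.2|) * expR (th * x.1.2).

(** Three bad events: a long stay between [- A] and [H] (the first set contains the paths that have
    not left by time [n]), a fall to [- A] before [H], and a return to 0 after height [H - g] and
    before [H]. *)
Definition not_reaching (A H g : R) (n : nat) : set T :=
  [set w | (n%:R <= duration A H n w)] `|`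
  ([set w | hit_success z sg 0 (- A) H idx n w] `|`
   [set w | hit_success z sg (H - g) 0 H idx n w]).

Let measurable_duration A H n : measurable_fun setT (duration A H n).
Proof.
have mr := measurable_run (measurable_exit_step (A + H)) Hz sg (A, 0, 0) idx n.
apply: measurable_funM.
  apply: measurable_funD => //; apply: (measurableT_comp (@normr_measurable _ _)).
  exact: (measurableT_comp measurable_snd mr).
apply: (measurableT_comp (@measurable_expR R)); apply: measurable_funM => //.
apply: (measurableT_comp measurable_snd).
exact: (measurableT_comp measurable_fst mr).
Qed.

(** The parameters are fixed in the order [H], [A], [n]: the return has probability at most
    [(g + c) / H], the fall at most [(H + c) / (A + H)], and the long stay at most [K / n] by
    Markov's inequality. *)
Lemma not_reaching_small (g e : R) : 0 < g -> 0 < e -> exists H0 : R,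
  forall H, H0 <= H -> exists A n0, 0 < A /\ forall n, (n0 <= n)%N ->
  measurable (not_reaching A H g n) /\ (Q (not_reaching A H g n) <= e%:E)%E.
Proof.
move=> g0 e0; have c0 := c_gt0.
have e3 : 0 < e / 3 by rewrite divr_gt0.
exists (Num.max 1 ((g + c) / (e / 3))) => H; rewrite ge_max => /andP[H1 H2].
pose A := (H + c) / (e / 3).
have A0 : 0 < A by rewrite /A divr_gt0//; lra.
pose K := 2 + slope v * ((A + shift c) * (2 * (A + H + c + shift c))).
exists A, (Num.truncn (K / (e / 3))).+1; split => // n nK.
have n0 : 0 < n%:R :> R by rewrite ltr0n (leq_trans _ nK).
have m1 : measurable [set w | n%:R <= duration A H n w].
  have mle : measurable_fun setT (fun w => n%:R <= duration A H n w).
    by apply: measurable_fun_ler => //; exact: measurable_duration.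
  by rewrite -[X in measurable X]setTI; exact: (mle measurableT [set true]).
have [m2 p2] := probability_bool
  (measurable_hit_success Hz sg 0 (- A) H idx n).
have [m3 p3] := probability_bool
  (measurable_hit_success Hz sg (H - g) 0 H idx n).
have -> : e%:E = ((e / 3)%:E + ((e / 3)%:E + (e / 3)%:E))%E.
  by rewrite -!EFinD; congr (_%:E); field.
split; first by apply: measurableU => //; exact: measurableU.
apply: (le_trans (measureU2 _ m1 (measurableU _ _ m2 m3))).
apply: leeD; last first.
  apply: (le_trans (measureU2 _ m2 m3)).
  apply: leeD.
    rewrite [X in (X <= _)%E]p2; apply: (le_trans (integral_hit Hz c_gt0 sgE _ inj _ _ _));
      [lra|lra|lra|].
    rewrite lee_fin subr0 opprK ler_pdivrMr; last lra.
    have : e / 3 * A = H + c by rewrite /A mulrCA divff ?mulr1// gt_eqF.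
    have : 0 <= e / 3 * H by rewrite mulr_ge0 ?ltW//; lra.
    lra.
  rewrite [X in (X <= _)%E]p3; apply: (le_trans (integral_hit Hz c_gt0 sgE _ inj _ _ _));
      [lra|lra|lra|].
  rewrite lee_fin subr0 ler_pdivrMr; last lra.
  by move: H2; rewrite ler_pdivrMr// mulrC; lra.
have nK' : K <= e / 3 * n%:R.
  rewrite mulrC -ler_pdivrMr//; apply: (@le_trans _ _ (Num.truncn (K / (e / 3))).+1%:R).
    by rewrite ltW// truncnS_gt.
  by rewrite ler_nat.
rewrite -(@lee_pmul2l _ n%:R%:E)//.
apply: (@le_trans _ _ K%:E); last by rewrite -EFinM lee_fin mulrC.
apply: (le_trans _ (integral_duration_weight_all Hz c_gt0 v_gt0 v_le sgE n _ inj)); last first.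
  by apply/andP; split; lra.
have QE : Q [set w | n%:R <= duration A H n w] =
    (\int[Q]_w (\1_[set w | n%:R <= duration A H n w] w)%:E)%E.
  by rewrite integral_indic// setIT.
rewrite [X in (_ * X <= _)%E]QE.
rewrite -ge0_integralZl_EFin//; last first.
  by apply/measurable_EFinP; exact: measurable_indic.
apply: ge0_le_integral => //.
- by apply: measurable_funeM; apply/measurable_EFinP; exact: measurable_indic.
- by apply/measurable_EFinP; exact: measurable_duration.
move=> w _; rewrite -EFinM lee_fin indicE.
case: (boolP (w \in _)) => [|_]; first by rewrite inE /= mulr1.
by rewrite mulr0 mulr_ge0 ?expR_ge0// addr_ge0.
Qed.

(** [k] is the first passage at height [H]; without a passage by time [n], the path would be in one
    of the first two bad events. *)
Lemma reaching (A H g : R) (n : nat) w (y : nat -> R) : 0 < A -> 0 < H ->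
  y 0%N = 0 -> (forall k, sg * z (idx k) w = y k.+1 - y k) ->
  ~ not_reaching A H g n w ->
  exists k, [/\ (k <= n)%N, H <= y k, forall i, (i < k)%N -> y i < H &
    forall p q, (p <= q)%N -> (q < k)%N -> H - g <= y p -> 0 < y q].
Proof.
move=> A0 H0 y0 yE /not_orP[ns /not_orP[nl nd]].
have ex : exists k, (k <= n)%N && (H <= y k).
  apply: contrapT => nex.
  have yH k : (k <= n)%N -> y k < H.
    by move=> kn; rewrite ltNge; apply/negP => Hk; apply: nex; exists k; rewrite kn.
  have yA k : (k <= n)%N -> - A < y k.
    move=> kn; rewrite ltNge; apply/negP => Ak; apply: nl => /=.
    apply: (@hit_run_success _ _ _ _ y _ 0 k) => //; first by rewrite y0.
    by move=> i ik; apply: yH; rewrite (leq_trans (ltnW ik)).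
  apply: ns => /=; rewrite /duration.
  have -> : run (exit_step (A + H)) (A, 0, 0) (fun k => sg * z (idx k) w) n =
      (A + y n, \sum_(k < n) expR (- (A + y k)), n%:R).
    have := @exit_run_alive _ (A + H) (fun k => A + y k)
      (fun k => sg * z (idx k) w) n.
    rewrite y0 addr0; apply => k kn; first by rewrite yE; ring.
    by have := yH k (ltnW kn); have := yA k (ltnW kn); lra.
  rewrite /= ger0_norm//.
  apply: (@le_trans _ _ (1 + n%:R)); first by rewrite lerDr.
  rewrite ler_peMr ?addr_ge0//.
  apply: le_trans (expR_ge1Dx _); rewrite lerDl mulr_ge0 ?(ltW (theta_gt0 _ _))//.
  by apply: sumr_ge0 => k _; exact: expR_ge0.
case: (ex_minnP ex) => k /andP[kn Hk] kmin; exists k; split => //.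
  move=> i ik; rewrite ltNge; apply/negP => Hi.
  by have := kmin i; rewrite Hi (leq_trans (ltnW ik) kn) => /(_ isT); rewrite leqNgt ik.
move=> p q pq qk Hp; rewrite ltNge; apply/negP => yq; apply: nd => /=.
apply: (@hit_run_success _ _ _ _ y _ p q) => //.
  by rewrite pq (leq_trans (ltnW qk) kn).
move=> i iq; rewrite ltNge; apply/negP => Hi.
have := kmin i; rewrite Hi (leq_trans (ltnW (ltn_trans iq qk)) kn) => /(_ isT).
by rewrite leqNgt (ltn_trans iq qk).
Qed.

End side.

(** Off the bad events of both sides, taken at a common height [H >= G], the first passages at [H]
    enclose a deep valley. *)
Lemma negligible_no_deep_valley (S : T -> int -> R) (G g : R) :
  (forall w, S w 0 = 0) -> (forall w k, S w k - S w (k - 1) = z k w) ->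
  0 < G -> 0 < g ->
  Q.-negligible [set w | ~ exists V, deep_valley (S w) G g V].
Proof.
move=> S0 SE G0 g0; apply: negligible_small => e e0.
have e2 : 0 < e / 2 by rewrite divr_gt0.
have sg1 : (1 : R) ^+ 2 = 1 by rewrite expr1n.
have sgN1 : (- 1 : R) ^+ 2 = 1 by rewrite sqrrN expr1n.
have [H1 HH1] := not_reaching_small sg1 (@right_sites_inj 0) g0 e2.
have [H2 HH2] := not_reaching_small sgN1 (@left_sites_inj 0) g0 e2.
pose H := Num.max G (Num.max H1 H2).
have GH : G <= H by rewrite /H le_max lexx.
have [A1 [n1 [A10 Hn1]]] := HH1 H (ltac:(by rewrite /H !le_max lexx !orbT)).
have [A2 [n2 [A20 Hn2]]] := HH2 H (ltac:(by rewrite /H !le_max lexx !orbT)).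
pose n := maxn n1 n2.
have [m1 p1] := Hn1 n (leq_maxl _ _).
have [m2 p2] := Hn2 n (leq_maxr _ _).
exists (not_reaching 1 (right_sites 0) A1 H g n `|`
  not_reaching (- 1) (left_sites 0) A2 H g n); split.
- exact: measurableU.
- apply: subsetCl => w /not_orP[nr nl].
  have H0 : 0 < H by exact: lt_le_trans GH.
  have yR k : 1 * z (right_sites 0 k) w = S w k.+1%:Z - S w k%:Z.
    rewrite mul1r -SE (_ : right_sites 0 k = k.+1%:Z).
      by rewrite (_ : k.+1%:Z - 1 = k%:Z)//; int_lia R.
    by rewrite /right_sites; int_lia R.
  have yL k : - 1 * z (left_sites 0 k) w = S w (- k.+1%:Z) - S w (- k%:Z).
    rewrite mulN1r -SE opprB (_ : left_sites 0 k = - k%:Z).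
      by rewrite (_ : - k%:Z - 1 = - k.+1%:Z)//; int_lia R.
    by rewrite /left_sites; int_lia R.
  have [r [rn Hr rlow rlate]] := reaching (y := fun k => S w k%:Z)
    A10 H0 (S0 w) yR nr.
  have [l [ln Hl llow llate]] := reaching (y := fun k => S w (- k%:Z))
    A20 H0 (S0 w) yL nl.
  have r0 : (0 < r)%N.
    by case: r Hr {rn rlow rlate} => //; rewrite S0 leNgt H0.
  have l0 : (0 < l)%N.
    by case: l Hl {ln llow llate} => //; rewrite oppr0 S0 leNgt H0.
  apply: (deep_valley_of_levels G0 (S0 w) (H := H) (a := - l%:Z) (b := r%:Z)).
  + by int_lia R.
  + by int_lia R.
  + by [].
  + by [].
  + by [].
  + move=> k klr; have [k0|k0] := leP 0 k.
      have -> : k = `|k|%N%:Z by int_lia R.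
      by apply: rlow; int_lia R.
    have -> : k = - `|k|%N%:Z by int_lia R.
    by apply: llow; int_lia R.
  + move=> p q p0 pq qr; have -> : p = `|p|%N%:Z by int_lia R.
    have -> : q = `|q|%N%:Z by int_lia R.
    by apply: rlate; int_lia R.
  + move=> p q p0 pq qr; have -> : p = - `|p|%N%:Z by int_lia R.
    have -> : q = - `|q|%N%:Z by int_lia R.
    by apply: llate; int_lia R.
- apply: (le_trans (measureU2 _ m1 m2)).
  have -> : e%:E = ((e / 2)%:E + (e / 2)%:E)%E.
    by rewrite -EFinD; congr (_%:E); field.
  exact: leeD.
Qed.

End existence_almost_surely.

(** * Quenched local times *)

Section taboo_probabilities.
Context {R : realType}.

(* [taboo e m n k] is the probability that the walk started at [m] is at [k]
   at time [n.+1] and has not visited [m] at the times [1, ..., n]. *)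
Fixpoint taboo (e : int -> R) (m : int) (n : nat) (k : int) : R :=
  if n is n'.+1 then
    (if k - 1 == m then 0 else taboo e m n' (k - 1) * e (k - 1)) +
    (if k + 1 == m then 0 else taboo e m n' (k + 1) * (1 - e (k + 1)))
  else rwre_step e m k.

Variables (e : int -> R) (m : int).
Hypothesis e01 : forall i, 0 < e i < 1.

Lemma rwre_step_ge0 i j : 0 <= rwre_step e i j.
Proof.
by rewrite /rwre_step; have /andP[h1 h2] := e01 i;
  case: ifP => _; [exact: ltW|case: ifP => // _; lra].
Qed.

Lemma taboo_ge0 n k : 0 <= taboo e m n k.
Proof.
elim: n k => [|n ih] k /=; first exact: rwre_step_ge0.
have /andP[h1 h2] := e01 (k - 1); have /andP[h3 h4] := e01 (k + 1).
by apply: addr_ge0; case: ifP => // _; rewrite mulr_ge0//; lra.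
Qed.

(* The reversible measure of the chain, normalised at [m], is an excessive
   measure for the chain killed at [m]. *)
Lemma sum_taboo_le (S : int -> R) N k :
  (forall i, S i - S (i - 1) = log_ratio (e i)) ->
  \sum_(n < N) taboo e m n k <= e m / e k * expR (- (S k - S m)).
Proof.
move=> SE.
have e0 i : 0 < e i by case/andP: (e01 i).
have e1 i : 0 < 1 - e i by have /andP[_] := e01 i; lra.
have ratio i : expR (S i - S (i - 1)) = (1 - e i) / e i.
  by rewrite SE /log_ratio lnK// posrE divr_gt0.
pose wt i := e m / e i * expR (- (S i - S m)).
have wm : wt m = 1 by rewrite /wt subrr oppr0 expR0 mulr1 divff// gt_eqF.
have wl i : wt (i - 1) * e (i - 1) = wt i * (1 - e i).
  rewrite /wt (_ : - (S (i - 1) - S m) = - (S i - S m) + (S i - S (i - 1))).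
    by rewrite expRD ratio; field; rewrite !gt_eqF.
  by ring.
have wr i : wt (i + 1) * (1 - e (i + 1)) = wt i * e i.
  by have := wl (i + 1); rewrite addrK.
(* A neighbour of [k] other than [m] sends to [k] at most its weight times the step probability, by
   induction. If the neighbour is [m], of weight 1, the first step supplies exactly that amount. By
   reversibility the two contributions add up to [wt k]. *)
rewrite -/(wt k); elim: N k => [|N ih] k.
  by rewrite big_ord0 /wt mulr_ge0 ?expR_ge0// divr_ge0// ltW.
rewrite big_ord_recl /=.
rewrite big_split /=.
have hl : \sum_(i < N) (if k - 1 == m then 0 else taboo e m i (k - 1) * e (k - 1))
    <= (if k - 1 == m then 0 else wt (k - 1) * e (k - 1)).
  case: ifP => _; first by rewrite big1.
  by rewrite -mulr_suml ler_wpM2r// ltW.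
have hr : \sum_(i < N) (if k + 1 == m then 0 else taboo e m i (k + 1) * (1 - e (k + 1)))
    <= (if k + 1 == m then 0 else wt (k + 1) * (1 - e (k + 1))).
  case: ifP => _; first by rewrite big1.
  by rewrite -mulr_suml ler_wpM2r// ltW.
apply: (@le_trans _ _ (wt (k - 1) * e (k - 1) + wt (k + 1) * (1 - e (k + 1)))); last first.
  by rewrite wl wr -mulrDr subrK mulr1.
have w0 i : 0 < wt i by rewrite /wt mulr_gt0 ?expR_gt0// divr_gt0.
have pl : 0 < wt (k - 1) * e (k - 1) by rewrite mulr_gt0.
have pr : 0 < wt (k + 1) * (1 - e (k + 1)) by rewrite mulr_gt0.
rewrite /rwre_step.
have [kl|kl] := eqVneq (k - 1) m.
  have -> : (k == m + 1) = true by apply/eqP; lia.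
  move: hl hr; rewrite kl eqxx wm mul1r => hl hr.
  have kr : (k + 1 == m) = false by apply/eqP; lia.
  by move: hr; rewrite kr => hr; lra.
have -> : (k == m + 1) = false by apply/eqP => E; move/eqP: kl; lia.
rewrite (negbTE kl) in hl.
have [kr|kr] := eqVneq (k + 1) m.
  have -> : (k == m - 1) = true by apply/eqP; lia.
  by move: hr; rewrite kr eqxx wm mul1r => hr; lra.
have -> : (k == m - 1) = false by apply/eqP => E; move/eqP: kr; lia.
by rewrite (negbTE kr) in hr; lra.
Qed.

End taboo_probabilities.

Section quenched_walk.
Context {R : realType} {d : measure_display} {T : measurableType d}.
Variables (X : nat -> T -> int) (P : (int -> R) -> int -> probability T R).
Hypothesis HQ : quenched_laws X P.

Definition adapted (n : nat) (C : (nat -> int) -> Prop) :=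
  forall x y, (forall l, (l <= n)%N -> x l = y l) -> C x -> C y.

Let mX n k : measurable [set w | X n w = k]. Proof. by case: HQ. Qed.

Let cyl n (x : nat -> int) : set T :=
  [set w | forall k, (k <= n)%N -> X k w = x k].

Let measurable_cyl n x : measurable (cyl n x).
Proof.
rewrite (_ : cyl n x = \bigcap_k (if (k <= n)%N then [set w | X k w = x k] else setT)).
  by apply: bigcapT_measurable => k; case: ifP.
apply/seteqP; split => w /=.
  by move=> H k _; case: ifP => //= kn; exact: H.
by move=> H k kn; have := H k I; rewrite kn.
Qed.

(** Initial segments of paths are countable; numbering them cuts an event that depends on the times
    up to [n] into countably many cylinders, the sets described by [quenched_laws]. *)
Let code n w : nat := pickle [seq X i w | i <- iota 0 n.+1].

Let code_eq n w w' : code n w = code n w' <->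
  (forall l, (l <= n)%N -> X l w = X l w').
Proof.
split => [/(pcan_inj pickleK)/eq_in_map H l ln|H].
  by apply: H; rewrite mem_iota add0n ltnS.
congr pickle; apply/eq_in_map => l; rewrite mem_iota add0n ltnS => ln.
exact: H.
Qed.

Let code_cyl n (C : (nat -> int) -> Prop) i : adapted n C ->
  [set w | C (X^~ w) /\ code n w = i] = set0 \/
  exists x, C x /\ [set w | C (X^~ w) /\ code n w = i] = cyl n x /\
    forall w, cyl n x w <-> C (X^~ w) /\ code n w = i.
Proof.
move=> aC; have [[w0 [Cw0 w0i]]|nw] := pselect (exists w, C (X^~ w) /\ code n w = i).
  right; exists (X^~ w0); split => //.
  have H w : cyl n (X^~ w0) w <-> C (X^~ w) /\ code n w = i.
    split=> [Hw|[Cw wi]].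
      split; first by apply: aC Cw0 => l ln; rewrite Hw.
      by rewrite -w0i; apply/code_eq => l ln; exact: Hw.
    by move=> l ln; apply: (code_eq n w w0).1 => //; rewrite wi w0i.
  by split => //; apply/seteqP; split => w /H.
by left; apply/seteqP; split => w // Hw; apply: nw; exists w.
Qed.

Lemma measurable_adapted n C : adapted n C -> measurable [set w | C (X^~ w)].
Proof.
move=> aC; rewrite (_ : [set w | _] =
    \bigcup_i [set w | C (X^~ w) /\ code n w = i]); last first.
  apply/seteqP; split => w /=; first by move=> Cw; exists (code n w).
  by move=> [i _ []].
apply: bigcupT_measurable => i.
by have [->//|[x [_ [-> _]]]] := code_cyl i aC.
Qed.

Variables (e : int -> R) (m : int).
Hypothesis e01 : forall i, 0 < e i < 1.
Local Notation Pe := (P e m).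

Let start : Pe [set w | X 0%N w = m] = 1%E.
Proof. by case: HQ => _ /(_ e m e01)[]. Qed.

Let decompose n (A : set T) : measurable A ->
  Pe A = (\sum_(i <oo) Pe (A `&` [set w | code n w = i]))%E.
Proof.
move=> mA; rewrite -measure_semi_bigcup.
- congr (Pe _); rewrite -setI_bigcupr; apply/seteqP; split => w //=.
    by move=> Aw; split => //; exists (code n w).
  by case.
- move=> i; apply: measurableI => //.
  have aT : adapted n (fun=> True) by [].
  have [E|[x [_ [E _]]]] := code_cyl i aT.
    by rewrite (_ : [set w | _] = set0)// -E; apply/seteqP; split => w //= [].
  by rewrite (_ : [set w | _] = cyl n x)// -E; apply/seteqP; split => w //= [].
- by move=> i j _ _ [w /= [[_ <-] [_ <-]]].
- apply: bigcupT_measurable => i; apply: measurableI => //.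
  have aT : adapted n (fun=> True) by [].
  have [E|[x [_ [E _]]]] := code_cyl i aT.
    by rewrite (_ : [set w | _] = set0)// -E; apply/seteqP; split => w //= [].
  by rewrite (_ : [set w | _] = cyl n x)// -E; apply/seteqP; split => w //= [].
Qed.

Lemma quenched_markov n C j k : adapted n C ->
  Pe [set w | C (X^~ w) /\ X n w = j /\ X n.+1 w = k] =
  (Pe [set w | C (X^~ w) /\ X n w = j] * (rwre_step e j k)%:E)%E.
Proof.
move=> aC.
have aC' : adapted n (fun x => C x /\ x n = j).
  by move=> x y xy [Cx xn]; split; [exact: aC Cx|rewrite -xy].
have mA : measurable [set w | C (X^~ w) /\ X n w = j] by exact: measurable_adapted aC'.
have mB : measurable [set w | C (X^~ w) /\ X n w = j /\ X n.+1 w = k].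
  rewrite (_ : [set w | _] = [set w | C (X^~ w) /\ X n w = j] `&` [set w | X n.+1 w = k]).
    exact: measurableI.
  by apply/seteqP; split => w /=; [move=> [? [? ?]]|move=> [[? ?] ?]].
rewrite (decompose n mA) (decompose n mB) muleC -nneseriesZl//.
apply: eq_eseriesr => i _.
have [E|[x [[Cx xn] [E H]]]] := code_cyl i aC'.
  rewrite (_ : _ `&` _ = set0); last first.
    rewrite -subset0 => w /= [[Cw [wj wk]] wi].
    by have : set0 w by rewrite -E /=.
  by rewrite measure0 (_ : _ `&` _ = set0) ?measure0 ?mule0.
rewrite (_ : [set w | C (X^~ w) /\ X n w = j] `&` _ = cyl n x) ?E//.
pose x' l := if (l <= n)%N then x l else k.
rewrite (_ : _ `&` _ = cyl n.+1 x'); last first.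
  apply/seteqP; split => w /=.
    move=> [[Cw [wj wk]] wi] l; rewrite leq_eqVlt ltnS => /orP[/eqP ->|ln].
      by rewrite /x' ltnn.
    by rewrite /x' ln; apply: (H w).2.
  move=> Hw.
  have Hn : cyl n x w by move=> l ln; rewrite Hw ?leqW// /x' ln.
  have [[Cw wj] wi] := (H w).1 Hn; split => //; split => //; split => //.
  by rewrite Hw// /x' ltnn.
have [_ /(_ e m e01)[_ /(_ n x')]] := HQ.
rewrite -/(cyl n.+1 x') => ->.
rewrite /x' leqnn ltnn xn muleC; congr (_ * Pe _)%E.
by apply/seteqP; split => w /= Hw l ln; rewrite Hw// ln.
Qed.

(** The values of [X n] are countable, and each one other than [k - 1] and [k + 1] contributes a
    null event. *)
Lemma quenched_step_null n k :
  Pe [set w | X n w <> k - 1 /\ X n w <> k + 1 /\ X n.+1 w = k] = 0%E.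
Proof.
have mA : measurable [set w | X n w <> k - 1 /\ X n w <> k + 1 /\ X n.+1 w = k].
  rewrite (_ : [set w | _] = (~` [set w | X n w = k - 1]) `&`
    ((~` [set w | X n w = k + 1]) `&` [set w | X n.+1 w = k]))//.
  by apply: measurableI; [|apply: measurableI => //]; exact: measurableC.
suff : Pe.-negligible [set w | X n w <> k - 1 /\ X n w <> k + 1 /\ X n.+1 w = k].
  by rewrite negligibleP.
rewrite (_ : [set w | _] = \bigcup_i [set w |
  (X n w <> k - 1 /\ X n w <> k + 1 /\ X n.+1 w = k) /\ pickle (X n w) = i]); last first.
  apply/seteqP; split => w /=; first by move=> Hw; exists (pickle (X n w)).
  by move=> [i _ []].
apply: negligible_bigcup => i.
have [[j [j1 [j2 ji]]]|nj] :=
    pselect (exists j : int, j <> k - 1 /\ j <> k + 1 /\ pickle j = i); last first.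
  apply: (negligibleS _ (negligible_set0 _)) => w /= [[w1 [w2 _]] wi].
  by apply: nj; exists (X n w).
have aT : adapted n (fun=> True) by [].
have := quenched_markov j k aT.
rewrite /rwre_step; have -> : (k == j + 1) = false by apply/eqP; lia.
have -> : (k == j - 1) = false by apply/eqP; lia.
rewrite mule0 => H0.
apply: (@negligibleS _ _ _ _ [set w | True /\ X n w = j /\ X n.+1 w = k]).
  move=> w /= [[w1 [w2 wk]] wi]; split => //; split => //.
  by apply: (pcan_inj pickleK); rewrite ji.
apply/negligibleP => //.
rewrite (_ : [set w | _] = [set w | X n w = j] `&` [set w | X n.+1 w = k]).
  exact: measurableI.
by apply/seteqP; split => w /=; [move=> [_ []]|move=> []].
Qed.

Definition no_return (n : nat) (x : nat -> int) : Prop :=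
  forall j, (1 <= j <= n)%N -> x j <> m.

Lemma adapted_no_return n : adapted n (no_return n).
Proof. by move=> x y xy Hx j jn; rewrite -xy; [exact: Hx|case/andP: jn]. Qed.

Let mE n k : measurable [set w | no_return n (X^~ w) /\ X n.+1 w = k].
Proof.
rewrite (_ : [set w | _] = [set w | no_return n (X^~ w)] `&` [set w | X n.+1 w = k])//.
by apply: measurableI => //; exact: measurable_adapted (@adapted_no_return n).
Qed.

(** Outside a null event the position before the last step is [k - 1] or [k + 1]; from the second
    step on, the value [m] is excluded there, as it would be a return. *)
Lemma taboo_probability n k :
  Pe [set w | no_return n (X^~ w) /\ X n.+1 w = k] = (taboo e m n k)%:E.
Proof.
elim: n k => [|n ih] k.
  have aT : adapted 0 (fun=> True) by [].
  have := quenched_markov m k aT.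
  rewrite (_ : [set w | True /\ X 0%N w = m] = [set w | X 0%N w = m]); last first.
    by apply/seteqP; split => w //= [].
  rewrite start mul1e /= => <-.
  have m0 : Pe (~` [set w | X 0%N w = m]) = 0%E.
    by rewrite probability_setC// start subee.
  have mS : measurable [set w | True /\ X 0%N w = m /\ X 1%N w = k].
    rewrite (_ : [set w | _] = [set w | X 0%N w = m] `&` [set w | X 1%N w = k]).
      exact: measurableI.
    by apply/seteqP; split => w /=; [move=> [_ []]|move=> []].
  apply/eqP; rewrite eq_le; apply/andP; split.
    apply: (@le_trans _ _ (Pe ([set w | True /\ X 0%N w = m /\ X 1%N w = k] `|`
        ~` [set w | X 0%N w = m]))).
      apply: le_measure; rewrite ?inE//.
        by apply: measurableU => //; exact: measurableC.
      move=> w /= [_ w1]; have [w0|w0] := pselect (X 0%N w = m); [left|right] => //.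
    apply: (le_trans (measureU2 _ mS (measurableC (mX _ _)))).
    by rewrite [X in (_ + X)%E]m0 adde0.
  apply: le_measure; rewrite ?inE//.
  by move=> w /= [_ [w0 w1]]; split => // j; case: j.
pose E (j : int) : set T := [set w | no_return n.+1 (X^~ w) /\ X n.+1 w = j /\ X n.+2 w = k].
have aN := @adapted_no_return n.+1.
have PE j : Pe (E j) = ((if j == m then 0 else taboo e m n j) * rwre_step e j k)%:E.
  rewrite /E quenched_markov// EFinM; congr (_ * _)%E.
  case: eqP => [->|jm].
    rewrite (_ : [set w | _] = set0) ?measure0// -subset0 => w /= [Hw wm].
    by apply: (Hw n.+1) => //; rewrite leqnn.
  rewrite -ih; congr (Pe _); apply/seteqP; split => w /= [Hw wj]; split => //.
    by move=> i /andP[i1 iN]; apply: Hw; rewrite i1 leqW.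
  move=> i /andP[i1]; rewrite leq_eqVlt ltnS => /orP[/eqP ->|iN]; first by rewrite wj.
  by apply: Hw; rewrite i1.
have mEj j : measurable (E j).
  rewrite (_ : E j = [set w | no_return n.+1 (X^~ w)] `&`
      ([set w | X n.+1 w = j] `&` [set w | X n.+2 w = k])).
    apply: measurableI; last exact: measurableI.
    exact: measurable_adapted aN.
  by apply/seteqP; split => w /=; [move=> [? []]|move=> [? []]].
pose Z : set T := [set w | X n.+1 w <> k - 1 /\ X n.+1 w <> k + 1 /\ X n.+2 w = k].
have Z0 : Pe Z = 0%E := quenched_step_null n.+1 k.
have mZ : measurable Z.
  rewrite (_ : Z = (~` [set w | X n.+1 w = k - 1]) `&`
    ((~` [set w | X n.+1 w = k + 1]) `&` [set w | X n.+2 w = k]))//.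
  by apply: measurableI; [|apply: measurableI => //]; exact: measurableC.
have EE : Pe (E (k - 1) `|` E (k + 1)) = (taboo e m n.+1 k)%:E.
  transitivity (Pe (E (k - 1)%R) + Pe (E (k + 1)%R))%E.
    rewrite measureU// -subset0 => w [[_ [w1 _]] [_ [w2 _]]].
    by move: w1; rewrite w2; lia.
  rewrite !PE -EFinD /= /rwre_step subrK eqxx addrK.
  have -> : (k == k + 1 + 1) = false by apply/eqP; lia.
  rewrite eqxx; congr (_ + _)%:E; case: ifP => // _; exact: mul0r.
rewrite -EE; apply/eqP; rewrite eq_le; apply/andP; split.
  apply: (@le_trans _ _ (Pe ((E (k - 1) `|` E (k + 1)) `|` Z))).
    apply: le_measure; rewrite ?inE//.
      by apply: measurableU => //; exact: measurableU.
    move=> w /= [Hw wk]; have [w1|w1] := eqVneq (X n.+1 w) (k - 1).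
      by left; left.
    have [w2|w2] := eqVneq (X n.+1 w) (k + 1); first by left; right.
    by right; split; [exact/eqP|split => //; exact/eqP].
  apply: (le_trans (measureU2 _ (measurableU _ _ (mEj _) (mEj _)) mZ)).
  by rewrite [X in (_ + X)%E]Z0 adde0.
apply: le_measure; rewrite ?inE//; first exact: measurableU.
by move=> w /= [[Hw [_ wk]]|[Hw [_ wk]]].
Qed.

Lemma le_return_time (x : nat -> int) (i : nat) :
  (i%:R%:E <= return_time x m :> \bar R)%E <-> no_return i.-1 x.
Proof.
split=> [H j /andP[j1 ji] xj|H].
  have : (i%:R%:E <= (j%:R%:E : \bar R))%E.
    by apply: (le_trans H); apply: ereal_inf_lbound; exists j.
  rewrite lee_fin ler_nat => ij.
  by move: j1 ji; case: i ij {H} => [|n] ij /= j1 ji; lia.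
apply: le_ereal_inf_tmp => _ [j /= [j1 xj] <-]; rewrite lee_fin ler_nat.
rewrite leqNgt; apply/negP => ji; apply: (H j) => //.
by rewrite j1; lia.
Qed.

End quenched_walk.

Section local_time_of_visits.
Context {R : realType}.
Local Open Scope ereal_scope.

Let visit m n k : set (nat -> int) := [set x | no_return m n x /\ x n.+1 = k].

(** Time [n.+1] is counted when it does not exceed the return time, that is when the times 1 to [n]
    avoid [m]; the return itself is thus counted. *)
Lemma local_time_visits (x : nat -> int) (m k : int) :
  local_time x k (return_time x m) =
  \sum_(n <oo) (\1_(visit m n k) x)%:E :> \bar R.
Proof.
rewrite /local_time eseries_mkcond -(nneseries_addn (f := fun i =>
  if i%:R%:E <= return_time x m then ((x i == k)%:R)%:E else 0)); last first.
  by move=> i; case: ifP.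
apply: eq_eseriesr => i _; rewrite addn1 indicE.
have [h|h] := boolP ((i.+1)%:R%:E <= return_time x m).
  congr (_%:R%:E); apply/esym; move: h => /le_return_time /= h.
  have [E|E] := eqVneq (x i.+1) k; first by rewrite mem_set.
  by rewrite memNset// => -[_ /eqP]; exact/negP.
rewrite memNset// => -[h' _]; move/negP: h; apply; exact/le_return_time.
Qed.

Lemma local_time_set_visits (x : nat -> int) (m : int) (s : seq int) : uniq s ->
  local_time_set x [set` s] (return_time x m) =
  \sum_(k <- s) \sum_(n <oo) (\1_(visit m n k) x)%:E :> \bar R.
Proof.
move=> us; rewrite /local_time_set esum_fset//; first last.
- by move=> k _; rewrite local_time_visits; apply: nneseries_ge0 => *; rewrite lee_fin.
- exact: finite_seq.
rewrite -fsbig_seq//.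
by apply: eq_bigr => k _; exact: local_time_visits.
Qed.

End local_time_of_visits.

Section quenched_local_times.
Context {R : realType} {d : measure_display} {T : measurableType d}.
Variables (X : nat -> T -> int) (P : (int -> R) -> int -> probability T R).
Hypothesis HQ : quenched_laws X P.
Local Open Scope ereal_scope.

Lemma quenched_local_timeE (e : int -> R) (m : int) (s : seq int) :
  (forall i, 0 < e i < 1)%R -> uniq s ->
  quenched_local_time X P e m [set` s] =
  \sum_(k <- s) \sum_(n <oo) (taboo e m n k)%:E.
Proof.
move=> e01 us; rewrite /quenched_local_time.
under eq_integral do rewrite local_time_set_visits//.
pose V k n : set T := [set w | no_return m n (X^~ w) /\ X n.+1 w = k].
have VE k n w : (\1_([set x | no_return m n x /\ x n.+1 = k]) (X^~ w) : R) = \1_(V k n) w.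
  by rewrite !indicE.
under eq_integral do under eq_bigr do under eq_eseriesr do rewrite VE.
have mV k n : measurable (V k n).
  rewrite (_ : V k n = [set w | no_return m n (X^~ w)] `&` [set w | X n.+1 w = k])//.
  apply: measurableI; last by case: HQ.
  exact: measurable_adapted HQ _ _ (@adapted_no_return _ _).
have m1 k n : measurable_fun setT (fun w => (\1_(V k n) w)%:E : \bar R).
  by apply/measurable_EFinP; exact: measurable_indic.
rewrite ge0_integral_sum//; first last.
- by move=> k w _; apply: nneseries_ge0 => n _ _; rewrite lee_fin.
- move=> k; apply: ge0_emeasurable_sum => // n w _ _; by rewrite lee_fin.
apply: eq_bigr => k _; rewrite integral_nneseries//.
apply: eq_eseriesr => n _; rewrite integral_indic// setIT.
exact: taboo_probability.
Qed.

Lemma quenched_local_time_le (e : int -> R) (m : int) (s : seq int) (S : int -> R) :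
  (forall i, 0 < e i < 1)%R -> uniq s ->
  (forall i, S i - S (i - 1) = log_ratio (e i))%R ->
  quenched_local_time X P e m [set` s] <=
  (\sum_(k <- s) e m / e k * expR (- (S k - S m)))%:E.
Proof.
move=> e01 us SE; rewrite quenched_local_timeE// -sumEFin.
apply: lee_sum => k _; apply: lime_le.
  by apply: is_cvg_nneseries => n _ _; rewrite lee_fin taboo_ge0.
apply: nearW => N; rewrite sumEFin lee_fin big_mkord.
exact: sum_taboo_le.
Qed.

(** The first step lands on [m - 1] or [m + 1], so these two sites already carry total mass 1. *)
Lemma quenched_local_time_ge1 (e : int -> R) (m : int) (s : seq int) :
  (forall i, 0 < e i < 1)%R -> uniq s -> (m - 1)%R \in s -> (m + 1)%R \in s ->
  1 <= quenched_local_time X P e m [set` s].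
Proof.
move=> e01 us sl sr; rewrite quenched_local_timeE//.
apply: (@le_trans _ _ (\sum_(k <- s) (taboo e m 0 k)%:E)); last first.
  apply: lee_sum => k _.
  apply: (@le_trans _ _ (\sum_(0 <= n < 1) (taboo e m n k)%:E)).
    by rewrite big_nat1.
  by apply: nneseries_lim_ge => n _ _; rewrite lee_fin taboo_ge0.
rewrite (bigD1_seq (m - 1)%R)//= (big_rem (m + 1)%R)//=.
have ne : (m + 1 != m - 1 :> int)%R by apply/eqP; lia.
rewrite ne.
have -> : rwre_step e m (m - 1) = (1 - e m)%R.
  by rewrite /rwre_step eq_sym (negbTE ne) eqxx.
have -> : rwre_step e m (m + 1) = e m by rewrite /rwre_step eqxx.
rewrite addeA -EFinD subrK leeDl//.
by apply: sume_ge0 => k _; rewrite lee_fin rwre_step_ge0.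
Qed.

Lemma measurable_taboo {d'} {U : measurableType d'} (alpha : int -> U -> R) m n k :
  (forall i, measurable_fun setT (alpha i)) ->
  measurable_fun setT (fun w => taboo (alpha^~ w) m n k).
Proof.
move=> ma; elim: n k => [|n ih] k /=.
  rewrite /rwre_step; case: (k == m + 1)%R; first exact: ma.
  by case: (k == m - 1)%R => //; exact: measurable_funB.
apply: measurable_funD; first by case: (k - 1 == m)%R => //; exact: measurable_funM.
case: (k + 1 == m)%R => //; apply: measurable_funM => //.
exact: measurable_funB.
Qed.

(** [quenched_laws] says nothing on how [P e] varies with [e]; measurability comes from the taboo
    probabilities, which are polynomials in the environment. *)
Lemma measurable_quenched_local_time {d'} {U : measurableType d'}
    (alpha : int -> U -> R) m (s : seq int) :
  (forall i, measurable_fun setT (alpha i)) -> (forall i w, 0 < alpha i w < 1)%R ->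
  uniq s ->
  measurable_fun setT (fun w => quenched_local_time X P (alpha^~ w) m [set` s]).
Proof.
move=> ma a01 us.
under eq_fun do rewrite quenched_local_timeE//.
apply: emeasurable_sum => k; apply: ge0_emeasurable_sum.
  by move=> n w _ _; rewrite lee_fin taboo_ge0.
by move=> n _; apply/measurable_EFinP; exact: measurable_taboo.
Qed.

End quenched_local_times.

(** * Averaged local times *)

Section mirrored_walk.
Context {R : realType} {d : measure_display} {T : measurableType d}.
Variables (Q : probability T R) (z : int -> T -> R) (c v : R).
Hypothesis Hz : centered_walk Q z c v.

(* The steps of the mirrored path [k |-> S (- k)] of a path [S] with steps [z]. *)
Definition mirror_steps (i : int) (w : T) : R := - z (1 - i) w.

(** Reversing indices is injective, so independence carries over; the moments do because [z 1] and
    [z 0] have the same law. *)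
Lemma centered_walk_mirror : centered_walk Q mirror_steps c v.
Proof.
have [[mz indep same] bz Ez Ez2] := Hz.
have cI : involutive (fun i : int => 1 - i) by move=> i; lia.
have mN : measurable_fun setT (-%R : R -> R) by exact: measurable_funN.
pose X1 : {RV Q >-> R} := mfun_Sub (mem_set (mz 1)).
pose X0 : {RV Q >-> R} := mfun_Sub (mem_set (mz 0)).
have law (f : R -> R) M : measurable_fun setT f -> (forall w i, `|f (z i w)| <= M) ->
    (\int[Q]_w (f (z 1 w))%:E = \int[Q]_w (f (z 0 w))%:E)%E.
  move=> mf fM; transitivity (\int[distribution Q X1]_e (f e)%:E)%E.
    rewrite integral_distribution//; first exact/measurable_EFinP.
    exact: bounded_integrable (measurableT_comp mf (mz 1)) (fM^~ 1).
  transitivity (\int[distribution Q X0]_e (f e)%:E)%E.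
    by apply: eq_measure_integral => A mA _; exact: same.
  rewrite integral_distribution//; first exact/measurable_EFinP.
  exact: bounded_integrable (measurableT_comp mf (mz 0)) (fM^~ 0).
split.
- split.
  + by move=> i; apply: measurable_funN; exact: mz.
  + move=> s B us mB; rewrite /mirror_steps.
    have mB' i : measurable (-%R @^-1` B (1 - i)).
      by rewrite -[X in measurable X]setTI; exact: mN.
    have := indep [seq 1 - i | i <- s] _ _ mB'.
    rewrite map_inj_uniq ?big_map; last exact: can_inj cI.
    move=> /(_ us) H; transitivity (\prod_(j <- s) Q (z (1 - j)%R @^-1`
        (-%R @^-1` B (1 - (1 - j))%R)))%E; last by under eq_bigr do rewrite cI.
    rewrite -H; congr (Q _); apply/seteqP; split => w /=.
      by move=> Hw _ /mapP[i si ->] /=; rewrite cI; exact: Hw.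
    by move=> Hw i si; have := Hw (1 - i) (map_f _ si); rewrite cI.
  + move=> i B mB.
    have mB' : measurable (-%R @^-1` B).
      by rewrite -[X in measurable X]setTI; exact: mN.
    by have := same (1 - i) _ mB'; rewrite -(same (1 - 0) _ mB').
- by move=> i w; rewrite normrN.
- rewrite /mirror_steps subr0.
  rewrite (law -%R c)//; last by move=> w i; rewrite normrN.
  under eq_integral do rewrite EFinN.
  rewrite integralN ?Ez ?oppe0//.
  exact: (integrable_add_def measurableT (bounded_integrable Q (mz 0) (bz 0))).
- rewrite /mirror_steps subr0; under eq_integral do rewrite sqrrN.
  rewrite (law (fun x => x ^+ 2) (c ^+ 2))// => w i.
  by rewrite normrX; have := bz i w; have := normr_ge0 (z i w); nra.
Qed.

End mirrored_walk.

Section level_series.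
Context {R : realType} {d : measure_display} {T : measurableType d}.
Variables (Q : probability T R) (z : int -> T -> R) (c v G : R).
Hypotheses (Hz : centered_walk Q z c v).
Hypotheses (c_gt0 : 0 < c) (v_gt0 : 0 < v) (v_le : v <= c ^+ 2) (G_ge1 : 1 <= G).

(** The whole series is taken because the level of [D] depends on the environment. *)
Definition level_series (N : nat) (w : T) : \bar R :=
  (\sum_(j <oo) (level_bound z c v G N j w)%:E)%E.

Lemma level_series_ge0 N w : (0 <= level_series N w)%E.
Proof. by apply: nneseries_ge0 => j _ _; rewrite lee_fin level_bound_ge0. Qed.

Lemma measurable_level_series N : measurable_fun setT (level_series N).
Proof.
apply: ge0_emeasurable_sum => [j w _ _|j _]; first by rewrite lee_fin level_bound_ge0.
by apply/measurable_EFinP; exact: (measurable_level_bound Hz).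
Qed.

Lemma integral_level_series N :
  (\int[Q]_w level_series N w <= (level_const c v)%:E)%E.
Proof.
have mL j : measurable_fun setT (fun w => (level_bound z c v G N j w)%:E).
  by apply/measurable_EFinP; exact: (measurable_level_bound Hz).
have L0 j w : (0 <= (level_bound z c v G N j w)%:E)%E by rewrite lee_fin level_bound_ge0.
rewrite integral_nneseries//; apply: lime_le.
  by apply: is_cvg_nneseries => j _ _; exact: integral_ge0.
apply: nearW => J; rewrite -ge0_integral_sum//.
under eq_integral do rewrite sumEFin big_mkord.
by have [] := integral_level_bounds Hz c_gt0 v_gt0 v_le N G_ge1 J.
Qed.

Lemma site_sum_le_series (S : int -> R) (g : R) (B : triplet) N w :
  S 0 = 0 -> (forall k, S k - S (k - 1) = z k w) -> 0 < g -> g <= G ->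
  basic_facts S G g B -> 0 <= vbot B -> - N%:Z <= vleft B -> vright B <= N%:Z ->
  ((site_sum (fun k => expR (- (S k - S (vbot B)))) (vleft B) (vright B))%:E <=
   level_series N w)%E.
Proof.
move=> S0 SE g0 gG HB m0 NB BN.
have [J HJ] := site_sum_le_levels c_gt0 v_gt0 v_le G_ge1 S0 SE g0 gG HB m0 NB BN.
apply: (@le_trans _ _ (\sum_(0 <= j < J.+1) (level_bound z c v G N j w)%:E)%E).
  by rewrite sumEFin lee_fin big_mkord; exact: HJ.
by apply: nneseries_lim_ge => j _ _; rewrite lee_fin level_bound_ge0.
Qed.

End level_series.

Lemma site_sum_flip (R : realType) (f : int -> R) (a b : int) : a <= b ->
  site_sum (fun k => f (- k)) (- b) (- a) = site_sum f a b.
Proof.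
move=> ab; rewrite /site_sum.
have -> : `|- a - - b|%N = `|b - a|%N by congr absz; lia.
rewrite [RHS](reindex_inj rev_ord_inj) /=; apply: eq_bigr => i _.
by congr f; have := ltn_ord i; lia.
Qed.

Section triplet_valued.
Context {d : measure_display} {T : measurableType d}.
Variable B : T -> triplet.
Hypothesis mB : forall V, measurable [set w | B w = V].

(** Triplets are countable, so the event splits according to the value of [B]. *)
Lemma measurable_triplet_preimage (A : triplet -> set T) :
  (forall V, measurable (A V)) -> measurable [set w | A (B w) w].
Proof.
move=> mA; pose tr (p : int * int * int) := Triplet p.1.1 p.1.2 p.2.
rewrite (_ : [set w | _] = \bigcup_p ([set w | B w = tr p] `&` A (tr p))).
  apply: countable_bigcupT_measurable; first exact: countableP.
  by move=> p; exact: measurableI.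
apply/seteqP; split => w /=.
  move=> Aw; exists (vleft (B w), vbot (B w), vright (B w)) => //=.
  by rewrite /tr /=; case: (B w) Aw.
by move=> [p _ [-> ]].
Qed.

Lemma measurable_fun_triplet {d'} {U : measurableType d'} (F : triplet -> T -> U) :
  (forall V, measurable_fun setT (F V)) -> measurable_fun setT (fun w => F (B w) w).
Proof.
move=> mF _ A mA; rewrite setTI.
apply: (measurable_triplet_preimage (A := fun V => F V @^-1` A)) => V.
by rewrite -[X in measurable X]setTI; exact: mF.
Qed.

End triplet_valued.

Section integral_over_valleys.
Context {R : realType} {d : measure_display} {T : measurableType d}.
Variables (Q : probability T R) (z : int -> T -> R) (c v : R).
Hypotheses (Hz : centered_walk Q z c v).
Hypotheses (c_gt0 : 0 < c) (v_gt0 : 0 < v) (v_le : v <= c ^+ 2).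
Variables (S : T -> int -> R) (G g : R).
Hypotheses (S0 : forall w, S w 0 = 0).
Hypotheses (SE : forall w k, S w k - S w (k - 1) = z k w).
Hypotheses (G_ge1 : 1 <= G) (g_gt0 : 0 < g) (gG : g <= G).

Let site_sum_le_two_series (B : triplet) N w : basic_facts (S w) G g B ->
  - N%:Z <= vleft B -> vright B <= N%:Z ->
  ((site_sum (fun k => expR (- (S w k - S w (vbot B)))) (vleft B) (vright B))%:E <=
   level_series z c v G N w + level_series (mirror_steps z) c v G N w)%E.
Proof.
move=> HB NB BN.
have L0 z' : (0 <= level_series z' c v G N w)%E by exact: level_series_ge0.
have [m0|m0] := leP 0 (vbot B).
  apply: (le_trans (site_sum_le_series c_gt0 v_gt0 v_le G_ge1 (S0 w) (SE w)
    g_gt0 gG HB m0 NB BN)).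
  exact: leeDl.
have HB' := basic_facts_flip HB.
have m0' : 0 <= vbot (mirror B) by rewrite /= oppr_ge0 ltW.
have [_ l1 l2 _] := basic_facts_bounds (lt_le_trans ltr01 G_ge1) HB' m0'.
have ab : vleft B <= vright B by move: l1 l2 => /=; lia.
rewrite -(site_sum_flip _ ab).
have S0' : flip (S w) 0 = 0 by rewrite /flip oppr0.
have SE' k : flip (S w) k - flip (S w) (k - 1) = mirror_steps z k w.
  by rewrite /flip /mirror_steps -SE opprB opprB; congr (S w _ - S w _); lia.
have NB' : - N%:Z <= vleft (mirror B) by rewrite lerN2.
have BN' : vright (mirror B) <= N%:Z by rewrite /= lerNl.
have := site_sum_le_series c_gt0 v_gt0 v_le G_ge1 S0' SE' g_gt0 gG HB' m0' NB' BN'.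
rewrite /= /flip opprK => /le_trans; apply.
exact: leeDr.
Qed.

Variables (B : T -> triplet) (F : T -> \bar R) (K : R).
Hypotheses (mB : forall V, measurable [set w | B w = V]).
Hypotheses (mF : measurable_fun setT F) (F0 : forall w, (0 <= F w)%E) (K0 : 0 <= K).

(** The level bounds apply to valleys inside [[-N, N]], and their integrals are bounded
    independently of [N]; the events [A N] increase to the whole space. The factor 2 counts the two
    signs of the bottom. *)
Lemma integral_le_level_const :
  (\forall w \ae Q, basic_facts (S w) G g (B w) /\
     (F w <= (K * site_sum (fun k => expR (- (S w k - S w (vbot (B w)))))
                    (vleft (B w)) (vright (B w)))%:E)%E) ->
  (\int[Q]_w F w <= (2 * K * level_const c v)%:E)%E.
Proof.
move=> HF.
pose A (N : nat) := [set w | - N%:Z <= vleft (B w) /\ vright (B w) <= N%:Z].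
have mA N : measurable (A N).
  apply: (measurable_triplet_preimage mB (A := fun V =>
    [set w | - N%:Z <= vleft V /\ vright V <= N%:Z])) => V.
  have [h|h] := pselect (- N%:Z <= vleft V /\ vright V <= N%:Z).
    by rewrite (_ : [set w | _] = setT)//; apply/seteqP; split.
  by rewrite (_ : [set w | _] = set0)//; apply/seteqP; split.
have mAF N : measurable_fun (A N) F by exact: measurable_funTS.
have ndA : {homo A : n m / (n <= m)%N >-> (n <= m)%O}.
  by move=> n m nm; apply/subsetPset => w [h1 h2]; split; lia.
have UA : \bigcup_N A N = setT.
  apply/seteqP; split => // w _; exists (`|vleft (B w)|%N + `|vright (B w)|%N)%N => //.
  by split; lia.
have cvA := ge0_nondecreasing_set_cvg_integral (mu := Q) ndA mA mAF (fun _ w _ => F0 w).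
rewrite UA in cvA.
rewrite -(cvg_lim _ cvA)//; apply: lime_le; first by apply/cvg_ex; eexists; exact: cvA.
apply: nearW => N.
have Hz' := centered_walk_mirror Hz.
have mL := measurable_level_series G Hz c_gt0 v_gt0 N.
have mL' := measurable_level_series G Hz' c_gt0 v_gt0 N.
have L0 := level_series_ge0 z G c_gt0 v_gt0 N.
have L0' := level_series_ge0 (mirror_steps z) G c_gt0 v_gt0 N.
pose H w : \bar R := (K%:E * (level_series z c v G N w +
  level_series (mirror_steps z) c v G N w))%E.
have mH : measurable_fun setT H.
  by apply: measurable_funeM; exact: emeasurable_funD.
have H0 w : (0 <= H w)%E by rewrite mule_ge0// adde_ge0.
apply: (@le_trans _ _ (\int[Q]_(w in A N) H w)%E).
  apply: ae_ge0_le_integral => //; first exact: measurable_funTS.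
  apply: filterS HF => w [HB Fw] [NB BN]; apply: (le_trans Fw).
  by rewrite EFinM lee_wpmul2l ?lee_fin//; exact: site_sum_le_two_series.
apply: (@le_trans _ _ (\int[Q]_w H w)%E); first exact: ge0_subset_integral.
rewrite ge0_integralZl_EFin//; last first.
- exact: emeasurable_funD.
- by move=> w _; rewrite adde_ge0.
rewrite ge0_integralD//.
have I1 := integral_level_series Hz c_gt0 v_gt0 v_le G_ge1 N.
have I2 := integral_level_series Hz' c_gt0 v_gt0 v_le G_ge1 N.
apply: (@le_trans _ _ (K%:E * ((level_const c v)%:E + (level_const c v)%:E))%E).
  have K0' : (0 <= K%:E)%E by rewrite lee_fin.
  apply: (lee_wpmul2l K0').
  exact: (leeD I1 I2).
by rewrite -EFinD -EFinM lee_fin; lra.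
Qed.

End integral_over_valleys.

(** * Reduction to bounded steps *)

Section clipping.
Context {R : realType}.
Variable h : R.
Hypothesis h_bounds : 0 < h < 1 / 2.

(** The environment stays away from 0 and 1 only almost surely, while the driven chains take steps
    bounded everywhere; clipping changes the environment on a null set only. *)
Definition clip (a : R) : R := Num.max h (Num.min a (1 - h)).

Let h_bds : 0 < h /\ h < 1 / 2. Proof. exact/andP. Qed.

Lemma clip_bounds a : h <= clip a <= 1 - h.
Proof.
have [h0 h2] := h_bds; rewrite /clip le_max lexx /= ge_max.
by apply/andP; split; [lra|rewrite ge_min lexx orbT].
Qed.

Lemma clip_id a : h <= a <= 1 - h -> clip a = a.
Proof. by move=> /andP[ha ah]; rewrite /clip min_l// max_r. Qed.

Lemma log_ratioE (a : R) : 0 < a < 1 -> log_ratio a = ln (1 - a) - ln a.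
Proof. by move=> /andP[a0 a1]; rewrite /log_ratio ln_div// posrE; lra. Qed.

Lemma log_ratio_clip_le a : `|log_ratio (clip a)| <= - ln h.
Proof.
have [h0 h2] := h_bds; have /andP[l u] := clip_bounds a; set x := clip a in l u *.
have lx : ln h <= ln x by rewrite ler_ln ?posrE//; lra.
have l1x : ln h <= ln (1 - x) by rewrite ler_ln ?posrE//; lra.
have x0 : ln x <= 0 by apply: ln_le0; lra.
have x1 : ln (1 - x) <= 0 by apply: ln_le0; lra.
by rewrite log_ratioE; [rewrite ler_norml; lra|lra].
Qed.

Lemma measurable_log_ratio_clip : measurable_fun setT (fun a => log_ratio (clip a)).
Proof.
have [h0 h2] := h_bds.
have mc : measurable_fun setT clip by apply: measurable_maxr => //; exact: measurable_minr.
rewrite (_ : (fun a => _) = fun a => ln (1 - clip a) - ln (clip a)); last first.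
  by apply/funext => a; have /andP[l u] := clip_bounds a; rewrite log_ratioE//; lra.
apply: measurable_funB; apply: (measurableT_comp (@measurable_ln R)) => //.
exact: measurable_funB.
Qed.

End clipping.

Section clipped_environment.
Context {R : realType} {d : measure_display} {T : measurableType d}.
Variables (Q : probability T R) (alpha : int -> {RV Q >-> R}) (eta0 : R).
Hypothesis alpha01 : forall i w, 0 < alpha i w < 1.
Hypothesis alpha_iid : iid alpha.
Hypothesis mean0 : ('E_Q[fun w => log_ratio (alpha 0%R w)] = 0)%E.
Hypothesis var_gt0 : (0 < 'V_Q[fun w => log_ratio (alpha 0%R w)])%E.
Hypothesis eta0_bounds : 0 < eta0 < 1 / 2.
Hypothesis sup_eq : sup [set x : R | Q [set w | x <= alpha 0 w] = 1%E] =
  sup [set x : R | Q [set w | alpha 0 w <= 1 - x] = 1%E].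
Hypothesis sup_ge : eta0 <= sup [set x : R | Q [set w | x <= alpha 0 w] = 1%E].

(** Half of [eta0], because the supremum may fail to be attained: some [x > eta0 / 2] does satisfy
    the almost sure bound. *)
Local Notation h := (eta0 / 2).

Let h_bounds : 0 < h < 1 / 2.
Proof. by have /andP[? ?] := eta0_bounds; apply/andP; split; lra. Qed.

Let malpha i : measurable_fun setT (alpha i). Proof. exact: measurable_funP. Qed.

Let lt_sup (A : set R) : eta0 <= sup A -> exists2 x, A x & h < x.
Proof.
move=> eA; have /andP[e0 _] := eta0_bounds.
have hA : has_sup A.
  (* A set without supremum has [sup] equal to 0, against [eta0 > 0]. *)
  by apply: contrapT => /sup_out A0; move: eA; rewrite A0; lra.
have h0 : 0 < eta0 / 2 by lra.
have [x Ax lx] := sup_adherent h0 hA; exists x => //.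
by lra.
Qed.

Let ae_clip0 : \forall w \ae Q, h <= alpha 0 w <= 1 - h.
Proof.
have m1 x : measurable [set w | x <= alpha 0 w].
  rewrite (_ : [set w | _] = alpha 0 @^-1` `[x, +oo[%classic).
    by rewrite -[X in measurable X]setTI; exact: malpha.
  by apply/seteqP; split => w /=; rewrite in_itv /= andbT.
have m2 x : measurable [set w | alpha 0 w <= x].
  rewrite (_ : [set w | _] = alpha 0 @^-1` `]-oo, x]%classic).
    by rewrite -[X in measurable X]setTI; exact: malpha.
  by apply/seteqP; split => w /=; rewrite in_itv.
have ae1 (A : set T) : measurable A -> Q A = 1%E -> \forall w \ae Q, A w.
  move=> mA QA; suff : Q.-negligible (~` A) by [].
  rewrite negligibleP; last exact: measurableC.
  by rewrite [LHS]probability_setC// QA subee.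
have [x Qx hx] := lt_sup sup_ge.
have [|y Qy hy] := @lt_sup [set x | Q [set w | alpha 0 w <= 1 - x] = 1%E].
  by rewrite -sup_eq.
apply: filterS2 (ae1 _ (m1 x) Qx) (ae1 _ (m2 (1 - y)) Qy) => w /= w1 w2.
by apply/andP; split; lra.
Qed.

Lemma ae_clip : \forall w \ae Q, forall i, h <= alpha i w <= 1 - h.
Proof.
pose A : set R := ~` [set a | h <= a <= 1 - h].
have mA : measurable A.
  by apply: measurableC; rewrite (_ : [set a | _] = `[h, 1 - h]%classic).
have mAi i : measurable (alpha i @^-1` A).
  by rewrite -[X in measurable X]setTI; exact: malpha.
have A0 i : Q.-negligible (alpha i @^-1` A).
  rewrite negligibleP//; have [_ /(_ i A mA) same] := alpha_iid.
  by rewrite [LHS]same -negligibleP.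
suff : \forall w \ae Q, forall n i, pickle i = n -> h <= alpha i w <= 1 - h.
  by apply: filterS => w H i; exact: H (erefl _).
apply: ae_foralln => n.
have [[i ni]|ni] := pselect (exists i : int, pickle i = n).
  apply: (negligibleS _ (A0 i)) => w /= H Aw; apply: H => j jn.
  by have -> : j = i by apply: (pcan_inj pickleK); rewrite ni.
by apply: aeW => w i in'; exfalso; apply: ni; exists i.
Qed.

Definition clipped_steps (i : int) (w : T) : R := log_ratio (clip h (alpha i w)).

Lemma centered_clipped_steps : exists c v, [/\ 0 < c, 0 < v, v <= c ^+ 2 &
  centered_walk Q clipped_steps c v].
Proof.
have mxi i : measurable_fun setT (clipped_steps i).
  exact: (measurableT_comp (measurable_log_ratio_clip h_bounds)).
have bxi i w : `|clipped_steps i w| <= - ln h by exact: log_ratio_clip_le.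
have mlr : measurable_fun setT (fun w => log_ratio (alpha 0 w)).
  under eq_fun do rewrite log_ratioE//.
  apply: measurable_funB; apply: (measurableT_comp (@measurable_ln R)) => //.
  exact: measurable_funB.
have aexi : \forall w \ae Q, log_ratio (alpha 0 w) = clipped_steps 0 w.
  by apply: filterS ae_clip => w /(_ 0) H; rewrite /clipped_steps clip_id.
have c0 : 0 < - ln h.
  by have /andP[? ?] := h_bounds; rewrite oppr_gt0; apply: ln_lt0; apply/andP; split; lra.
have mean : (\int[Q]_w (clipped_steps 0 w)%:E = 0)%E.
  rewrite -mean0 unlock; apply: ae_eq_integral => //; [exact/measurable_EFinP..|].
  by apply: filterS aexi => w /= ->.
have var : (\int[Q]_w (clipped_steps 0 w ^+ 2)%:E = 'V_Q[fun w => log_ratio (alpha 0%R w)])%E.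
  rewrite /variance unlock mean0 /= unlock; apply: ae_eq_integral => //.
  - by apply/measurable_EFinP; exact: measurable_funX.
  - apply/measurable_EFinP => /=.
    by apply: measurable_funM; exact: measurable_funB.
  - apply: filterS aexi => w /= E _.
    by rewrite (_ : _ ^+ 2 = (log_ratio (alpha 0 w) - 0) * (log_ratio (alpha 0 w) - 0))//
      subr0 E expr2.
have x2 w : 0 <= clipped_steps 0 w ^+ 2 <= (- ln h) ^+ 2.
  by rewrite sqr_ge0 -[X in X <= _]real_normK ?num_real// lerXn2r// nnegrE// ltW.
have vle : (\int[Q]_w (clipped_steps 0 w ^+ 2)%:E <= ((- ln h) ^+ 2)%:E)%E.
  rewrite -[leRHS](integral_probability_cst Q).
  apply: ge0_le_integral => //.
  - by move=> w _; rewrite lee_fin; case/andP: (x2 w).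
  - by apply/measurable_EFinP; exact: measurable_funX.
  - by move=> w _; rewrite lee_fin; case/andP: (x2 w).
have v0 := var_gt0; rewrite -var in v0.
(* The second moment is positive and at most [(- ln h) ^+ 2], hence a real number, which becomes
   [v]. *)
move: vle v0; case E : (\int[Q]_w _)%E => [v| |]// vle v0.
exists (- ln h), v; split => //.
split => //; split => // [s B us mB|i B mB].
- have [indep _] := alpha_iid.
  pose B' i := (fun a => log_ratio (clip h a)) @^-1` B i.
  have mB' i : measurable (B' i).
    rewrite -[X in measurable X]setTI; exact: (measurable_log_ratio_clip h_bounds).
  by rewrite -(indep s B' us mB').
- have [_ same] := alpha_iid.
  apply: (same i ((fun a => log_ratio (clip h a)) @^-1` B)).
  by rewrite -[X in measurable X]setTI; exact: (measurable_log_ratio_clip h_bounds).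
Qed.

End clipped_environment.

Definition site_seq (V : triplet) : seq int :=
  if vleft V <= vright V then
    [seq vleft V + i%:Z | i <- iota 0 `|vright V - vleft V|%N.+1]
  else [::].

Lemma sitesE V : sites V = [set` site_seq V].
Proof.
rewrite /sites /site_seq; case: ifP => lr; apply/seteqP; split => k.
- by move=> /andP[l u]; apply/mapP; exists `|k - vleft V|%N; rewrite ?mem_iota; lia.
- move=> /mapP[i]; rewrite mem_iota add0n => /andP[_ ik] ->.
  by apply/andP; split; lia.
- by move=> /andP[l u]; lia.
- by [].
Qed.

Lemma site_seq_uniq V : uniq (site_seq V).
Proof.
rewrite /site_seq; case: ifP => // _; rewrite map_inj_uniq ?iota_uniq// => i j.
by lia.
Qed.

Lemma sum_site_seq (R : realType) (f : int -> R) V : vleft V <= vright V ->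
  \sum_(k <- site_seq V) f k = site_sum f (vleft V) (vright V).
Proof.
by move=> lr; rewrite /site_seq lr big_map /site_sum -(big_mkord xpredT (fun i => f (_ + i%:Z)))
  /index_iota subn0.
Qed.

Lemma potential0 (R : realType) (e : int -> R) : potential e 0 = 0.
Proof. exact: big_geq. Qed.

(** * Depth scales and the final estimate *)

Section depth_scales.
Context {R : realType}.

(** Makes the iterated logarithm positive and the depth at least 1. *)
Lemma ln_gt1 n : (3 < n)%N -> 1 < ln n%:R :> R.
Proof.
move=> n3; rewrite -[X in X < _]expRK ltr_ln ?posrE ?expR_gt0 ?ltr0n ?(ltn_trans _ n3)//.
apply: (@lt_le_trans _ _ 4); last by rewrite ler_nat.
(* [expR 1 < 4] follows from [expR (- (1 / 4)) >= 3 / 4] and [(3 / 4) ^+ 4 = 81 / 256 > 1 / 4]. *)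
have h1 := expR_ge1Dx (- (1 / 4) : R); have h2 := expR_gt0 (- (1 / 4) : R).
have h3 : expR (1 : R) = (expR (- (1 / 4)) ^+ 4)^-1.
  by rewrite -expRM_natl -expRN; congr expR; lra.
rewrite h3 invf_plt ?posrE ?exprn_gt0//.
have h4 : (3 / 4) ^+ 4 <= expR (- (1 / 4) : R) ^+ 4 by rewrite lerXn2r ?nnegrE//; lra.
by apply: lt_le_trans h4; lra.
Qed.

Lemma Gamma_bounds (gamma : R) n : 0 < gamma -> (3 < n)%N ->
  [/\ 1 <= Gamma gamma n, 0 < gamma * iterlog 2 n%:R &
      gamma * iterlog 2 n%:R <= Gamma gamma n].
Proof.
move=> g0 n3; have l1 := @ln_gt1 _ n3.
have l2 : 0 < gamma * iterlog 2 (n%:R : R) by rewrite mulr_gt0//= ln_gt0.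
by rewrite /Gamma; split => //; lra.
Qed.

End depth_scales.

Section averaged_local_time.
Context {R : realType} {d1 : measure_display} {Omega1 : measurableType d1}.
Variables (Q : probability Omega1 R) (alpha : int -> {RV Q >-> R}) (h c v : R).
Hypotheses (alpha01 : forall i w, 0 < alpha i w < 1) (h_bounds : 0 < h < 1 / 2).
Hypothesis alpha_bounds : \forall w \ae Q, forall i, h <= alpha i w <= 1 - h.
Hypothesis Hz : centered_walk Q (fun i w => log_ratio (clip h (alpha i w))) c v.
Hypotheses (c_gt0 : 0 < c) (v_gt0 : 0 < v) (v_le : v <= c ^+ 2).
Context {d2 : measure_display} {Omega2 : measurableType d2}.
Variables (X : nat -> Omega2 -> int)
  (P : (int -> R) -> int -> probability Omega2 R).
Hypothesis HQ : quenched_laws X P.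
Variables (gamma : R) (B : nat -> Omega1 -> triplet) (n : nat).
Hypotheses (gamma_gt0 : 0 < gamma) (HB : basic_valley_choice gamma alpha B).
Hypothesis n3 : (3 < n)%N.

Local Notation EL := (fun w => quenched_local_time X P (fun i => alpha i w)
  (vbot (B n w)) (sites (B n w))).

Lemma averaged_local_time_ge0 w : (0 <= EL w)%E.
Proof.
apply: integral_ge0 => w' _; apply: esum_ge0 => k _.
by apply: nneseries_ge0 => *; rewrite lee_fin.
Qed.

Lemma measurable_averaged_local_time : measurable_fun setT EL.
Proof.
have [mB _] := HB n3.
apply: (measurable_fun_triplet mB (F := fun V w =>
  quenched_local_time X P (fun i => alpha i w) (vbot V) (sites V))) => V.
rewrite sitesE; apply: (measurable_quenched_local_time HQ) => //.
exact: site_seq_uniq.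
Qed.

Let S w := potential (fun i => clip h (alpha i w)).

(** Deep valleys exist almost surely, so the chosen triplet is almost surely a genuine basic
    valley. *)
Lemma ae_basic_facts : \forall w \ae Q, (forall i, h <= alpha i w <= 1 - h) /\
  S w = potential (fun i => alpha i w) /\
  basic_facts (S w) (Gamma gamma n) (gamma * iterlog 2 n%:R) (B n w).
Proof.
have [G1 g0 gG] := Gamma_bounds gamma_gt0 n3.
have G0 : 0 < Gamma gamma n by lra.
have S0 w : S w 0 = 0 by exact: potential0.
have SE w k : S w k - S w (k - 1) = log_ratio (clip h (alpha k w)).
  exact: potentialB.
have ND : \forall w \ae Q, exists V,
    deep_valley (S w) (Gamma gamma n) (gamma * iterlog 2 n%:R) V.
  exact: (negligible_no_deep_valley Hz c_gt0 v_gt0 v_le S0 SE G0 g0).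
apply: filterS2 alpha_bounds ND => w aw [V HV].
have ES : S w = potential (fun i => alpha i w).
  by rewrite /S; congr potential; apply/funext => i; rewrite clip_id.
split => //; split => //; apply: basic_valley_facts.
have [_ HBw] := HB n3; rewrite ES; apply: HBw.
by rewrite ES in HV; exact: exists_basic_valley G0 g0 _ HV.
Qed.

Let ae_bounds : \forall w \ae Q, (1 <= EL w)%E /\
  basic_facts (S w) (Gamma gamma n) (gamma * iterlog 2 n%:R) (B n w) /\
  (EL w <= (h^-1 * site_sum (fun k => expR (- (S w k - S w (vbot (B n w)))))
                    (vleft (B n w)) (vright (B n w)))%:E)%E.
Proof.
apply: filterS ae_basic_facts => w [aw [ES HBw]].
have [_ [_ [_ [_ lm _ _] _ [_ mr _ _] _]]] := HBw.
have us := site_seq_uniq (B n w).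
have a01 i : 0 < alpha i w < 1 by exact: alpha01.
split.
  rewrite sitesE; apply: (quenched_local_time_ge1 HQ) => //.
    suff : (sites (B n w)) (vbot (B n w) - 1) by rewrite sitesE.
    by rewrite /sites /=; lia.
  suff : (sites (B n w)) (vbot (B n w) + 1) by rewrite sitesE.
  by rewrite /sites /=; lia.
split => //; rewrite sitesE.
apply: (le_trans (quenched_local_time_le HQ _ a01 us (S := S w) _)).
  by move=> i; rewrite ES potentialB.
rewrite lee_fin -sum_site_seq ?mulr_sumr; last by lia.
apply: ler_sum => k _; apply: ler_wpM2r; first exact: expR_ge0.
(* The ratio of environment values at the bottom and at [k] is at most [h^-1]. *)
have /andP[h0 _] := h_bounds; have /andP[hk _] := aw k.
have /andP[m0 m1] := a01 (vbot (B n w)).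
rewrite ler_pdivrMr; last by lra.
apply: (@le_trans _ _ 1); first exact: ltW.
by rewrite ler_pdivlMl ?mulr1.
Qed.

Lemma averaged_local_time_ge1 : (1 <= \int[Q]_w EL w)%E.
Proof.
rewrite -[leLHS](integral_probability_cst Q); apply: ae_ge0_le_integral => //.
- by move=> w _; exact: averaged_local_time_ge0.
- exact: measurable_averaged_local_time.
- by apply: filterS ae_bounds => w [].
Qed.

Lemma averaged_local_time_le : (\int[Q]_w EL w <= (2 * h^-1 * level_const c v)%:E)%E.
Proof.
have [G1 g0 gG] := Gamma_bounds gamma_gt0 n3.
have /andP[h0 _] := h_bounds; have [mB _] := HB n3.
apply: (integral_le_level_const Hz c_gt0 v_gt0 v_le (S := S) _ _ G1 g0 gG mB) => //.
- by move=> w; exact: potential0.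
- by move=> w k; exact: potentialB.
- exact: measurable_averaged_local_time.
- by move=> w; exact: averaged_local_time_ge0.
- by rewrite invr_ge0 ltW.
- by apply: filterS ae_bounds => w [].
Qed.

End averaged_local_time.

Lemma markov_ge0 d (T : measurableType d) (R : realType) (Q : probability T R)
    (f : T -> \bar R) (t C : R) : measurable_fun setT f -> (forall w, 0 <= f w)%E ->
  0 < t -> (\int[Q]_w f w <= C%:E)%E ->
  (Q [set w | t%:E < f w] <= (C / t)%:E)%E.
Proof.
move=> mf f0 t0 If; set A := [set w | _].
have mA : measurable A.
  by have := emeasurable_fun_o_infty measurableT mf t%:E; rewrite setTI.
rewrite EFinM lee_pdivlMr// muleC.
apply: (le_trans _ If); apply: (@le_trans _ _ (\int[Q]_(w in A) f w)%E); last first.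
  exact: ge0_subset_integral.
rewrite -integral_cst//; apply: ge0_le_integral => //.
- by move=> w _; rewrite lee_fin ltW.
- exact: measurable_funTS.
- by move=> w /ltW.
Qed.

Theorem proposition3p12 (R : realType)
    (d1 : measure_display) (Omega1 : measurableType d1)
    (Q : probability Omega1 R) (alpha : int -> {RV Q >-> R}) (eta0 : R)
    (alpha01 : forall i w, 0 < alpha i w < 1)
    (alpha_iid : iid alpha)
    (mean0 : ('E_Q[fun w => log_ratio (alpha 0%R w)] = 0)%E)
    (var_gt0 : (0 < 'V_Q[fun w => log_ratio (alpha 0%R w)])%E)
    (eta0_bounds : 0 < eta0 < 1 / 2)
    (sup_eq : sup [set x : R | Q [set w | x <= alpha 0 w] = 1%E] =
              sup [set x : R | Q [set w | alpha 0 w <= 1 - x] = 1%E])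
    (sup_ge : eta0 <= sup [set x : R | Q [set w | x <= alpha 0 w] = 1%E]) :
  exists2 c1 : R, 0 < c1 &
  forall (gamma : R), 0 < gamma ->
  forall (B : nat -> Omega1 -> triplet), basic_valley_choice gamma alpha B ->
  forall (d2 : measure_display) (Omega2 : measurableType d2)
    (X : nat -> Omega2 -> int) (P : (int -> R) -> int -> probability Omega2 R),
  quenched_laws X P ->
  let EL n w := quenched_local_time X P (fun i => alpha i w)
                  (vbot (B n w)) (sites (B n w)) in
  (forall n : nat, (3 < n)%N -> (1 <= \int[Q]_w EL n w <= c1%:E)%E) /\
  (forall theta : nat -> R,
     (forall n, 0 < theta n) -> {homo theta : k l / (k <= l)%N >-> k <= l} ->
     forall n : nat, (3 < n)%N ->
       (Q [set w | (theta n)%:E < EL n w] <= (c1 / theta n)%:E)%E).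
Proof.
have [c [v [c_gt0 v_gt0 v_le Hz]]] := centered_clipped_steps alpha01 alpha_iid
  mean0 var_gt0 eta0_bounds sup_eq sup_ge.
have bounds := ae_clip alpha_iid eta0_bounds sup_eq sup_ge.
have h_bounds : 0 < eta0 / 2 < 1 / 2.
  by move/andP: eta0_bounds => [? ?]; apply/andP; split; lra.
(* [C] depends on [eta0] and on the bound and variance of the clipped steps, but not on [gamma] or
   [n]; passing to its absolute value plus 1 makes positivity immediate. *)
set C := 2 * (eta0 / 2)^-1 * level_const c v.
exists (`|C| + 1) => [|gamma gamma_gt0 B HB d2 Omega2 X P HQ EL]; first exact: ltr_wpDl.
have EL_le n : (3 < n)%N -> (\int[Q]_w EL n w <= (`|C| + 1)%:E)%E.
  move=> n3; apply: (le_trans (averaged_local_time_le alpha01 h_bounds bounds Hz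
    c_gt0 v_gt0 v_le HQ gamma_gt0 HB n3)).
  by rewrite lee_fin -/C; have := ler_norm C; lra.
split=> [n n3|theta theta_gt0 _ n n3].
  by rewrite EL_le// andbT; exact: (averaged_local_time_ge1 alpha01 h_bounds bounds Hz
    c_gt0 v_gt0 v_le HQ gamma_gt0 HB n3).
apply: markov_ge0 => //; last exact: EL_le.
  exact: (measurable_averaged_local_time alpha01 HQ HB n3).
by move=> w; exact: averaged_local_time_ge0.
Qed.
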